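(* If ${}_{K_0}F_{K_1}$ is a simple two-sided vector space (of rank 2), then $\Lambda_{00}$ is a Dedekind domain of (Gelfand-Kirillov) dimension 1, where $\Lambda=\mathbb S^{nc}(F)[g^{-1}]$.
   Context: All fields have characteristic $\ne 2$. $F$ is a field and $K_0,K_1\subset F$ are subfields of index 2 such that the $K_0$-$K_1$-bimodule $F$ is simple. Integer subscripts on fields are read modulo 2, so $K_i=K_{i\bmod 2}$; $\mathrm{Gal}(F/K_i)=\{1,\tau_i\}$. A $\mathbb Z$-indexed algebra $C$ consists of abelian groups $C_{ij}$ ($i,j\in\mathbb Z$) with associative biadditive multiplications $C_{ij}\times C_{jl}\to C_{il}$ and local units $e_i\in C_{ii}$; it is identified with the ring $\bigoplus_{i,j}C_{ij}$, where the product of $C_{ij}$ and $C_{rl}$ is $0$ for $j\neq r$. Tensor algebra $T=T(F)$: $T_{ij}=0$ for $i>j$, $T_{ii}=K_i$, and for $i<j$, $T_{ij}=F\otimes_{K_{i+1}}F\otimes_{K_{i+2}}\cdots\otimes_{K_{j-1}}F$ ($j-i$ factors), with multiplication given by the tensor product. Noncommutative symmetric algebra: $A=\mathbb S^{nc}(F)=T/R$, where $R$ is the two-sided ideal generated by $h_i=1\otimes_{K_{i+1}}1+w_{i+1}^{-1}\otimes_{K_{i+1}}w_{i+1}\in T_{i,i+2}$ $(i\in\mathbb Z)$, with $w_{i+1}\in F\setminus K_{i+1}$, $w_{i+1}^2\in K_{i+1}$ (equivalently $0\ne w_{i+1}$, $\tau_{i+1}(w_{i+1})=-w_{i+1}$).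 The $w_{i+1}$ are chosen with $w_{i+1}\notin K_i$, so that $h_i$ and $g_i:=w_{i+1}h_i=h_iw_{i+1}$ form a $K_i$-basis of $Fh_i=h_iF\subset T_{i,i+2}$. The images $g_i\in A_{i,i+2}$ form a normal family of degree 2: $g_iA_{i+2,j+2}=A_{ij}g_j$ for all $i,j$. It is known that $A$ is a noetherian domain. $\Lambda=A[g^{-1}]$ is the $\mathbb Z$-indexed algebra obtained by formally inverting all the $g_i$ (Ore localisation at the products $g_ig_{i+2}\cdots g_{i+2n-2}$). Elements of $\Lambda_{ij}$ have the form $ag^{-r}$ with $a\in A_{i,j+2r}$ and $g^{-r}=(g_jg_{j+2}\cdots g_{j+2r-2})^{-1}$. $\Lambda_{00}$ is a ring. A (possibly noncommutative) ring is a Dedekind domain if it is a (left and right) hereditary noetherian domain which is an Asano order, i.e. every non-zero two-sided ideal is invertible in its ring of fractions. The dimension of $\Lambda_{00}$ is computed with respect to $K_0$-dimension along the ascending filtration $\Lambda_{00}^n=A_{0,2n}g^{-n}$, $n\ge0$ (for which $\Lambda_{00}^n\Lambda_{00}^1=\Lambda_{00}^1\Lambda_{00}^n=\Lambda_{00}^{n+1}$): the Hilbert function is $f_{\Lambda_{00}}(n)=\dim_{K_0}(\Lambda_{00}^n/\Lambda_{00}^{n-1})$, with $\Lambda_{00}^{-1}=0$, and $\dim\Lambda_{00}=\deg f_{\Lambda_{00}}(n)+1$ (degree of the polynomial agreeing with $f_{\Lambda_{00}}$ for $n\gg0$, when this is non-zero). *)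

(* Defs.v *)
From HB Require Import structures.
From mathcomp Require Import all_boot all_order all_algebra.
From mathcomp Require Import generic_quotient ring_quotient.
From mathcomp.multinomials Require Import freeg.
From mathcomp Require Import boolp classical_sets.

Set Implicit Arguments.
Unset Strict Implicit.
Unset Printing Implicit Defensive.

Import GRing.Theory.
Local Open Scope ring_scope.
Local Open Scope quotient_scope.
Local Open Scope classical_set_scope.

(** Dimension over the subfield [K], acting on [M] through [act], of [V / W]:
    the classes of the [b t] form a basis. *)
Definition has_dim (F : fieldType) (K : {pred F}) (M : zmodType)
    (act : F -> M -> M) (V W : set M) (d : nat) : Prop :=
  exists2 b : 'I_d -> M, (forall t, V (b t)) &
    forall x, V x -> exists! c : {ffun 'I_d -> F},
      (forall t, c t \in K) /\ W (x - \sum_t act (c t) (b t)).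

Definition has_index (F : fieldType) (K : {pred F}) (d : nat) : Prop :=
  has_dim K *%R [set: F] [set 0] d.

(** Dimension along the ascending filtration [V], with [V (-1) = 0]: one plus
    the degree of the non-zero polynomial giving the Hilbert function for large
    arguments. *)
Definition filtration_dim (F : fieldType) (K : {pred F}) (M : zmodType)
    (act : F -> M -> M) (V : nat -> set M) (d : nat) : Prop :=
  exists hilb : nat -> nat,
    (forall n, has_dim K act (V n)
                 (if n is m.+1 then V m else [set 0]) (hilb n)) /\
    exists p : {poly rat},
      [/\ p != 0,
          exists N, forall n, (N <= n)%N -> p.[n%:R] = (hilb n)%:R &
          d = (size p).-1.+1].

Section Dedekind.

Definition is_domain (R : pzRingType) : Prop :=
  1 != 0 :> R /\ forall x y : R, x * y = 0 -> x = 0 \/ y = 0.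

Definition left_ideal (R : pzRingType) (I : set R) : Prop :=
  [/\ I 0, forall x y, I x -> I y -> I (x + y) & forall a x, I x -> I (a * x)].

Definition two_sided_ideal (R : pzRingType) (I : set R) : Prop :=
  left_ideal I /\ forall a x, I x -> I (x * a).

Definition left_noetherian (R : pzRingType) : Prop :=
  forall I : set R, left_ideal I ->
    exists n (a : 'I_n -> R),
      I = [set x | exists c : 'I_n -> R, x = \sum_t c t * a t].

(** Module morphisms from the left ideal [I] to [M] are represented by maps on
    [R] whose values outside [I] are irrelevant. *)
Definition linear_on (R : pzRingType) (M : lmodType R) (I : set R)
    (f : R -> M) : Prop :=
  (forall x y, I x -> I y -> f (x + y) = f x + f y) /\
  (forall a x, I x -> f (a * x) = a *: f x).

Definition projective_ideal (R : pzRingType) (I : set R) : Prop :=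
  forall (M N : lmodType R) (p : {linear M -> N}) (f : R -> N),
    (forall y, exists x, p x = y) -> linear_on I f ->
    exists2 f' : R -> M, linear_on I f' & forall x, I x -> p (f' x) = f x.

Definition left_hereditary (R : pzRingType) : Prop :=
  forall I : set R, left_ideal I -> projective_ideal I.

(** The right-handed versions are the left-handed ones for the converse ring. *)
Definition noetherian (R : pzRingType) : Prop :=
  left_noetherian R /\ left_noetherian R^c.

Definition hereditary (R : pzRingType) : Prop :=
  left_hereditary R /\ left_hereditary R^c.

Definition regular (R : pzRingType) (x : R) : Prop :=
  GRing.lreg x /\ GRing.rreg x.

Definition is_ring_of_fractions (R : pzRingType) (Q : unitRingType)
    (f : {rmorphism R -> Q}) : Prop :=
  [/\ injective f,
      forall s, regular s -> f s \is a GRing.unit,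
      forall q, exists a s, regular s /\ q = f a * (f s)^-1 &
      forall q, exists a s, regular s /\ q = (f s)^-1 * f a].

Definition prod_set (Q : pzRingType) (I J : set Q) : set Q :=
  [set q | exists n (a b : 'I_n -> Q),
     [/\ forall t, I (a t), forall t, J (b t) & q = \sum_t a t * b t]].

Definition sub_bimodule (R Q : pzRingType) (f : R -> Q) (J : set Q) : Prop :=
  [/\ J 0, forall x y, J x -> J y -> J (x + y),
      forall a x, J x -> J (f a * x) & forall a x, J x -> J (x * f a)].

Definition invertible_in (R Q : pzRingType) (f : R -> Q) (I : set R) : Prop :=
  exists J : set Q, [/\ sub_bimodule f J,
    prod_set (f @` I) J = range f & prod_set J (f @` I) = range f].

Definition asano_order (R : pzRingType) : Prop :=
  exists (Q : unitRingType) (f : {rmorphism R -> Q}),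
    is_ring_of_fractions f /\
    forall I : set R, two_sided_ideal I -> I <> [set 0] -> invertible_in f I.

Definition dedekind_domain (R : pzRingType) : Prop :=
  [/\ is_domain R, noetherian R, hereditary R & asano_order R].

End Dedekind.

Record zalg : Type := ZAlg {
  zhom :> int -> int -> zmodType;
  zmul : forall i j l, zhom i j -> zhom j l -> zhom i l;
  zone : forall i, zhom i i;
  zmulA : forall i j l m (a : zhom i j) (b : zhom j l) (c : zhom l m),
    zmul a (zmul b c) = zmul (zmul a b) c;
  zmul1l : forall i j (a : zhom i j), zmul (zone i) a = a;
  zmul1r : forall i j (a : zhom i j), zmul a (zone j) = a;
  zmulDl : forall i j l (a b : zhom i j) (c : zhom j l),
    zmul (a + b) c = zmul a c + zmul b c;
  zmulDr : forall i j l (a : zhom i j) (b c : zhom j l),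
    zmul a (b + c) = zmul a b + zmul a c }.

Arguments zone {z} i.

Section ZAlgTheory.
Variable C : zalg.

Lemma zmul0l i j l (a : C j l) : zmul (0 : C i j) a = 0.
Proof. by apply: (addrI (zmul 0 a)); rewrite -zmulDl !addr0. Qed.

Lemma zmul0r i j l (a : C i j) : zmul a (0 : C j l) = 0.
Proof. by apply: (addrI (zmul a 0)); rewrite -zmulDr !addr0. Qed.

Lemma zmulNl i j l (a : C i j) (b : C j l) : zmul (- a) b = - zmul a b.
Proof. by apply: (addrI (zmul a b)); rewrite -zmulDl !subrr zmul0l. Qed.

Lemma zmulNr i j l (a : C i j) (b : C j l) : zmul a (- b) = - zmul a b.
Proof. by apply: (addrI (zmul a b)); rewrite -zmulDr !subrr zmul0r. Qed.

Lemma zmulBl i j l (a b : C i j) (c : C j l) :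
  zmul (a - b) c = zmul a c - zmul b c.
Proof. by rewrite zmulDl zmulNl. Qed.

Lemma zmulBr i j l (a : C i j) (b c : C j l) :
  zmul a (b - c) = zmul a b - zmul a c.
Proof. by rewrite zmulDr zmulNr. Qed.

End ZAlgTheory.

Definition zcorner (C : zalg) (i : int) : Type := C i i.
HB.instance Definition _ (C : zalg) i := GRing.Zmodule.on (zcorner C i).
HB.instance Definition _ (C : zalg) i :=
  GRing.Zmodule_isPzRing.Build (zcorner C i)
    (@zmulA C i i i i) (@zmul1l C i i) (@zmul1r C i i)
    (@zmulDl C i i i) (@zmulDr C i i i).

Definition zmorphism (A B : zalg) (f : forall i j, A i j -> B i j) : Prop :=
  [/\ forall i j (a b : A i j), f i j (a + b) = f i j a + f i j b,
      forall i j l (a : A i j) (b : A j l),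
        f i l (zmul a b) = zmul (f i j a) (f j l b) &
      forall i, f i i (zone i) = zone i].

Definition zinverse (C : zalg) i j (a : C i j) (b : C j i) : Prop :=
  zmul a b = zone i /\ zmul b a = zone j.

Section Quotient.
Variables (C : zalg) (r : forall i j, set (C i j)).

Definition zideal (J : forall i j, set (C i j)) : Prop :=
  [/\ forall i j, J i j 0,
      forall i j a b, J i j a -> J i j b -> J i j (a - b),
      forall i j l (a : C i j) b, J j l b -> J i l (zmul a b) &
      forall i j l a (b : C j l), J i j a -> J i l (zmul a b)].

Definition zideal_gen i j : set (C i j) :=
  [set a | forall J, zideal J -> (forall i j a, @r i j a -> J i j a) -> J i j a].

Lemma zideal_gen_ideal : zideal zideal_gen.
Proof.
split=> [i j|i j a b Ia Ib|i j l a b Ib|i j l a b Ia] J J_id rJ;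
  case: (J_id) => J0 JB Jl Jr.
- exact: J0.
- by apply: JB; [apply: Ia|apply: Ib].
- by apply: Jl; apply: Ib.
- by apply: Jr; apply: Ia.
Qed.

Definition zideal_pred i j : {pred C i j} := fun a => `[< zideal_gen a >].

Fact zideal_pred_closed i j : zmod_closed (@zideal_pred i j).
Proof.
case: zideal_gen_ideal => I0 IB _ _.
by split=> [|a b /asboolP Ia /asboolP Ib]; apply/asboolP; [exact: I0|exact: IB].
Qed.
HB.instance Definition _ i j :=
  GRing.isZmodClosed.Build (C i j) (@zideal_pred i j) (@zideal_pred_closed i j).

Definition zquot_hom (i j : int) : zmodType :=
  Quotient.quot (@zideal_pred i j : zmodClosed _).

Definition zpi i j (a : C i j) : zquot_hom i j := \pi a.

Definition zquot_mul i j l (a : zquot_hom i j) (b : zquot_hom j l) :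
  zquot_hom i l := zpi (zmul (repr a) (repr b)).

Lemma zpi_eq i j (a b : C i j) : zideal_gen (a - b) <-> zpi a = zpi b.
Proof.
split=> [Iab|/eqP]; first by apply/eqP; rewrite -Quotient.idealrBE; apply/asboolP.
by rewrite -Quotient.idealrBE => /asboolP.
Qed.

Lemma zpiK i j (a : zquot_hom i j) : zpi (repr a) = a.
Proof. exact: reprK. Qed.

Lemma zpiD i j (a b : C i j) : zpi (a + b) = zpi a + zpi b.
Proof. exact: raddfD. Qed.

Lemma zpiM i j l (a : C i j) (b : C j l) :
  zpi (zmul a b) = zquot_mul (zpi a) (zpi b).
Proof.
have [_ IB Il Ir] := zideal_gen_ideal.
have IN i' j' (x : C i' j') : zideal_gen x -> zideal_gen (- x).
  by move=> Ix; rewrite -sub0r; apply: IB => //; case: zideal_gen_ideal.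
have [/zpi_eq Ia /zpi_eq Ib] := (zpiK (zpi a), zpiK (zpi b)).
apply/zpi_eq; set a' := repr _; set b' := repr _ in Ib *.
have -> : zmul a b - zmul a' b' = zmul (- (a' - a)) b - zmul a' (b' - b).
  by rewrite zmulNl zmulBl zmulBr; rewrite !opprB addrA subrK.
by apply: (IB _ _ _ _ (Ir _ _ _ _ _ (IN _ _ _ Ia))); exact: Il.
Qed.

Fact zquot_mulA i j l m (a : zquot_hom i j) (b : zquot_hom j l)
    (c : zquot_hom l m) :
  zquot_mul a (zquot_mul b c) = zquot_mul (zquot_mul a b) c.
Proof. by rewrite -[a]zpiK -[b]zpiK -[c]zpiK -!zpiM zmulA. Qed.

Fact zquot_mul1l i j (a : zquot_hom i j) : zquot_mul (zpi (zone i)) a = a.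
Proof. by rewrite -[a]zpiK -zpiM zmul1l. Qed.

Fact zquot_mul1r i j (a : zquot_hom i j) : zquot_mul a (zpi (zone j)) = a.
Proof. by rewrite -[a]zpiK -zpiM zmul1r. Qed.

Fact zquot_mulDl i j l (a b : zquot_hom i j) (c : zquot_hom j l) :
  zquot_mul (a + b) c = zquot_mul a c + zquot_mul b c.
Proof.
by rewrite -[a]zpiK -[b]zpiK -[c]zpiK -zpiD -!zpiM -zpiD zmulDl.
Qed.

Fact zquot_mulDr i j l (a : zquot_hom i j) (b c : zquot_hom j l) :
  zquot_mul a (b + c) = zquot_mul a b + zquot_mul a c.
Proof.
by rewrite -[a]zpiK -[b]zpiK -[c]zpiK -zpiD -!zpiM -zpiD zmulDr.
Qed.

Definition zquot : zalg :=
  ZAlg zquot_mulA zquot_mul1l zquot_mul1r zquot_mulDl zquot_mulDr.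

End Quotient.

HB.instance Definition _ (R : nzRingType) (I : choiceType) (M : lmodType R)
    (f : I -> M) :=
  GRing.isZmodMorphism.Build {freeg I / R} M (fglift f) (lift_is_additive f).

Section Tensor.
Variables (F : fieldType) (K : int -> divringClosed F).

(** The word [:: k; x_1; ...; x_n] stands for the pure tensor
    [k (x) x_1 (x) ... (x) x_n] in
    [K_i (x)_{K_i} F (x)_{K_{i+1}} ... (x)_{K_{j-1}} F], where [j = i + n].
    The scalar [k] makes the degrees [j = i] and [j > i] uniform. *)
Definition is_word (i j : int) (s : seq F) : bool :=
  if s is k :: s' then (k \in K i) && (j == i + (size s')%:Z) else false.

Definition word (i j : int) : choiceType := {s : seq F | is_word i j s}.

(** Concatenation, absorbing the scalar of the second word into the last factor
    of the first one. *)
Definition cat_word (s t : seq F) : seq F :=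
  match s, t with
  | x :: s', y :: t' => belast x s' ++ (last x s' * y) :: t'
  | _, _ => [::]
  end.

Lemma cat_wordP i j l s t :
  is_word i j s -> is_word j l t -> is_word i l (cat_word s t).
Proof.
case: s t => [|x s] // [|y t] //= /andP[Kx /eqP->] /andP[Ky /eqP->].
case: s Ky => [|z s] /= Ky.
  by rewrite addr0 in Ky *; rewrite rpredM //=.
by rewrite Kx /= size_cat /= size_belast addnS -addrA -PoszD addSn.
Qed.

Lemma cat_wordA s t u : cat_word s (cat_word t u) = cat_word (cat_word s t) u.
Proof.
case: s t u => [|x s] [|y t] [|z u] //=.
  by case: (belast x s ++ _).
case: t => [|t0 t] /=.
  by case: s => [|s0 s] /=; rewrite ?belast_cat ?last_cat /= ?cats1 -?lastI mulrA.
case: s => [|s0 s] //=; rewrite belast_cat last_cat /= -[RHS]catA /=.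
by rewrite -[RHS]cat_rcons -lastI.
Qed.

Lemma cat_word1l s : cat_word [:: 1] s = s.
Proof. by case: s => //= x s; rewrite mul1r. Qed.

Lemma cat_word1r s : cat_word s [:: 1] = s.
Proof. by case: s => //= x s; rewrite mulr1 cats1 -lastI. Qed.

Lemma is_word1 i : is_word i i [:: 1].
Proof. by rewrite /= rpred1 addr0 eqxx. Qed.

Definition word_mul i j l (s : word i j) (t : word j l) : word i l :=
  Sub (cat_word (val s) (val t)) (cat_wordP (valP s) (valP t)).

Definition free_hom (i j : int) : zmodType := {freeg (word i j) / int}.

Definition free_mul i j l (a : free_hom i j) (b : free_hom j l) :
    free_hom i l :=
  fglift (fun s : word i j => fglift (fun t => << word_mul s t >>) b) a.

Definition free_one i : free_hom i i := << (Sub [:: 1] (is_word1 i) : word i i) >>.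


Lemma free_mulDl i j l (a b : free_hom i j) (c : free_hom j l) :
  free_mul (a + b) c = free_mul a c + free_mul b c.
Proof. exact: (raddfD (fglift _)). Qed.

Lemma free_mulDr i j l (a : free_hom i j) (b c : free_hom j l) :
  free_mul a (b + c) = free_mul a b + free_mul a c.
Proof.
have ext (f g h : word i j -> free_hom i l) : (forall s, f s = g s + h s) ->
    fglift f a = fglift g a + fglift h a.
  move=> fE; rewrite -[a]freeg_sumE !raddf_sum -big_split; apply: eq_bigr => s _.
  by rewrite /= !liftU fE scalerDr.
by apply: ext => s; exact: (raddfD (fglift _)).
Qed.

Lemma free_mulU i j l (s : word i j) (t : word j l) :
  free_mul << s >> << t >> = << word_mul s t >>.
Proof. by rewrite /free_mul !liftU !scale1r. Qed.

Lemma free_ind i j (P : free_hom i j -> Prop) :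
  P 0 -> (forall a b, P a -> P b -> P (a - b)) -> (forall s, P << s >>) ->
  forall a, P a.
Proof.
move=> P0 PB PU a.
have PN b : P b -> P (- b) by move=> Pb; rewrite -sub0r; apply: PB.
have PD b c : P b -> P c -> P (b + c).
  by move=> Pb Pc; rewrite -[c]opprK; apply: PB => //; apply: PN.
have PMn b n : P b -> P (b *+ n).
  by move=> Pb; elim: n => [|n IHn]; rewrite ?mulr0n // mulrS; apply: PD.
rewrite -[a]freeg_sumE; elim/big_ind: _ => // s _.
rewrite -[coeff s a]intz -freegU_mulz; case: (coeff s a) => n; first exact: PMn.
by rewrite NegzE mulrNz; apply/PN/PMn.
Qed.

Lemma free_mul0l i j l (b : free_hom j l) : free_mul (0 : free_hom i j) b = 0.
Proof. exact: (raddf0 (fglift _)). Qed.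

Lemma free_mul0r i j l (a : free_hom i j) : free_mul a (0 : free_hom j l) = 0.
Proof. by apply: (addrI (free_mul a 0)); rewrite -free_mulDr !addr0. Qed.

Lemma free_mulBl i j l (a b : free_hom i j) (c : free_hom j l) :
  free_mul (a - b) c = free_mul a c - free_mul b c.
Proof. exact: (raddfB (fglift _)). Qed.

Lemma free_mulBr i j l (a : free_hom i j) (b c : free_hom j l) :
  free_mul a (b - c) = free_mul a b - free_mul a c.
Proof.
by apply: (addIr (free_mul a c)); rewrite -free_mulDr !subrK.
Qed.

Fact free_mulA i j l m (a : free_hom i j) (b : free_hom j l)
    (c : free_hom l m) :
  free_mul a (free_mul b c) = free_mul (free_mul a b) c.
Proof.
elim/free_ind: a => [|a a' IHa IHa'|s]; first by rewrite !free_mul0l.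
  by rewrite !free_mulBl IHa IHa'.
elim/free_ind: b => [|b b' IHb IHb'|t].
- by rewrite !(free_mul0l, free_mul0r).
- by rewrite !(free_mulBl, free_mulBr) IHb IHb'.
elim/free_ind: c => [|c c' IHc IHc'|u]; first by rewrite !free_mul0r.
  by rewrite !free_mulBr IHc IHc'.
rewrite !free_mulU; congr << _ >>; apply: val_inj; exact: cat_wordA.
Qed.

Fact free_mul1l i j (a : free_hom i j) : free_mul (free_one i) a = a.
Proof.
elim/free_ind: a => [|a b IHa IHb|s]; first by rewrite free_mul0r.
  by rewrite free_mulBr IHa IHb.
rewrite free_mulU; congr << _ >>; apply: val_inj; exact: cat_word1l.
Qed.

Fact free_mul1r i j (a : free_hom i j) : free_mul a (free_one j) = a.
Proof.
elim/free_ind: a => [|a b IHa IHb|s]; first by rewrite free_mul0l.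
  by rewrite free_mulBl IHa IHb.
rewrite free_mulU; congr << _ >>; apply: val_inj; exact: cat_word1r.
Qed.

Definition free_zalg : zalg :=
  ZAlg free_mulA free_mul1l free_mul1r free_mulDl free_mulDr.

(** The generator given by a word, with the dummy value [0] on sequences that
    are not words from [i] to [j]. *)
Definition free_gen (i j : int) (s : seq F) : free_zalg i j :=
  if insub s is Some u then << (u : word i j) >> else 0.

(** In [u ++ x :: y :: v] the entry [x] has position [size u], so that the
    tensor sign after it is over [K_{i + size u}]. The set of these relations is
    stable under multiplication by words on both sides, hence the ideal that it
    generates is, in each degree, the subgroup that it spans. *)
Inductive tensor_rel : forall i j, free_zalg i j -> Prop :=
| TensorAdd i j u x y v :
    is_word i j (u ++ x :: v) -> is_word i j (u ++ y :: v) ->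
    tensor_rel (free_gen i j (u ++ (x + y) :: v) -
                (free_gen i j (u ++ x :: v) + free_gen i j (u ++ y :: v)))
| TensorBal i j u x k y v :
    k \in K (i + (size u)%:Z) ->
    is_word i j (u ++ x * k :: y :: v) -> is_word i j (u ++ x :: k * y :: v) ->
    tensor_rel (free_gen i j (u ++ x * k :: y :: v) -
                free_gen i j (u ++ x :: k * y :: v)).

Definition tensor_zalg : zalg := zquot tensor_rel.

Definition tensor (i j : int) (s : seq F) : tensor_zalg i j :=
  zpi _ (free_gen i j s).

Variable w : int -> F.

(** [sym_mul x i] is [x h_i], where [x] acts on the first factor of
    [F (x)_{K_{i+1}} F]. *)
Definition sym_mul (x : F) (i : int) : tensor_zalg i (i + 2) :=
  tensor i (i + 2) [:: 1; x; 1] +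
  tensor i (i + 2) [:: 1; x * (w (i + 1))^-1; w (i + 1)].

Inductive sym_rel : forall i j, tensor_zalg i j -> Prop :=
  SymRel i : sym_rel (sym_mul 1 i).

Definition nc_sym : zalg := zquot sym_rel.

Definition sym_g (i : int) : nc_sym i (i + 2) := zpi _ (sym_mul (w (i + 1)) i).

Definition sym_scalar (i : int) (k : F) : nc_sym i i := zpi _ (tensor i i [:: k]).

End Tensor.

Section Localisation.
Variables (A : zalg) (g : forall i, A i (i + 2)).

Fixpoint shift2 (i : int) (n : nat) : int :=
  if n is m.+1 then shift2 (i + 2) m else i.

Lemma shift2E i n : shift2 i n = i + 2 * n%:Z.
Proof.
elim: n i => [|n IHn] i /=; first by rewrite mulr0 addr0.
by rewrite IHn -addrA intS mulrDr mulr1.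
Qed.

Fixpoint gprod (i : int) (n : nat) : A i (shift2 i n) :=
  if n is m.+1 then zmul (g i) (gprod (i + 2) m) else zone i.

Variables (L : zalg) (f : forall i j, A i j -> L i j).

(** [L] is the right ring of fractions of [A] at the products [gprod j r]:
    these become invertible, every element of [L] is of the form [a g^{-r}], and
    the kernel of [A -> L] is the torsion. This determines [L] up to a unique
    isomorphism under [A]. *)
Definition is_localisation : Prop :=
  [/\ zmorphism f,
      forall i, exists y, zinverse (f (g i)) y,
      forall i j (z : L i j), exists r (a : A i (shift2 j r)) y,
        zinverse (f (gprod j r)) y /\ z = zmul (f a) y &
      forall i j (a : A i j), f a = 0 -> exists r, zmul a (gprod j r) = 0].

Definition loc_filtration (n : nat) : set (zcorner L 0) :=
  [set z | exists (a : A 0 (shift2 0 n)) y,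
     zinverse (f (gprod 0 n)) y /\ z = zmul (f a) y].

Definition loc_scale (k : A 0 0) (x : zcorner L 0) : zcorner L 0 :=
  zmul (f k) x.

End Localisation.

Definition alternate (F : fieldType) (K0 K1 : divringClosed F) (i : int) :
  divringClosed F := if odd `|i|%N then K1 else K0.

(** [F] is non-zero, so only the absence of proper non-zero sub-bimodules is
    required. *)
Definition simple_bimodule (F : fieldType) (K0 K1 : {pred F}) : Prop :=
  forall V : set F,
    V 0 -> (forall x y, V x -> V y -> V (x - y)) ->
    (forall k x, k \in K0 -> V x -> V (k * x)) ->
    (forall k x, k \in K1 -> V x -> V (x * k)) ->
    V = [set 0] \/ V = [set: F].

(* Main.v *)
(** Write [tau_i] for the conjugation of [F] over [K_i] and
    [sigma = tau_1 tau_0]. Sending [x] in [A_(i,i+1) = F] to [tau_0 x + x t] for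
    even [i] and to [tau_0 x - t^-1 x] for odd [i] represents [A] in the skew
    Laurent ring [S = F[t, t^-1; sigma]] and makes the [g_i] units of [F]. The
    representation extends to [Lambda] and identifies [Lambda_00] with the ring
    [R] of invariants of the involution of [S] that is [tau_0] on [F] and inverts
    [t]; the [n]-th step of the filtration becomes the invariants supported in
    degrees [-n], ..., [n]. Now [S] is a principal left and right ideal domain,
    free over [R] with basis [1, w_0], so a left ideal [I] of [R] is a direct
    summand of [S I], which is free over [R]. For a two-sided ideal [I] one has
    [w_0 I = I w_0]: [tau_0] is not a power of [sigma], and an element of
    [F (x) F] separating the [sigma^n] from the [sigma^n tau_0] can be projected
    to [K_0 (x) K_0]. Hence [S I = I S], the orders of [I] are [R], and the dual
    basis of the projective ideal [I] makes it invertible. *)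

From HB Require Import structures.
Require Import Defs.
From mathcomp Require Import all_boot all_order all_algebra.
From mathcomp Require Import generic_quotient ring_quotient.
From mathcomp.multinomials Require Import freeg.
From mathcomp Require Import ring zify.
From mathcomp Require Import boolp classical_sets functions.

Set Implicit Arguments.
Unset Strict Implicit.
Unset Printing Implicit Defensive.

Import Order.TTheory GRing.Theory Num.Theory.
Local Open Scope ring_scope.
Local Open Scope quotient_scope.

(** * Rings of fractions of Ore domains *)

(** No basis of the tensor products or of [A] is available beforehand. Rewriting with the normal
    elements only shows that [A_(0,2n)] is the sum of the tensors [x (x) 1 (x) ... (x) 1] and of
    [A_(0,2n-2) g]. Independence is read off the representation: the first summand contributes the
    coefficient [x] of [t^n], the second has smaller support. The same coefficient yields
    injectivity, the image, and the dimension 2 of every positive step of the filtration. Elements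
    of [A_(0,2n)] are multiplied by [(-1)^n] under the involution, and so is the product of [n]
    elements [g]; the signs cancel in fractions. Elements of [F (x) F] enter because replacing
    [c t^l] by the sum of the [p c t^l q] multiplies it by the value of the sum of the [p (x) q] at
    [sigma^l], and conjugation by [w_0] is the case [w_0 (x) w_0^-1]. If all [p] and [q] lie in
    [K_0], the operation preserves two-sided ideals of [R]. Taking traces to get there mixes the
    values at [sigma^l] with those at [sigma^l tau_0], so the latter have to be made zero. *)

Definition right_ore (R : pzRingType) : Prop :=
  is_domain R /\
  forall a b : R, a <> 0 -> b <> 0 -> exists c d, a * c = b * d /\ a * c <> 0.

(** The ring of fractions of a right Ore domain [R]: the functions [R -> R]
    that are linear on some non-zero right ideal [c R], modulo equality on such
    an ideal, with composition as product. *)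
Section Germs.
Variables (R : pzRingType) (oreR : right_ore R).

Let mulf_neq0 (a b : R) : a <> 0 -> b <> 0 -> a * b <> 0.
Proof. by case: oreR => -[_ dom] _ a0 b0 /dom[]. Qed.

Let one_neq0 : (1 : R) <> 0.
Proof. by case: oreR => -[/eqP h _] _. Qed.

Let ore (a b : R) : a <> 0 -> b <> 0 -> exists c d, a * c = b * d /\ a * c <> 0.
Proof. by case: oreR => _; exact. Qed.

Definition linear_at (h : R -> R) (c : R) : Prop :=
  c <> 0 /\ forall x, h (c * x) = h c * x.

Definition germ_fun : {pred R -> R} := fun h => `[< exists c, linear_at h c >].

Lemma linear_atM h c x : linear_at h c -> c * x <> 0 -> linear_at h (c * x).
Proof. by move=> [_ hc] cx; split=> // y; rewrite -mulrA !hc mulrA. Qed.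

Lemma linear_at0 h c : linear_at h c -> h 0 = 0.
Proof. by case=> _ /(_ 0); rewrite !mulr0. Qed.

Lemma common_linear_at h k : h \in germ_fun -> k \in germ_fun ->
  exists c, linear_at h c /\ linear_at k c.
Proof.
move=> /asboolP[c hc] /asboolP[d kd].
have [x [y [cd cx]]] := ore hc.1 kd.1.
by exists (c * x); split; [|rewrite cd]; apply: linear_atM => //; rewrite -cd.
Qed.

Fact germ_fun_closed : zmod_closed germ_fun.
Proof.
split=> [|h k hg kg]; first by apply/asboolP; exists 1; split=> // x; rewrite mul0r.
have [c [[c0 hc] [_ kc]]] := common_linear_at hg kg.
apply/asboolP; exists c; split=> // x.
by rewrite !fctE hc kc mulrBl.
Qed.
HB.instance Definition _ := GRing.isZmodClosed.Build _ germ_fun germ_fun_closed.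

Record germ_rep := GermRep { germ_rep_fun : R -> R; _ : germ_rep_fun \in germ_fun }.
HB.instance Definition _ := [isSub for germ_rep_fun].
HB.instance Definition _ := [Choice of germ_rep by <:].
HB.instance Definition _ := [SubChoice_isSubZmodule of germ_rep by <:].

Definition null_germ : {pred germ_rep} := fun h =>
  `[< exists c, c <> 0 /\ forall x, val h (c * x) = 0 >].

Fact null_germ_closed : zmod_closed null_germ.
Proof.
split=> [|h k /asboolP[c [c0 hc]] /asboolP[d [d0 kd]]]; apply/asboolP.
  by exists 1; split=> // x; rewrite raddf0.
have [x [y [cd cx]]] := ore c0 d0.
exists (c * x); split=> // z; rewrite raddfB /= !fctE /=.
by rewrite -mulrA hc mulrA cd -mulrA kd subr0.
Qed.
HB.instance Definition _ := GRing.isZmodClosed.Build _ null_germ null_germ_closed.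

Definition germ : Type := Quotient.quot (null_germ : zmodClosed germ_rep).
HB.instance Definition _ := GRing.Zmodule.on germ.

Definition pi_germ (h : germ_rep) : germ := \pi h.

Lemma germ_rep_funB (h k : germ_rep) x : val (h - k) x = val h x - val k x.
Proof. by rewrite raddfB. Qed.

Lemma germ_rep_funD (h k : germ_rep) x : val (h + k) x = val h x + val k x.
Proof. by rewrite raddfD. Qed.

Lemma germ_rep_fun0 x : val (0 : germ_rep) x = 0.
Proof. by rewrite raddf0. Qed.

Lemma pi_germP (h k : germ_rep) :
  pi_germ h = pi_germ k <->
  exists c, c <> 0 /\ forall x, val h (c * x) = val k (c * x).
Proof.
have eqE c x : (val (h - k) (c * x) = 0) = (val h (c * x) = val k (c * x)).
  rewrite germ_rep_funB; apply/propext.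
  by split=> [/eqP|->]; rewrite ?subrr // subr_eq0 => /eqP.
split=> [/eqP|[c [c0 hk]]]; last first.
  apply/eqP; rewrite -Quotient.idealrBE; apply/asboolP.
  by exists c; split=> // x; rewrite eqE.
rewrite -Quotient.idealrBE => /asboolP[c [c0 hk]].
by exists c; split=> // x; rewrite -eqE.
Qed.

Lemma pi_germD h k : pi_germ (h + k) = pi_germ h + pi_germ k.
Proof. exact: raddfD. Qed.

Lemma pi_germ0 : pi_germ 0 = 0.
Proof. exact: raddf0. Qed.

(** The domain [d R] of a germ can be shrunk to [d u R] so that its values fall in a prescribed
    non-zero right ideal [e R]. This is what makes composition defined and compatible with equality
    of germs. *)
Lemma linear_at_pullback k d e : linear_at k d -> e <> 0 ->
  exists u, d * u <> 0 /\ exists v, k (d * u) = e * v.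
Proof.
move=> [d0 kd] e0; have [kd0|/eqP kd0] := eqVneq (k d) 0.
  by exists 1; rewrite mulr1; split=> //; exists 0; rewrite kd0 mulr0.
have [u [v [uv u0]]] := ore kd0 e0; exists u; split; last by exists v; rewrite kd.
by move=> du; apply: u0; rewrite -kd du (linear_at0 (conj d0 kd)).
Qed.

Lemma germ_fun_comp h k :
  h \in germ_fun -> k \in germ_fun -> h \o k \in germ_fun.
Proof.
move=> /asboolP[e he] /asboolP[d kd]; apply/asboolP.
have [u [du [v kdu]]] := linear_at_pullback kd he.1.
exists (d * u); split=> // x /=.
by rewrite (linear_atM kd du).2 kdu -mulrA !he.2 mulrA.
Qed.

Definition germ_comp (h k : germ_rep) : germ_rep :=
  GermRep (germ_fun_comp (valP h) (valP k)).

Lemma germ_compE h k x : val (germ_comp h k) x = val h (val k x).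
Proof. by []. Qed.

Lemma germ_lmul_subproof a : (fun x : R => a * x) \in germ_fun.
Proof. by apply/asboolP; exists 1; split=> // x; rewrite mulr1 mul1r. Qed.

Definition germ_lmul a : germ_rep := GermRep (germ_lmul_subproof a).

Definition germ_mul (a b : germ) : germ := pi_germ (germ_comp (repr a) (repr b)).

Lemma pi_germK (a : germ) : pi_germ (repr a) = a.
Proof. exact: reprK. Qed.

Lemma pi_germM h k : pi_germ (germ_comp h k) = germ_mul (pi_germ h) (pi_germ k).
Proof.
rewrite /germ_mul; set h' := repr _; set k' := repr _.
have /pi_germP[c [c0 hh']] : pi_germ h = pi_germ h' by rewrite pi_germK.
have /pi_germP[d [d0 kk']] : pi_germ k = pi_germ k' by rewrite pi_germK.
have /asboolP[e ke] := valP k.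
have [x [y [ex dy]]] := ore ke.1 d0.
have [u [exu [v kv]]] := linear_at_pullback (linear_atM ke dy) c0.
apply/pi_germP; exists (e * x * u); split=> // z; rewrite !germ_compE.
have -> : val k' (e * x * u * z) = val k (e * x * u * z).
  by rewrite ex -!mulrA kk'.
rewrite (linear_atM (linear_atM ke dy) exu).2 kv -mulrA.
exact: hh'.
Qed.

Fact germ_mulA : associative germ_mul.
Proof.
move=> a b c; rewrite -[a]pi_germK -[b]pi_germK -[c]pi_germK -!pi_germM.
by congr pi_germ; apply: val_inj.
Qed.

Fact germ_mul1l : left_id (pi_germ (germ_lmul 1)) germ_mul.
Proof.
move=> a; rewrite -[a]pi_germK -pi_germM; congr pi_germ; apply: val_inj.
by apply/funext => x /=; rewrite mul1r.
Qed.

Fact germ_mul1r : right_id (pi_germ (germ_lmul 1)) germ_mul.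
Proof.
move=> a; rewrite -[a]pi_germK -pi_germM; congr pi_germ; apply: val_inj.
by apply/funext => x /=; rewrite mul1r.
Qed.

Fact germ_mulDl : left_distributive germ_mul +%R.
Proof.
move=> a b c; rewrite -[a]pi_germK -[b]pi_germK -[c]pi_germK.
rewrite -pi_germD -!pi_germM -pi_germD; congr pi_germ; apply: val_inj.
by rewrite !raddfD.
Qed.

Fact germ_mulDr : right_distributive germ_mul +%R.
Proof.
move=> a b c; rewrite -[a]pi_germK -[b]pi_germK -[c]pi_germK.
set h := repr a; set k := repr b; set l := repr c.
rewrite -pi_germD -!pi_germM -pi_germD; apply/pi_germP.
have [d [[d0 kd] [_ ld]]] := common_linear_at (valP k) (valP l).
have /asboolP[e he] := valP h.
have [u [du [v kv]]] := linear_at_pullback (conj d0 kd) he.1.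
have [u' [duu' [v' lv]]] := linear_at_pullback (linear_atM (conj d0 ld) du) he.1.
exists (d * u * u'); split=> // x.
rewrite germ_compE germ_rep_funD germ_rep_funD !germ_compE.
have -> : val k (d * u * u' * x) = e * (v * u' * x).
  by rewrite -(mulrA (d * u)) (linear_atM (conj d0 kd) du).2 kv !mulrA.
have -> : val l (d * u * u' * x) = e * (v' * x).
  by rewrite (linear_atM (linear_atM (conj d0 ld) du) duu').2 lv mulrA.
by rewrite -mulrDr !he.2 mulrDr.
Qed.

HB.instance Definition _ := GRing.Zmodule_isPzRing.Build germ
  germ_mulA germ_mul1l germ_mul1r germ_mulDl germ_mulDr.

Lemma germ_neq0 : (1 : germ) != 0.
Proof.
apply/eqP; rewrite -pi_germ0 => /(pi_germP (germ_lmul 1))[c [c0 /(_ 1)]].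
by rewrite germ_rep_fun0 /= mulr1 mul1r.
Qed.
HB.instance Definition _ := GRing.PzSemiRing_isNonZero.Build germ germ_neq0.

(** If [h] is linear at [c] and not null, then [h c] is non-zero, hence regular, and
    [h c * x |-> c * x] is a well-defined inverse on the right ideal generated by [h c]. *)
Lemma germ_has_inv (a : germ) : a <> 0 -> exists b : germ, b * a = 1 /\ a * b = 1.
Proof.
rewrite -[a]pi_germK; move: (repr a) => h h0.
have /asboolP[c hc] := valP h.
have [hc0|/eqP hc0] := eqVneq (val h c) 0.
  case: h0; rewrite -pi_germ0; apply/pi_germP; exists c; split=> [|x]; first exact: hc.1.
  by rewrite hc.2 hc0 mul0r germ_rep_fun0.
pose k y := xget 0 [set c * x | x in [set x | y = val h c * x]]%classic.
have kE x : k (val h c * x) = c * x.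
  rewrite /k; case: xgetP => [y -> [z /= hz <-]|/(_ (c * x))[]]; last by exists x.
  have : val h c * (x - z) = 0 by rewrite mulrBr hz subrr.
  by move/oreR.1.2 => [//|/eqP]; rewrite subr_eq0 => /eqP->.
have kg : k \in germ_fun.
  apply/asboolP; exists (val h c); split=> // x.
  by rewrite kE -[in RHS](mulr1 (val h c)) kE mulr1.
exists (pi_germ (GermRep kg)); rewrite /GRing.mul /= -!pi_germM; split.
  apply/pi_germP; exists c; split=> [|x]; first exact: hc.1.
  by rewrite germ_compE hc.2 /= kE mul1r.
apply/pi_germP; exists (val h c); split=> // x.
by rewrite germ_compE /= kE mul1r hc.2.
Qed.

(** The default value [a] makes the inverse of [0] equal to [0], as a unit ring requires outside its
    units. *)
Definition germ_inv (a : germ) : germ :=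
  xget a [set b | b * a = 1 /\ a * b = 1]%classic.

Lemma germ_invP (a : germ) : a != 0 -> germ_inv a * a = 1 /\ a * germ_inv a = 1.
Proof.
move=> /eqP/germ_has_inv[b ab]; rewrite /germ_inv.
by case: xgetP => [c _ //|/(_ b)].
Qed.

Fact germ_mulVr : {in [pred a | a != 0], left_inverse 1 germ_inv *%R}.
Proof. by move=> a /germ_invP[]. Qed.

Fact germ_divrr : {in [pred a | a != 0], right_inverse 1 germ_inv *%R}.
Proof. by move=> a /germ_invP[]. Qed.

Fact germ_unitP (a b : germ) : b * a = 1 /\ a * b = 1 -> a != 0.
Proof.
by case=> ba _; apply: contra_eq_neq ba => ->; rewrite mulr0 eq_sym oner_eq0.
Qed.

Fact germ_inv_out : {in [predC [pred a | a != 0]], germ_inv =1 id}.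
Proof.
move=> a /negPn/eqP->; rewrite /germ_inv.
by case: xgetP => // b _ [/eqP]; rewrite mulr0 eq_sym oner_eq0.
Qed.

HB.instance Definition _ := GRing.NzRing_hasMulInverse.Build germ
  germ_mulVr germ_divrr germ_unitP germ_inv_out.

Definition to_germ (a : R) : germ := pi_germ (germ_lmul a).

Fact to_germ_zmod_morphism : zmod_morphism to_germ.
Proof.
move=> a b; rewrite /to_germ -[LHS]/(pi_germ _) /pi_germ -raddfB.
congr (\pi _); apply: val_inj; rewrite raddfB; apply/funext => x.
exact: mulrBl.
Qed.

Fact to_germ_monoid_morphism : monoid_morphism to_germ.
Proof.
split=> // a b; rewrite /to_germ /GRing.mul /= -pi_germM; congr pi_germ.
by apply: val_inj; apply/funext => x /=; rewrite mulrA.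
Qed.
HB.instance Definition _ :=
  GRing.isZmodMorphism.Build R germ to_germ to_germ_zmod_morphism.
HB.instance Definition _ :=
  GRing.isMonoidMorphism.Build R germ to_germ to_germ_monoid_morphism.

Lemma to_germ_inj : injective to_germ.
Proof.
move=> a b /pi_germP[c [c0 /(_ 1)]] /=; rewrite mulr1 => /eqP.
by rewrite -subr_eq0 -mulrBl => /eqP/oreR.1.2[/eqP|//]; rewrite subr_eq0 => /eqP.
Qed.

Lemma to_germ_unit a : a <> 0 -> to_germ a \is a GRing.unit.
Proof.
move=> a0; suff /eqP : to_germ a <> 0 by [].
by rewrite -(raddf0 to_germ) => /to_germ_inj.
Qed.

Lemma germ_fracP (a : germ) :
  exists b s, s <> 0 /\ a = to_germ b * (to_germ s)^-1.
Proof.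
rewrite -[a]pi_germK; move: (repr a) => h; have /asboolP[c hc] := valP h.
exists (val h c), c; split; first exact: hc.1.
apply: canRL (mulrK (to_germ_unit hc.1)) _.
rewrite /to_germ /GRing.mul /= -pi_germM; congr pi_germ; apply: val_inj.
by apply/funext => x /=; rewrite hc.2.
Qed.
End Germs.

Lemma domain_regular (R : pzRingType) (s : R) :
  is_domain R -> regular s <-> s <> 0.
Proof.
move=> [/eqP R1 dom]; split=> [[sl _] s0|s0].
  by apply: R1; apply: sl; rewrite s0 !mul0r.
split=> x y /eqP; rewrite -subr_eq0.
  by rewrite -mulrBr => /eqP/dom[//|/eqP]; rewrite subr_eq0 => /eqP.
by rewrite -mulrBl => /eqP/dom[/eqP|//]; rewrite subr_eq0 => /eqP.
Qed.

(** Germs are right fractions [b s^-1] by construction. The Ore condition of the converse ring gives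
    [c b = d s], which turns them into left fractions [c^-1 d]. *)
Lemma ore_fractions (R : pzRingType) (oreR : right_ore R) :
  right_ore R^c -> is_ring_of_fractions (@to_germ R oreR).
Proof.
move=> oreRc; have [dom ore] := oreR.
split.
- exact: to_germ_inj.
- by move=> s /(domain_regular _ dom); exact: to_germ_unit.
- move=> q; have [b [s [s0 qE]]] := germ_fracP q.
  by exists b, s; split=> //; apply/(domain_regular _ dom).
move=> q; have [b [s [s0 qE]]] := germ_fracP q.
have [b0|/eqP b0] := eqVneq b 0.
  exists 0, 1; split; last by rewrite qE b0 !raddf0 mul0r mulr0.
  by apply/(domain_regular _ dom)/eqP; exact: dom.1.
have [c [d [/= cd c0]]] := oreRc.2 _ _ b0 s0.
have d0 : c <> 0 by move=> e; apply: c0; rewrite e [LHS]mul0r.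
exists d, c; split; first exact/(domain_regular _ dom).
apply: canRL (mulKr (to_germ_unit oreR d0)) _.
rewrite qE mulrA; apply: canLR (mulrK (to_germ_unit oreR s0)) _.
by rewrite -!rmorphM; congr to_germ.
Qed.

(** * Fixed rings of involutions *)

(** [R] is identified by [psi] with the fixed ring of the involution [theta] of
    the subring [S] of [E]; as [theta w = - w], [S] is free over it with basis
    [1, w] on both sides. The last field says that conjugation by [w] preserves
    the two-sided ideals of [R]. *)
Record fixed_ring (E : pzRingType) (S : set E) (theta : E -> E) (w w' : E)
    (R : pzRingType) (psi : R -> E) : Prop := FixedRing {
  fr_neq0 : 1 <> 0 :> E;
  fr_S1 : S 1;
  fr_SB : forall a b, S a -> S b -> S (a - b);
  fr_SM : forall a b, S a -> S b -> S (a * b);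
  fr_dom : forall a b, S a -> S b -> a * b = 0 -> a = 0 \/ b = 0;
  fr_half : exists2 h : E, S h & h + h = 1;
  fr_thetaB : forall a b, theta (a - b) = theta a - theta b;
  fr_thetaM : forall a b, theta (a * b) = theta a * theta b;
  fr_thetaK : forall a, theta (theta a) = a;
  fr_thetaS : forall a, S a -> S (theta a);
  fr_Sw : S w;
  fr_Sw' : S w';
  fr_ww' : w * w' = 1;
  fr_w'w : w' * w = 1;
  fr_thetaw : theta w = - w;
  fr_psiB : forall a b, psi (a - b) = psi a - psi b;
  fr_psiM : forall a b, psi (a * b) = psi a * psi b;
  fr_psi1 : psi 1 = 1;
  fr_psi_inj : injective psi;
  fr_psiP : forall x, (S x /\ theta x = x) <-> exists a, x = psi a;
  fr_lprincipal : forall J : set E, J 0 -> (forall a, J a -> S a) ->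
    (forall a b, J a -> J b -> J (a - b)) -> (forall s a, S s -> J a -> J (s * a)) ->
    exists2 d, J d & forall a, J a -> exists2 s, S s & a = s * d;
  fr_rprincipal : forall J : set E, J 0 -> (forall a, J a -> S a) ->
    (forall a b, J a -> J b -> J (a - b)) -> (forall s a, S s -> J a -> J (a * s)) ->
    exists2 d, J d & forall a, J a -> exists2 s, S s & a = d * s;
  fr_ideal : forall I : set R, two_sided_ideal I -> forall a, I a ->
    (exists2 b, I b & w * psi a = psi b * w) /\
    (exists2 b, I b & psi a * w = w * psi b) }.

Lemma two_sided_ideal_conv (R : pzRingType) (I : set R) :
  @two_sided_ideal R^c I -> two_sided_ideal I.
Proof. by case=> -[I0 ID Il] Ir; split=> //. Qed.

(** The two principality fields exchange their roles, and so do the two halves of [fr_ideal]. Every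
    one-sided result below therefore yields its mirror image. *)
Lemma fixed_ring_conv (E : pzRingType) (S : set E) theta w w' (R : pzRingType)
    (psi : R -> E) : fixed_ring S theta w w' psi ->
  @fixed_ring E^c S theta w w' R^c psi.
Proof.
case=> neq0 S1 SB SM dom half thetaB thetaM thetaK thetaS Sw Sw' ww' w'w thetaw
  psiB psiM psi1 psi_inj psiP lpr rpr ideal.
split=> //.
- by move=> a b Sa Sb; exact: SM.
- by move=> a b Sa Sb /(dom _ _ Sb Sa)[]; [right|left].
- by move=> a b; exact: thetaM.
- by move=> a b; exact: psiM.
by move=> I /two_sided_ideal_conv I2 a Ia; have [] := ideal I I2 a Ia.
Qed.

Section FixedRing.
Variables (E : pzRingType) (S : set E) (theta : E -> E) (w w' : E).
Variables (R : pzRingType) (psi : R -> E).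
Hypothesis FR : fixed_ring S theta w w' psi.

Let psi0 : psi 0 = 0.
Proof. by rewrite -(subrr 0) (fr_psiB FR) subrr. Qed.

Let psiN a : psi (- a) = - psi a.
Proof. by rewrite -sub0r (fr_psiB FR) psi0 sub0r. Qed.

Let psiD a b : psi (a + b) = psi a + psi b.
Proof. by rewrite -{1}[b]opprK (fr_psiB FR) psiN opprK. Qed.

Let theta0 : theta 0 = 0.
Proof. by rewrite -{1}(subrr 0) (fr_thetaB FR) subrr. Qed.

Let thetaN a : theta (- a) = - theta a.
Proof. by rewrite -sub0r (fr_thetaB FR) theta0 sub0r. Qed.

Let thetaD a b : theta (a + b) = theta a + theta b.
Proof. by rewrite -{1}[b]opprK (fr_thetaB FR) thetaN opprK. Qed.

Let S0 : S 0.
Proof. by rewrite -(subrr 1); apply: (fr_SB FR); exact: (fr_S1 FR). Qed.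

Let SN a : S a -> S (- a).
Proof. by move=> Sa; rewrite -sub0r; exact: (fr_SB FR). Qed.

Let SD a b : S a -> S b -> S (a + b).
Proof. by move=> Sa Sb; rewrite -[b]opprK; apply: (fr_SB FR) => //; exact: SN. Qed.

Let Spsi a : S (psi a).
Proof. by have [] : S (psi a) /\ theta (psi a) = psi a by apply/(fr_psiP FR); exists a. Qed.

Let thetapsi a : theta (psi a) = psi a.
Proof. by have [] : S (psi a) /\ theta (psi a) = psi a by apply/(fr_psiP FR); exists a. Qed.

Let double_eq0 (a : E) : a + a = 0 -> a = 0.
Proof.
have [h _ hh] := fr_half FR; move=> aa.
by rewrite -[a]mul1r -hh mulrDl -mulrDr aa mulr0.
Qed.

(** Split [s] into its invariant and anti-invariant halves. The latter becomes invariant after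
    multiplication by [w^-1] on either side, because [theta w' = - w']. *)
Lemma fixed_decomposition s : S s ->
  (exists a b, s = psi a + psi b * w) /\ (exists a b, s = psi a + w * psi b).
Proof.
move=> Ss; have [h Sh hh] := fr_half FR.
(* Centrality of the half is not assumed: twice the commutator of [h] and [x] is [x - x]. *)
have hC x : h * x = x * h.
  apply/eqP; rewrite -subr_eq0; apply/eqP/double_eq0; rewrite addrACA -opprD.
  by rewrite -mulrDl -mulrDr hh mul1r mulr1 subrr.
have thetah : theta h = h.
  apply/eqP; rewrite -subr_eq0; apply/eqP/double_eq0.
  rewrite addrACA -opprD -thetaD hh -(fr_psi1 FR) thetapsi subrr //.
have SM := fr_SM FR; have thetaM := fr_thetaM FR.
have thetaw' : theta w' = - w'.
  apply/eqP; rewrite -[theta w']mulr1 -(fr_ww' FR) mulrA.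
  have -> : theta w' * w = - theta (w' * w).
    by rewrite thetaM (fr_thetaw FR) mulrN opprK.
  by rewrite (fr_w'w FR) -(fr_psi1 FR) thetapsi (fr_psi1 FR) mulN1r.
have [a aE] : exists a, h * (s + theta s) = psi a.
  apply/(fr_psiP FR); split; last by rewrite thetaM thetah thetaD (fr_thetaK FR) addrC.
  by apply: SM => //; apply: SD => //; exact: (fr_thetaS FR).
have dE : h * (s + theta s) + h * (s - theta s) = s.
  by rewrite -mulrDr addrACA subrr addr0 mulrDr -mulrDl hh mul1r.
have Sd : S (h * (s - theta s)).
  by apply: SM => //; apply: SD => //; apply/SN/(fr_thetaS FR).
have thetad : theta (h * (s - theta s)) = - (h * (s - theta s)).
  by rewrite thetaM thetah (fr_thetaB FR) (fr_thetaK FR) -mulrN opprB.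
split; exists a.
  have [b bE] : exists b, h * (s - theta s) * w' = psi b.
    apply/(fr_psiP FR); split; first by apply: SM => //; exact: (fr_Sw' FR).
    by rewrite thetaM thetad thetaw' mulrNN.
  by exists b; rewrite -aE -bE -mulrA (fr_w'w FR) mulr1.
have [b bE] : exists b, w' * (h * (s - theta s)) = psi b.
  apply/(fr_psiP FR); split; first by apply: SM => //; exact: (fr_Sw' FR).
  by rewrite thetaM thetad thetaw' mulrNN.
by exists b; rewrite -aE -bE mulrA (fr_ww' FR) mul1r.
Qed.

Lemma fixed_decomposition_uniq a b : psi a + psi b * w = 0 -> a = 0 /\ b = 0.
Proof.
move=> e; have := congr1 theta e.
rewrite theta0 thetaD (fr_thetaM FR) !thetapsi (fr_thetaw FR) mulrN => e'.
have a0 : psi a = 0.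
  by apply: double_eq0; rewrite -[RHS](addr0 0) -{1}e -e' addrACA subrr addr0.
split; apply: (fr_psi_inj FR); rewrite psi0 //.
move: e; rewrite a0 add0r => e.
by rewrite -[psi b]mulr1 -(fr_ww' FR) mulrA e mul0r.
Qed.

Lemma w_psi a : exists b, w * psi a = psi b * w.
Proof.
have [[u [v e]] _] := fixed_decomposition (fr_SM FR (fr_Sw FR) (Spsi a)).
have e' : - (w * psi a) = psi u - psi v * w.
  have := congr1 theta e.
  by rewrite thetaD !(fr_thetaM FR) !thetapsi (fr_thetaw FR) mulNr mulrN.
exists v; rewrite e; suff -> : psi u = 0 by rewrite add0r.
apply: double_eq0; rewrite -[RHS](subrr (w * psi a)) e' e addrACA subrr addr0 //.
Qed.

Lemma fixed_ring_domain : is_domain R.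
Proof.
split=> [|a b ab].
  apply/eqP => e; apply: (fr_neq0 FR).
  by rewrite -(fr_psi1 FR) e psi0.
have : psi a * psi b = 0 by rewrite -(fr_psiM FR) ab psi0.
by case/(fr_dom FR (Spsi a) (Spsi b)) => e; [left|right];
  apply: (fr_psi_inj FR); rewrite psi0.
Qed.

(** This is the left ideal [S I], since [S = R + w R]. *)
Let induced (I : set R) : set E :=
  [set x | exists a b, [/\ I a, I b & x = psi a + w * psi b]]%classic.

Let inducedB (I : set R) : left_ideal I ->
  forall x y, induced I x -> induced I y -> induced I (x - y).
Proof.
move=> [I0 ID Il] x y [a [b [Ia Ib ->]]] [c [d [Ic Id ->]]].
have IB u v : I u -> I v -> I (u - v).
  by move=> Iu Iv; rewrite -mulN1r; apply: ID => //; exact: Il.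
exists (a - c), (b - d); split; [exact: IB|exact: IB|].
by rewrite !(fr_psiB FR) mulrBr opprD addrACA.
Qed.

Let inducedS (I : set R) : I 0 -> (forall a, induced I a -> S a) /\ induced I 0 /\
  (forall a, I a -> induced I (psi a)).
Proof.
move=> I0; split=> [x [a [b [_ _ ->]]]|].
  by apply: SD => //; apply: (fr_SM FR) => //; exact: (fr_Sw FR).
split=> [|a Ia]; first by exists 0, 0; rewrite psi0 mulr0 addr0.
by exists a, 0; rewrite psi0 mulr0 addr0.
Qed.

Let inducedZ (I : set R) : left_ideal I ->
  forall s x, S s -> induced I x -> induced I (s * x).
Proof.
move=> [I0 ID Il] s x Ss [a [b [Ia Ib ->]]].
have [_ [p [q sE]]] := fixed_decomposition Ss.
have [_ [p' [q' swE]]] := fixed_decomposition (fr_SM FR Ss (fr_Sw FR)).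
exists (p * a + p' * b), (q * a + q' * b); split.
- by apply: ID; exact: Il.
- by apply: ID; exact: Il.
rewrite mulrDr mulrA swE sE !mulrDl !psiD !(fr_psiM FR) mulrDr !mulrA.
by rewrite addrACA.
Qed.

(** Write [S I = S d] with [d = a + w b]. Each [x] in [I] is [(p + q w) d] with [p] and [q] unique,
    hence linear in [x]. Comparing the components in [R] gives [x = p a + q c b], where
    [c = w^2]. *)
Lemma left_dual_basis (I : set R) : left_ideal I ->
  exists a b (phi psi' : R -> R), [/\ I a, I b, 
    linear_on (M := R^o) I phi, linear_on (M := R^o) I psi' &
    forall x, I x -> x = phi x * a + psi' x * b].
Proof.
move=> I_id; have [I0 ID Il] := I_id.
have [JS [J0 Jpsi]] := inducedS I0.
have [d Jd dP] := fr_lprincipal FR J0 JS (inducedB I_id) (inducedZ I_id).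
have [d0|/eqP d0] := eqVneq d 0.
  exists 0, 0, (fun=> 0), (fun=> 0); split=> //.
  - by split=> *; rewrite /= ?addr0 ?scaler0.
  - by split=> *; rewrite /= ?addr0 ?scaler0.
  move=> x /Jpsi/dP[s _]; rewrite d0 !mul0r !mulr0 addr0 -psi0.
  exact: (fr_psi_inj FR).
have [a [b [Ia Ib dE]]] := Jd.
have [c cE] : exists c, w * w = psi c.
  apply/(fr_psiP FR); split; first by apply: (fr_SM FR); exact: (fr_Sw FR).
  by rewrite (fr_thetaM FR) (fr_thetaw FR) mulrNN.
have /choice[g gP] : forall x, exists g : R * R,
    I x -> psi x = (psi g.1 + psi g.2 * w) * d.
  move=> x; have [Ix|nIx] := pselect (I x); last by exists (0, 0).
  have [s Ss sE] := dP _ (Jpsi _ Ix).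
  have [[p [q pq]] _] := fixed_decomposition Ss.
  by exists (p, q) => _; rewrite sE pq.
have uniq p q p' q' :
    (psi p + psi q * w) * d = (psi p' + psi q' * w) * d -> p = p' /\ q = q'.
  move/eqP; rewrite -subr_eq0 -mulrBl opprD addrACA -mulrBl -!(fr_psiB FR).
  move=> /eqP e; have [||/fixed_decomposition_uniq|//] := fr_dom FR _ _ e.
  - by apply: SD => //; apply: (fr_SM FR) => //; exact: (fr_Sw FR).
  - exact: JS.
  by case=> /eqP + /eqP; rewrite !subr_eq0 => /eqP-> /eqP->.
have gD x y : I x -> I y -> (g (x + y)).1 = (g x).1 + (g y).1 /\
    (g (x + y)).2 = (g x).2 + (g y).2.
  move=> Ix Iy; apply: uniq; rewrite -gP; last exact: ID.
  by rewrite !psiD (gP _ Ix) (gP _ Iy) -mulrDl addrACA -[in LHS]mulrDl.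
have gM r x : I x -> (g (r * x)).1 = r * (g x).1 /\ (g (r * x)).2 = r * (g x).2.
  move=> Ix; apply: uniq; rewrite -gP; last exact: Il.
  by rewrite !(fr_psiM FR) (gP _ Ix) mulrA mulrDr -!mulrA.
exists a, (c * b), (fun x => (g x).1), (fun x => (g x).2); split=> //.
- exact: Il.
- by split=> [x y Ix Iy|r x Ix]; [case: (gD x y Ix Iy)|case: (gM r x Ix)].
- by split=> [x y Ix Iy|r x Ix]; [case: (gD x y Ix Iy)|case: (gM r x Ix)].
move=> x Ix; have := gP _ Ix; move: (g x) => [p q] /=.
rewrite dE => e; apply/eqP; rewrite -subr_eq0.
have [[b' wb] [a' wa]] := (w_psi b, w_psi a).
have : psi (x - (p * a + q * (c * b))) + psi (- (p * b' + q * a')) * w = 0.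
  rewrite (fr_psiB FR) psiN !psiD !(fr_psiM FR) -cE e mulNr.
  rewrite -addrA -opprD; apply/eqP; rewrite subr_eq0; apply/eqP.
  rewrite !mulrDl !mulrDr -!mulrA -wa -wb.
  by rewrite [X in _ + X = _]addrC addrACA.
by case/fixed_decomposition_uniq => ->.
Qed.

Lemma fixed_ring_left_noetherian : left_noetherian R.
Proof.
move=> I I_id; have [I0 ID Il] := I_id.
have [a [b [phi [phi' [Ia Ib _ _ IE]]]]] := left_dual_basis I_id.
exists 2, (fun t : 'I_2 => if t == 0 then a else b).
apply/seteqP; split=> [x Ix|_ [c ->]] /=; last first.
  by rewrite big_ord_recl big_ord1 /=; apply: ID; exact: Il.
exists (fun t : 'I_2 => if t == 0 then phi x else phi' x).
by rewrite big_ord_recl big_ord1 /=; exact: IE.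
Qed.

Lemma fixed_ring_left_hereditary : left_hereditary R.
Proof.
move=> I I_id M N p f p_surj [fD fM].
have [a [b [phi [phi' [Ia Ib [phiD phiM] [phiD' phiM'] IE]]]]] := left_dual_basis I_id.
have [[m mE] [n nE]] := (p_surj (f a), p_surj (f b)).
have [_ _ Il] := I_id.
exists (fun x => phi x *: m + phi' x *: n).
  split=> [x y Ix Iy|r x Ix].
    by rewrite phiD // phiD' // !scalerDl addrACA.
  by rewrite phiM // phiM' // scalerDr !scalerA.
move=> x Ix; rewrite linearD !linearZ /= mE nE -!fM // -fD -?IE //; exact: Il.
Qed.

(** A common right multiple is found in [S], where the right ideal generated by [psi a] and [psi b]
    is principal. Its coordinates on [1, w] are then common multiples in [R], and one of them is
    non-zero. *)
Lemma fixed_ring_right_ore : right_ore R.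
Proof.
split=> [|a b a0 b0]; first exact: fixed_ring_domain.
have SM := fr_SM FR; have dom := fr_dom FR; have S1 := fr_S1 FR.
have psi_neq0 x : x <> 0 -> psi x <> 0.
  by move=> x0; rewrite -psi0 => /(fr_psi_inj FR).
suff [x [y [Sx [Sy [xy x0]]]]] : exists x y,
    S x /\ S y /\ psi a * x = psi b * y /\ psi a * x <> 0.
  have [[p [q xE]] _] := fixed_decomposition Sx.
  have [[p' [q' yE]] _] := fixed_decomposition Sy.
  have [ep eq] : a * p - b * p' = 0 /\ a * q - b * q' = 0.
    apply: fixed_decomposition_uniq; rewrite !(fr_psiB FR) !(fr_psiM FR) mulrBl.
    apply/eqP; rewrite addrACA -opprD -!mulrA -!mulrDr -xE -yE xy subrr //.
  have /eqP ap := ep; have /eqP aq := eq; rewrite subr_eq0 in ap; rewrite subr_eq0 in aq.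
  have [ap0|/eqP ap0] := eqVneq (a * p) 0; last by exists p, p'; split=> //; exact/eqP.
  have [aq0|/eqP aq0] := eqVneq (a * q) 0; last by exists q, q'; split=> //; exact/eqP.
  by case: x0; rewrite xE mulrDr mulrA -!(fr_psiM FR) ap0 aq0 psi0 mul0r addr0.
have [|x [u [v [Su Sv ->]]]|x y [u [v [Su Sv ->]]] [u' [v' [Su' Sv' ->]]]|
    s x Ss [u [v [Su Sv ->]]]|d [u [v [Su Sv dE]]] dP] := fr_rprincipal FR
    (J := [set x | exists u v, [/\ S u, S v & x = psi a * u + psi b * v]]%classic).
- by exists 0, 0; rewrite !mulr0 addr0.
- by apply: SD; apply: SM.
- exists (u - u'), (v - v'); split; [exact: (fr_SB FR)|exact: (fr_SB FR)|].
  by rewrite opprD addrACA -!mulrBr.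
- by exists (u * s), (v * s); split; [exact: SM|exact: SM|rewrite mulrDl !mulrA].
have [|a' Sa' aE] := dP (psi a).
  by exists 1, 0; rewrite mulr1 mulr0 addr0.
have [|b' Sb' bE] := dP (psi b).
  by exists 0, 1; rewrite mulr1 mulr0 add0r.
have Sd : S d by rewrite dE; apply: SD; apply: SM.
have a'0 : a' <> 0 by move=> e; apply: (psi_neq0 a a0); rewrite aE e mulr0.
have b'0 : b' <> 0 by move=> e; apply: (psi_neq0 b b0); rewrite bE e mulr0.
have d0 : d <> 0 by move=> e; apply: (psi_neq0 a a0); rewrite aE e mul0r.
have mulI x y : S x -> S y -> x <> 0 -> x * y = 0 -> y = 0.
  by move=> Sx Sy x0 /(dom _ _ Sx Sy)[].
have uv : a' * u + b' * v = 1.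
  apply/eqP; rewrite -subr_eq0; apply/eqP/(mulI d) => //.
    by apply: (fr_SB FR) => //; apply: SD; apply: SM.
  by rewrite mulrBr mulrDr !mulrA -aE -bE -dE mulr1 subrr.
(* The Bezout relation [uv] gives [a' (1 - u a') = b' v a']. If this vanishes, then [v = 0] and
   [a' u = 1], so that [psi b] is itself a right multiple of [psi a]. *)
have [bva|/eqP bva] := eqVneq (b' * (v * a')) 0.
  have [/(mulI _ _ Sb' Sv b'0)|//] : b' * v = 0 \/ a' = 0.
    by apply: dom => //; [exact: SM|rewrite -mulrA].
  move=> v0; move: uv; rewrite v0 mulr0 addr0 => uv.
  exists (u * b'), 1; split; [exact: SM|split=> //].
  suff -> : psi a * (u * b') = psi b by rewrite mulr1; split=> //; exact: psi_neq0.
  by rewrite aE -mulrA (mulrA a') uv mul1r.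
exists (1 - u * a'), (v * a'); split; [by apply: (fr_SB FR) => //; apply: SM|].
split; [exact: SM|].
have e : psi a * (1 - u * a') = psi b * (v * a').
  rewrite aE bE -!mulrA; congr (d * _).
  rewrite mulrBr mulr1; apply/eqP; rewrite subr_eq -{1}[a']mul1r -uv mulrDl.
  by rewrite -!mulrA addrC.
split=> //; rewrite e bE -mulrA => /(mulI _ _ Sd) h; apply: bva; apply: h => //.
by apply/SM => //; exact: SM.
Qed.

(** The right order of a non-zero two-sided ideal is [R], without fractions. *)
Lemma fixed_ring_quotient (I : set R) a s : two_sided_ideal I -> I <> [set 0]%classic ->
  s <> 0 -> (forall x, I x -> exists2 y, I y & x * a = y * s) ->
  exists r, a = r * s.
Proof.
move=> I2 In0 s0 Ias; have [I_id Ir] := I2; have [I0 ID Il] := I_id.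
have SM := fr_SM FR; have dom := fr_dom FR.
have [JS [J0 Jpsi]] := inducedS I0.
have JB := inducedB I_id.
have JN x : induced I x -> induced I (- x) by move=> Jx; rewrite -sub0r; exact: JB.
have JD x y : induced I x -> induced I y -> induced I (x + y).
  by move=> Jx Jy; rewrite -[y]opprK; apply: JB => //; exact: JN.
(* Invariance of [I] under conjugation by [w] is used here: it makes [S I] a right ideal of [S] as
   well. *)
have Jr t x : S t -> induced I x -> induced I (x * t).
  move=> St [b [c [Ib Ic ->]]]; have [_ [p [q ->]]] := fixed_decomposition St.
  have JM e : I e -> induced I (psi e * (psi p + w * psi q)).
    move=> Ie; have [_ [e' Ie' ee']] := fr_ideal FR I2 Ie.
    exists (e * p), (e' * q); split; [exact: Ir|exact: Ir|].
    by rewrite mulrDr mulrA ee' !(fr_psiM FR) -mulrA.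
  rewrite mulrDl -mulrA; apply: JD; first exact: JM.
  by apply: (inducedZ I_id); [exact: (fr_Sw FR)|exact: JM].
(* With [S I = d S], the hypothesis puts [d * psi a] in [d S psi s]. Cancelling [d] leaves
   [psi a = u * psi s], and [u] is invariant since [psi a] and [psi s] are. *)
have [d Jd dP] := fr_rprincipal FR J0 JS JB Jr.
have d0 : d <> 0.
  move=> e; apply: In0; apply/seteqP; split=> [x /Jpsi/dP[t _]|x ->] //=.
  by rewrite e mul0r -psi0 => /(fr_psi_inj FR).
have [j Jj jE] : exists2 j, induced I j & d * psi a = j * psi s.
  have [b [c [/Ias[b' Ib' bE] /Ias[c' Ic' cE] ->]]] := Jd.
  exists (psi b' + w * psi c'); first by exists b', c'.
  by rewrite !mulrDl -!mulrA -!(fr_psiM FR) bE cE.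
have [u Su uE] := dP _ Jj.
have psiE : psi a = u * psi s.
  apply/eqP; rewrite -subr_eq0; apply/eqP.
  have [|||//|//] := dom d (psi a - u * psi s).
  - exact: JS.
  - by apply: (fr_SB FR) => //; exact: SM.
  - by rewrite mulrBr jE uE mulrA subrr.
have thetau : theta u = u.
  have /eqP := congr1 theta psiE; rewrite (fr_thetaM FR) !thetapsi psiE.
  rewrite -subr_eq0 -mulrBl => /eqP e; have [||/eqP|] := dom _ _ _ _ e.
  - by apply: (fr_SB FR) => //; exact: (fr_thetaS FR).
  - exact: Spsi.
  - by rewrite subr_eq0 => /eqP.
  by rewrite -psi0 => /(fr_psi_inj FR).
have [r rE] : exists r, u = psi r by apply/(fr_psiP FR).
by exists r; apply: (fr_psi_inj FR); rewrite (fr_psiM FR) -rE.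
Qed.

(** A linear map [chi] from [I] to [R] is right multiplication by the fraction [x0^-1 chi(x0)], by
    the left Ore condition. The identities satisfied by [f] are separate hypotheses so that [f] can
    also be read as a map from [R^c] to [Q^c]. *)
Lemma fraction_dual_basis (Q : unitRingType) (f : R -> Q) (I : set R) :
  (forall a b, f (a + b) = f a + f b) -> (forall a b, f (a * b) = f a * f b) ->
  f 1 = 1 -> (forall s, s <> 0 -> f s \is a GRing.unit) ->
  right_ore R^c -> left_ideal I -> I <> [set 0]%classic ->
  exists a b p q, [/\ I a, I b, p * f a + q * f b = 1 &
    forall x, I x -> (exists r, f x * p = f r) /\ (exists r, f x * q = f r)].
Proof.
move=> fD fM f1 fU [_ ore] I_id In0; have [I0 ID Il] := I_id.
have [a [b [phi [phi' [Ia Ib [_ phiM] [_ phiM'] IE]]]]] := left_dual_basis I_id.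
have [x0 [Ix0 x0n]] : exists x, I x /\ x <> 0.
  apply/not_existsP => h; apply: In0; apply/seteqP; split=> [x Ix|x ->] //=.
  by apply/not_notP => x0; apply: (h x).
have fx0 := fU _ x0n.
have key (chi : R -> R) : (forall r x, I x -> chi (r * x) = r * chi x) ->
    forall x, I x -> f x * ((f x0)^-1 * f (chi x0)) = f (chi x).
  move=> chiM x Ix; have [->|/eqP xn] := eqVneq x 0.
    have f0 : f 0 = 0 by apply: (addrI (f 0)); rewrite -fD !addr0.
    by have := chiM 0 0 I0; rewrite !mul0r => ->; rewrite f0 mul0r.
  have [c [d [cd c0]]] : exists c d : R, c * x = d * x0 /\ c * x <> 0.
    exact: ore.
  have cn : c <> 0 by move=> e; apply: c0; rewrite e mul0r.
  apply: (mulrI (fU _ cn)); rewrite !mulrA -fM cd fM (mulrK fx0) -!fM -chiM //.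
  by rewrite -cd chiM.
exists a, b, ((f x0)^-1 * f (phi x0)), ((f x0)^-1 * f (phi' x0)); split=> //.
  by rewrite -!mulrA -!fM -mulrDr -fD -IE // mulVr.
move=> x Ix; split; [exists (phi x)|exists (phi' x)]; exact: key.
Qed.
End FixedRing.

Section Asano.
Variables (E : pzRingType) (S : set E) (theta : E -> E) (w w' : E).
Variables (R : pzRingType) (psi : R -> E).
Hypothesis FR : fixed_ring S theta w w' psi.

Lemma two_sided_ideal_to_conv (I : set R) :
  two_sided_ideal I -> @two_sided_ideal R^c I.
Proof. by case=> -[I0 ID Il] Ir; split=> //. Qed.

(** The inverse is the set [J] of the [q] with [I q] in [R]. If [I q] lies in [R], then [I q I] lies
    in [I], so [q I] lies in the right order of [I], which is [R]; the converse uses the left order.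
    Thus [J] has the same description on both sides, and the two dual bases put [1] in [I J] and in
    [J I]. *)
Lemma fixed_ring_invertible (Q : unitRingType) (f : {rmorphism R -> Q}) (I : set R) :
  is_ring_of_fractions f -> two_sided_ideal I -> I <> [set 0]%classic ->
  invertible_in f I.
Proof.
move=> [f_inj fU0 rfrac lfrac] I2 In0; have [I_id Ir] := I2.
have [I0 ID Il] := I_id.
have dom := fixed_ring_domain FR.
have fU s : s <> 0 -> f s \is a GRing.unit.
  by move=> s0; apply: fU0; apply/domain_regular.
have FRc := fixed_ring_conv FR.
have ore := fixed_ring_right_ore FR.
have orec := fixed_ring_right_ore FRc.
have Ic := two_sided_ideal_to_conv I2.
have lorder q : (forall x, I x -> exists2 y, I y & q * f x = f y) ->
    exists r, q = f r.
  have [a [s [sreg ->]]] := lfrac q => h.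
  have s0 : s <> 0 by apply/(domain_regular _ dom).
  have [x Ix|r rE] := fixed_ring_quotient FRc (a := a) Ic In0 s0.
    have [y Iy e] := h x Ix; exists y => //.
    apply: f_inj; rewrite !rmorphM -e !mulrA mulrV ?mul1r //; exact: fU.
  exists r; rewrite (rE : a = s * r) rmorphM mulKr //; exact: fU.
have rorder q : (forall x, I x -> exists2 y, I y & f x * q = f y) ->
    exists r, q = f r.
  have [a [s [sreg ->]]] := rfrac q => h.
  have s0 : s <> 0 by apply/(domain_regular _ dom).
  have [x Ix|r rE] := fixed_ring_quotient FR (a := a) I2 In0 s0.
    have [y Iy e] := h x Ix; exists y => //.
    by apply: f_inj; rewrite !rmorphM -e mulrA divrK //; exact: fU.
  by exists r; rewrite rE rmorphM mulrK //; exact: fU.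
pose J : set Q := [set q | forall x, I x -> exists r, f x * q = f r]%classic.
have JP q : J q <-> forall x, I x -> exists r, q * f x = f r.
  split=> h x Ix.
    apply: rorder => y Iy; have [r rE] := h y Iy.
    by exists (r * x); [exact: Il|rewrite rmorphM -rE mulrA].
  apply: lorder => y Iy; have [r rE] := h y Iy.
  by exists (x * r); [exact: Ir|rewrite rmorphM -rE mulrA].
have Jbi : sub_bimodule f J.
  split=> [x Ix|x y Jx Jy z Iz|a x Jx z Iz|a x Jx z Iz].
  - by exists 0; rewrite mulr0 raddf0.
  - have [[r rE] [r' rE']] := (Jx z Iz, Jy z Iz).
    by exists (r + r'); rewrite mulrDr rmorphD rE rE'.
  - by rewrite mulrA -rmorphM; apply: Jx; exact: Ir.
  - by have [r rE] := Jx z Iz; exists (r * a); rewrite mulrA rE rmorphM.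
have sumf n (u : 'I_n -> Q) : (forall t, exists r, u t = f r) ->
    exists r, \sum_t u t = f r.
  move=> uP; elim/big_ind: _ => [|x y [r ->] [r' ->]|//]; first by exists 0; rewrite raddf0.
  by exists (r + r'); rewrite raddfD.
have [JZ JZr] : (forall a x, J x -> J (f a * x)) /\ (forall a x, J x -> J (x * f a)).
  by case: Jbi.
exists J; split=> //; apply/seteqP; split=> [q [n [a [b [aI bJ ->]]]]|q [r _ <-]].
- have [t|r ->] := sumf n (fun t => a t * b t); last by exists r.
  by have [x Ix <-] := aI t; have [r ->] := bJ t x Ix; exists r.
- have [a [b [p [p' [Ia Ib e pP]]]]] : exists a b (p p' : Q),
      [/\ I a, I b, f a * p + f b * p' = 1 & forall x, I x ->
        (exists r, p * f x = f r) /\ (exists r, p' * f x = f r)].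
    exact: (fraction_dual_basis (Q := Q^c) (f := f) FRc
      (rmorphD f) (fun a b => rmorphM f b a) (rmorph1 f) fU ore Ic.1 In0).
  have Jp : J p by apply/JP => x /pP[].
  have Jp' : J p' by apply/JP => x /pP[].
  exists 2, (fun t : 'I_2 => if t == 0 then f a else f b),
    (fun t : 'I_2 => if t == 0 then p * f r else p' * f r); split.
  + by move=> t; case: ifP => _; [exists a|exists b].
  + by move=> t; case: ifP => _; apply: JZr.
  by rewrite big_ord_recl big_ord1 /= !mulrA -mulrDl e mul1r.
- have [t|r ->] := sumf n (fun t => a t * b t); last by exists r.
  by have [x Ix <-] := bJ t; have [r ->] := (JP _).1 (aI t) x Ix; exists r.
have [a [b [p [p' [Ia Ib e pP]]]]] := fraction_dual_basis (f := f) FR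
    (rmorphD f) (rmorphM f) (rmorph1 f) fU orec I_id In0.
have Jp : J p by move=> x /pP[].
have Jp' : J p' by move=> x /pP[].
exists 2, (fun t : 'I_2 => if t == 0 then f r * p else f r * p'),
  (fun t : 'I_2 => if t == 0 then f a else f b); split.
+ by move=> t; case: ifP => _; apply: JZ.
+ by move=> t; case: ifP => _; [exists a|exists b].
by rewrite big_ord_recl big_ord1 /= -!mulrA -mulrDr e mulr1.
Qed.

Lemma fixed_ring_dedekind : dedekind_domain R.
Proof.
have FRc := fixed_ring_conv FR.
split.
- exact: fixed_ring_domain FR.
- split; [exact: fixed_ring_left_noetherian FR|].
  exact: fixed_ring_left_noetherian FRc.
- split; [exact: fixed_ring_left_hereditary FR|].
  exact: fixed_ring_left_hereditary FRc.
have ore := fixed_ring_right_ore FR.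
have frac := ore_fractions ore (fixed_ring_right_ore FRc).
exists (germ ore), (@to_germ R ore); split=> // I I2 In0.
exact: fixed_ring_invertible.
Qed.
End Asano.

(** * Skew Laurent polynomials *)

Section AdditiveEndomorphisms.
Variable U : zmodType.

Definition zmod_endo : {pred U -> U} := fun f => `[< zmod_morphism f >].

Fact zmod_endo_closed : zmod_closed zmod_endo.
Proof.
split=> [|f g /asboolP fB /asboolP gB]; apply/asboolP => x y.
  by rewrite subrr.
by rewrite !fctE fB gB opprD addrACA [in RHS]opprD.
Qed.
HB.instance Definition _ := GRing.isZmodClosed.Build _ zmod_endo zmod_endo_closed.

(** The skew Laurent ring is realised by operators on sequences inside this ring, so its ring axioms
    come from composition. *)
Record zend := ZEnd { zend_fun :> U -> U; _ : zend_fun \in zmod_endo }.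
HB.instance Definition _ := [isSub for zend_fun].
HB.instance Definition _ := [Choice of zend by <:].
HB.instance Definition _ := [SubChoice_isSubZmodule of zend by <:].

Lemma zendB (a : zend) x y : a (x - y) = a x - a y.
Proof. by case: a => f /= /asboolP; exact. Qed.

Lemma zend_ext (a b : zend) : (forall x, a x = b x) -> a = b.
Proof. by move=> ab; apply/val_inj/funext. Qed.

Lemma zend_id_subproof : idfun \in zmod_endo.
Proof. exact/asboolP. Qed.

Lemma zend_comp_subproof (a b : zend) : a \o b \in zmod_endo.
Proof. by apply/asboolP => x y /=; rewrite !zendB. Qed.

Definition zend_comp (a b : zend) : zend := ZEnd (zend_comp_subproof a b).

Lemma zendDE (a b : zend) x : (a + b) x = a x + b x.
Proof. by rewrite -[LHS]/(val (a + b) x) raddfD. Qed.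

Fact zend_compA : associative zend_comp.
Proof. by move=> a b c; exact: zend_ext. Qed.

Fact zend_comp1l : left_id (ZEnd zend_id_subproof) zend_comp.
Proof. by move=> a; exact: zend_ext. Qed.

Fact zend_comp1r : right_id (ZEnd zend_id_subproof) zend_comp.
Proof. by move=> a; exact: zend_ext. Qed.

Fact zend_compDl : left_distributive zend_comp +%R.
Proof. by move=> a b c; apply: zend_ext => x; rewrite [RHS]zendDE; exact: zendDE. Qed.

Fact zend_compDr : right_distributive zend_comp +%R.
Proof.
move=> a b c; apply: zend_ext => x; rewrite [RHS]zendDE.
rewrite -[LHS]/(a ((b + c) x)) -[zend_comp a b x]/(a (b x)) -[zend_comp a c x]/(a (c x)).
rewrite zendDE.
have a0 : a 0 = 0 by rewrite -{1}(subrr 0) zendB subrr.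
have aN y : a (- y) = - a y by rewrite -sub0r zendB a0 sub0r.
by rewrite -{1}[c x]opprK zendB aN opprK.
Qed.

HB.instance Definition _ := GRing.Zmodule_isPzRing.Build zend
  zend_compA zend_comp1l zend_comp1r zend_compDl zend_compDr.

Lemma zendME (a b : zend) x : (a * b) x = a (b x).
Proof. by []. Qed.

Lemma zendBE (a b : zend) x : (a - b) x = a x - b x.
Proof. by rewrite -[LHS]/(val (a - b) x) raddfB. Qed.
End AdditiveEndomorphisms.

Section SkewLaurent.
Variables (F : fieldType) (s sV tau : {rmorphism F -> F}).
Hypotheses (sK : cancel s sV) (sVK : cancel sV s).
Hypotheses (tauK : involutive tau) (tau_s : forall x, tau (s (tau x)) = sV x).

Definition spow (k : int) : F -> F :=
  match k with Posz n => iter n s | Negz n => iter n.+1 sV end.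

Lemma spowS k x : spow (k + 1) x = s (spow k x).
Proof.
case: k => [n|[|n]]; first by rewrite -PoszD addn1.
  by rewrite /= sVK.
have -> : Negz n.+1 + 1 = Negz n by lia.
by rewrite /= sVK.
Qed.

Lemma spowP k x : spow (k - 1) x = sV (spow k x).
Proof. by rewrite -{2}[k](subrK 1) spowS sK. Qed.

Lemma spow_ind (P : int -> Prop) : P 0 -> (forall k, P k -> P (k + 1)) ->
  (forall k, P k -> P (k - 1)) -> forall k, P k.
Proof.
move=> P0 PS PP; elim/int_rec => [//|k Pk|k Pk]; first by rewrite -addn1 PoszD; exact: PS.
by rewrite -addn1 PoszD opprD; exact: PP.
Qed.

Lemma spowD k l x : spow (k + l) x = spow k (spow l x).
Proof.
elim/spow_ind: k => [|k IHk|k IHk]; first by rewrite add0r.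
  by rewrite addrAC !spowS IHk.
by rewrite addrAC !spowP IHk.
Qed.

Fact spow_zmod_morphism k : zmod_morphism (spow k).
Proof.
move=> x y; elim/spow_ind: k => [//|k IHk|k IHk].
  by rewrite !spowS IHk rmorphB.
by rewrite !spowP IHk rmorphB.
Qed.

Fact spow_monoid_morphism k : monoid_morphism (spow k).
Proof.
elim/spow_ind: k => [//|k [IH1 IHM]|k [IH1 IHM]].
  by split=> [|x y]; rewrite !spowS ?IH1 ?IHM ?rmorph1 ?rmorphM.
by split=> [|x y]; rewrite !spowP ?IH1 ?IHM ?rmorph1 ?rmorphM.
Qed.
HB.instance Definition _ k :=
  GRing.isZmodMorphism.Build F F (spow k) (spow_zmod_morphism k).
HB.instance Definition _ k :=
  GRing.isMonoidMorphism.Build F F (spow k) (spow_monoid_morphism k).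

Definition spow_rmorphism k : {rmorphism F -> F} := spow k.

Lemma tau_sV x : tau (sV (tau x)) = s x.
Proof. by rewrite -tau_s !tauK. Qed.

Lemma tau_spow k x : tau (spow k (tau x)) = spow (- k) x.
Proof.
elim/spow_ind: k x => [|k IHk|k IHk] x; first by rewrite oppr0 tauK.
- by rewrite opprD spowP spowS -[spow k _]tauK IHk tau_s.
by rewrite opprB [1 - k]addrC spowS spowP -[spow k _]tauK IHk tau_sV.
Qed.

Local Notation U := (int -> F).
Local Notation E := (zend (int -> F)).

Lemma mon_subproof c k : (fun (f : U) n => c * spow k (f (n - k))) \in @zmod_endo U.
Proof.
apply/asboolP => f g; apply/funext => n.
by rewrite !fctE rmorphB mulrBr.
Qed.

(** The operator [c t ^ k] on sequences, where [t] shifts and applies [s]. *)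
Definition mon c k : E := ZEnd (mon_subproof c k).

Lemma mon_mul c k d l : mon c k * mon d l = mon (c * spow k d) (k + l).
Proof.
apply: zend_ext => f; apply/funext => n.
by rewrite zendME /= rmorphM /= mulrA -spowD opprD addrA.
Qed.

Lemma mon1 : mon 1 0 = 1.
Proof. by apply: zend_ext => f; apply/funext => n; rewrite /= mul1r subr0. Qed.

Lemma monB c d k : mon (c - d) k = mon c k - mon d k.
Proof. by apply: zend_ext => f; apply/funext => n; rewrite zendBE !fctE /= mulrBl. Qed.

Lemma mon0 k : mon 0 k = 0.
Proof. by rewrite -(subrr 0) monB subrr. Qed.

Lemma monN c k : mon (- c) k = - mon c k.
Proof. by rewrite -sub0r monB mon0 sub0r. Qed.

Lemma monD c d k : mon (c + d) k = mon c k + mon d k.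
Proof. by rewrite -{1}[d]opprK monB monN opprK. Qed.

(** The operator [c t^k] sends the indicator of [0] to the sequence with the single value [c] at
    [k]. Coefficients are thus determined by the operator, and uniqueness of the expansion needs no
    separate argument. *)
Definition cf (a : E) (n : int) : F := a (fun k => (k == 0)%:R) n.

Lemma cfB a b n : cf (a - b) n = cf a n - cf b n.
Proof. by rewrite /cf zendBE. Qed.

Lemma cfD a b n : cf (a + b) n = cf a n + cf b n.
Proof. by rewrite /cf zendDE. Qed.

Lemma cf_mon c k n : cf (mon c k) n = if n == k then c else 0.
Proof.
rewrite /cf /= subr_eq0; case: eqP => _; first by rewrite rmorph1 mulr1.
by rewrite rmorph0 mulr0.
Qed.

(** [laurent m n] consists of the skew Laurent polynomials supported in
    [m, n). *)
Inductive laurent (m n : int) : E -> Prop :=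
| laurent0 : laurent m n 0
| laurentD c k a : m <= k < n -> laurent m n a -> laurent m n (a + mon c k).

Lemma laurent_mon m n c k : m <= k < n -> laurent m n (mon c k).
Proof. by move=> kmn; rewrite -[mon c k]add0r; apply: laurentD => //; exact: laurent0. Qed.

Lemma laurent_add m n a b : laurent m n a -> laurent m n b -> laurent m n (a + b).
Proof.
move=> La; elim=> [|c k b' kmn _ Lab]; first by rewrite addr0.
by rewrite addrA; exact: laurentD.
Qed.

Lemma laurent_opp m n a : laurent m n a -> laurent m n (- a).
Proof.
elim=> [|c k b kmn _ Lb]; first by rewrite oppr0; exact: laurent0.
by rewrite opprD -monN; exact: laurentD.
Qed.

Lemma laurent_sub m n a b : laurent m n a -> laurent m n b -> laurent m n (a - b).
Proof. by move=> La Lb; apply: laurent_add => //; exact: laurent_opp. Qed.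

Lemma laurent_widen m n m' n' a :
  m' <= m -> n <= n' -> laurent m n a -> laurent m' n' a.
Proof.
move=> mm nn; elim=> [|c k b kmn _ Lb]; first exact: laurent0.
by apply: laurentD => //; lia.
Qed.

Lemma laurent_mul m n m' n' a b :
  laurent m n a -> laurent m' n' b -> laurent (m + m') (n + n' - 1) (a * b).
Proof.
move=> La Lb.
have monL c k : m <= k < n -> laurent (m + m') (n + n' - 1) (mon c k * b).
  move=> kmn; elim: Lb => [|d l b' lmn _ Lb]; first by rewrite mulr0; exact: laurent0.
  by rewrite mulrDr mon_mul; apply: laurentD => //; lia.
elim: La => [|c k a' kmn _ La]; first by rewrite mul0r; exact: laurent0.
by rewrite mulrDl; apply: laurent_add => //; exact: monL.
Qed.

Lemma laurent_eq0 m n a : n <= m -> laurent m n a -> a = 0.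
Proof. by move=> nm; elim=> // c k b kmn; lia. Qed.

Lemma cf_laurent m n a k : laurent m n a -> ~~ (m <= k < n) -> cf a k = 0.
Proof.
move=> La kmn; elim: La => [|c l b lmn _ b0]; first by rewrite -(subrr 0) cfB subrr.
by rewrite cfD b0 cf_mon add0r; case: eqP => // kl; move: kmn lmn; rewrite kl => /negbTE->.
Qed.

Lemma laurent_top m n a :
  laurent m (n + 1) a -> laurent m n (a - mon (cf a n) n).
Proof.
have cf00 k : cf 0 k = 0 by rewrite -(subrr 0) cfB subrr.
elim=> [|c k b kmn _ Lb]; first by rewrite cf00 mon0 subr0; exact: laurent0.
rewrite cfD cf_mon monD opprD addrACA; apply: laurent_add => //.
have [->|nk] := eqVneq n k; first by rewrite subrr; exact: laurent0.
by rewrite mon0 subr0; apply: laurent_mon; lia.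
Qed.

Lemma laurent_bot m n a :
  laurent m n a -> laurent (m + 1) n (a - mon (cf a m) m).
Proof.
have cf00 k : cf 0 k = 0 by rewrite -(subrr 0) cfB subrr.
elim=> [|c k b kmn _ Lb]; first by rewrite cf00 mon0 subr0; exact: laurent0.
rewrite cfD cf_mon monD opprD addrACA; apply: laurent_add => //.
have [->|nk] := eqVneq m k; first by rewrite subrr; exact: laurent0.
by rewrite mon0 subr0; apply: laurent_mon; lia.
Qed.

Lemma cf_top_mul m n m' n' a b : laurent m (n + 1) a -> laurent m' (n' + 1) b ->
  cf (a * b) (n + n') = cf a n * spow n (cf b n').
Proof.
move=> La Lb.
have La' := laurent_top La; have Lb' := laurent_top Lb.
rewrite -{1}[a](subrK (mon (cf a n) n)) mulrDl cfD.
rewrite (cf_laurent (laurent_mul La' Lb)) ?add0r; last by lia.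
rewrite -{1}[b](subrK (mon (cf b n') n')) mulrDr cfD.
have Lm : laurent n (n + 1) (mon (cf a n) n) by apply: laurent_mon; lia.
rewrite (cf_laurent (laurent_mul Lm Lb')) ?add0r; last by lia.
by rewrite mon_mul cf_mon eqxx.
Qed.

Definition laurent_ring : set E := [set a | exists m n, laurent m n a]%classic.

Lemma laurent_leading a : laurent_ring a -> a <> 0 ->
  exists m k, laurent m (m + k%:Z + 1) a /\ cf a (m + k%:Z) != 0.
Proof.
move=> [m [n La]] a0.
have {La} : exists k : nat, laurent m (m + k%:Z) a.
  by exists `|(n - m)%R|%N; apply: laurent_widen La; lia.
case; elim=> [|k IHk] La; first by case: a0; apply: laurent_eq0 La; lia.
have {}La : laurent m (m + k%:Z + 1) a by rewrite -addrA -PoszD addn1.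
have [c0|cn0] := eqVneq (cf a (m + k%:Z)) 0; last by exists m, k.
by apply: IHk; have := laurent_top La; rewrite c0 mon0 subr0.
Qed.

Lemma laurent_ring1 : laurent_ring 1.
Proof. by exists 0, 1; rewrite -mon1; apply: laurent_mon. Qed.

Lemma laurent_ringB a b : laurent_ring a -> laurent_ring b -> laurent_ring (a - b).
Proof.
move=> [m [n La]] [m' [n' Lb]]; exists (Num.min m m'), (Num.max n n').
by apply: laurent_sub; [apply: laurent_widen La|apply: laurent_widen Lb]; lia.
Qed.

Lemma laurent_ringM a b : laurent_ring a -> laurent_ring b -> laurent_ring (a * b).
Proof.
by move=> [m [n La]] [m' [n' Lb]]; exists (m + m'), (n + n' - 1); exact: laurent_mul.
Qed.

Lemma laurent_ring_mon c k : laurent_ring (mon c k).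
Proof. by exists k, (k + 1); apply: laurent_mon; lia. Qed.

Lemma cf0 n : cf 0 n = 0.
Proof. by rewrite -(subrr 0) cfB subrr. Qed.

Lemma laurent_ring_domain a b : laurent_ring a -> laurent_ring b ->
  a * b = 0 -> a = 0 \/ b = 0.
Proof.
move=> La Lb ab0; have [->|/eqP a0] := eqVneq a 0; first by left.
have [->|/eqP b0] := eqVneq b 0; first by right.
have [m [k [{}La {}a0]]] := laurent_leading La a0.
have [m' [k' [{}Lb {}b0]]] := laurent_leading Lb b0.
have /eqP := cf_top_mul La Lb; rewrite ab0 cf0 eq_sym mulf_eq0 (negbTE a0) fmorph_eq0.
by rewrite (negbTE b0).
Qed.

(** Euclidean division by an element [d] of [J] whose non-zero top coefficient lies at the least
    distance [k] above a lower bound of the support. Only top terms are cancelled: [r * d] occupies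
    the degrees from [p + l - k] to [p + l], which stay above the lower bound [p] of [a] as
    [k <= l]. *)
Lemma laurent_lprincipal (J : set E) : J 0 ->
  (forall a, J a -> laurent_ring a) -> (forall a b, J a -> J b -> J (a - b)) ->
  (forall r a, laurent_ring r -> J a -> J (r * a)) ->
  exists2 d, J d & forall a, J a -> exists2 r, laurent_ring r & a = r * d.
Proof.
move=> J0 JS JB JM.
have [Jn0|Jz] := pselect (exists a, J a /\ a <> 0); last first.
  exists 0 => // a Ja; exists 0; first exact: JS.
  by rewrite mulr0; apply/not_notP => a0; apply: Jz; exists a.
pose P k := `[< exists d m, [/\ J d, laurent m (m + k%:Z + 1) d & cf d (m + k%:Z) != 0] >].
have exP : exists k, P k.
  have [a [Ja a0]] := Jn0; have [m [k [La ak]]] := laurent_leading (JS _ Ja) a0.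
  by exists k; apply/asboolP; exists a, m.
case: (ex_minnP exP) => k /asboolP[d [m [Jd Ld d0]]] kmin; exists d => // a Ja.
have [p [n La]] := JS _ Ja.
have {La} : exists l : nat, laurent p (p + l%:Z) a.
  by exists `|(n - p)%R|%N; apply: laurent_widen La; lia.
case=> l; elim: l a Ja => [|l IHl] a Ja La.
  exists 0; first exact: JS.
  by rewrite mul0r; apply: laurent_eq0 La; lia.
have {}La : laurent p (p + l%:Z + 1) a by rewrite -addrA -PoszD addn1.
have [c0|cn0] := eqVneq (cf a (p + l%:Z)) 0.
  by apply: IHl => //; have := laurent_top La; rewrite c0 mon0 subr0.
have kl : (k <= l)%N by apply: kmin; apply/asboolP; exists a, p.
pose j := p + l%:Z - (m + k%:Z).
pose r := mon (cf a (p + l%:Z) / spow j (cf d (m + k%:Z))) j.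
have Jrd : J (r * d) by apply: JM => //; exact: laurent_ring_mon.
have Lr : laurent j (j + 1) r by apply: laurent_mon; lia.
have [||q Lq qE] := IHl (a - r * d).
- exact: JB.
- have Lrd : laurent p (p + l%:Z + 1) (r * d).
    by apply: laurent_widen (laurent_mul Lr Ld); rewrite /j; lia.
  have := laurent_top (laurent_sub La Lrd); rewrite cfB.
  have -> : cf (r * d) (p + l%:Z) = cf a (p + l%:Z).
    have -> : p + l%:Z = j + (m + k%:Z) by rewrite /j subrK.
    by rewrite (cf_top_mul Lr Ld) cf_mon eqxx /j subrK divfK // fmorph_eq0.
  by rewrite subrr mon0 subr0.
exists (q + r); last by rewrite mulrDl -qE subrK.
rewrite -[r]opprK -[- r]sub0r; apply: laurent_ringB => //; apply: laurent_ringB.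
  exact: JS.
exact: laurent_ring_mon.
Qed.

Lemma laurent_rprincipal (J : set E) : J 0 ->
  (forall a, J a -> laurent_ring a) -> (forall a b, J a -> J b -> J (a - b)) ->
  (forall r a, laurent_ring r -> J a -> J (a * r)) ->
  exists2 d, J d & forall a, J a -> exists2 r, laurent_ring r & a = d * r.
Proof.
move=> J0 JS JB JM.
have [Jn0|Jz] := pselect (exists a, J a /\ a <> 0); last first.
  exists 0 => // a Ja; exists 0; first exact: JS.
  by rewrite mulr0; apply/not_notP => a0; apply: Jz; exists a.
pose P k := `[< exists d m, [/\ J d, laurent m (m + k%:Z + 1) d & cf d (m + k%:Z) != 0] >].
have exP : exists k, P k.
  have [a [Ja a0]] := Jn0; have [m [k [La ak]]] := laurent_leading (JS _ Ja) a0.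
  by exists k; apply/asboolP; exists a, m.
case: (ex_minnP exP) => k /asboolP[d [m [Jd Ld d0]]] kmin; exists d => // a Ja.
have [p [n La]] := JS _ Ja.
have {La} : exists l : nat, laurent p (p + l%:Z) a.
  by exists `|(n - p)%R|%N; apply: laurent_widen La; lia.
case=> l; elim: l a Ja => [|l IHl] a Ja La.
  exists 0; first exact: JS.
  by rewrite mulr0; apply: laurent_eq0 La; lia.
have {}La : laurent p (p + l%:Z + 1) a by rewrite -addrA -PoszD addn1.
have [c0|cn0] := eqVneq (cf a (p + l%:Z)) 0.
  by apply: IHl => //; have := laurent_top La; rewrite c0 mon0 subr0.
have kl : (k <= l)%N by apply: kmin; apply/asboolP; exists a, p.
pose j := p + l%:Z - (m + k%:Z).
(* On the right of [d], the coefficient of [r] is twisted by the power of [s] given by the degree of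
   [d]; the opposite power undoes this. *)
pose r := mon (spow (- (m + k%:Z)) (cf a (p + l%:Z) / cf d (m + k%:Z))) j.
have Jrd : J (d * r) by apply: JM => //; exact: laurent_ring_mon.
have Lr : laurent j (j + 1) r by apply: laurent_mon; lia.
have [||q Lq qE] := IHl (a - d * r).
- exact: JB.
- have Lrd : laurent p (p + l%:Z + 1) (d * r).
    by apply: laurent_widen (laurent_mul Ld Lr); rewrite /j; lia.
  have := laurent_top (laurent_sub La Lrd); rewrite cfB.
  have -> : cf (d * r) (p + l%:Z) = cf a (p + l%:Z).
    have jE : (m + k%:Z) + j = p + l%:Z by rewrite /j addrC subrK.
    by rewrite -{1}jE (cf_top_mul Ld Lr) cf_mon eqxx -spowD subrr mulrC divfK.
  by rewrite subrr mon0 subr0.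
exists (q + r); last by rewrite mulrDr -qE subrK.
rewrite -[r]opprK -[- r]sub0r; apply: laurent_ringB => //; apply: laurent_ringB.
  exact: JS.
exact: laurent_ring_mon.
Qed.

Lemma flip_subproof : (fun (f : U) n => tau (f (- n))) \in @zmod_endo U.
Proof. by apply/asboolP => f g; apply/funext => n; rewrite !fctE rmorphB. Qed.

(** The involution of the skew Laurent ring is conjugation by this operator, which makes its
    multiplicativity immediate. *)
Definition flip : E := ZEnd flip_subproof.

Lemma flipK : flip * flip = 1.
Proof. by apply: zend_ext => f; apply/funext => n; rewrite zendME /= tauK opprK. Qed.

Definition theta (a : E) : E := flip * a * flip.

Lemma thetaB a b : theta (a - b) = theta a - theta b.
Proof. by rewrite /theta mulrBr mulrBl. Qed.

Lemma thetaM a b : theta (a * b) = theta a * theta b.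
Proof.
by rewrite /theta -!mulrA; do 2!congr (_ * _); rewrite !mulrA flipK mul1r.
Qed.

Lemma thetaK a : theta (theta a) = a.
Proof. by rewrite /theta !mulrA flipK mul1r -mulrA flipK mulr1. Qed.

Lemma theta_mon c k : theta (mon c k) = mon (tau c) (- k).
Proof.
apply: zend_ext => f; apply/funext => n; rewrite /theta !zendME /=.
by rewrite rmorphM /= tau_spow opprB !opprK [k + n]addrC.
Qed.

Lemma thetaD a b : theta (a + b) = theta a + theta b.
Proof. by rewrite /theta mulrDr mulrDl. Qed.

Lemma theta0 : theta 0 = 0.
Proof. by rewrite -{1}(subrr 0) thetaB subrr. Qed.

Lemma laurent_theta m n a : laurent m n a -> laurent (1 - n) (1 - m) (theta a).
Proof.
elim=> [|c k b kmn _ Lb]; first by rewrite theta0; exact: laurent0.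
by rewrite thetaD theta_mon; apply: laurentD => //; lia.
Qed.

Lemma cf_theta m n a k : laurent m n a -> cf (theta a) k = tau (cf a (- k)).
Proof.
elim=> [|c l b _ _ IHb]; first by rewrite theta0 !cf0 rmorph0.
rewrite thetaD theta_mon !cfD !cf_mon rmorphD IHb; congr (_ + _).
by rewrite -(eqr_opp k) opprK; case: eqP => //; rewrite rmorph0.
Qed.

Lemma laurent_ring_theta a : laurent_ring a -> laurent_ring (theta a).
Proof. by move=> [m [n La]]; exists (1 - n), (1 - m); exact: laurent_theta. Qed.
End SkewLaurent.

(** * Pairs of quadratic subfields *)

(** A generator with square in the subfield gives the conjugation by the explicit formula
    [p + q w |-> p - q w]. *)
Structure quadratic (F : fieldType) := Quadratic {
  qbase :> divringClosed F;
  qgen : F;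
  qgen_notin : qgen \notin qbase;
  qgen_sqr : qgen ^+ 2 \in qbase;
  qspan : forall x, exists2 p : F * F,
    (p.1 \in qbase) && (p.2 \in qbase) & x = p.1 + p.2 * qgen }.

(** Cramer's rule: [D] is the determinant of [1, w] in the given basis, and [D = 0] would make [w] a
    quotient of elements of [K]. *)
Lemma has_index2_span (F : fieldType) (K : divringClosed F) (w x : F) :
  has_index K 2 -> w \notin K ->
  exists2 p : F * F, (p.1 \in K) && (p.2 \in K) & x = p.1 + p.2 * w.
Proof.
move=> [b _ bP] wK.
have coord y : exists p q, [/\ p \in K, q \in K & y = p * b 0 + q * b 1].
  have [c [[cK yE] _]] := bP y I.
  move/eqP: (yE : y - _ = 0); rewrite subr_eq0 => /eqP {}yE.
  exists (c 0), (c 1); split=> //; rewrite yE big_ord_recl big_ord1.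
  by congr (_ + c _ * b _); apply: val_inj.
have [[p0 [p1 [Kp0 Kp1 e1]]] [q0 [q1 [Kq0 Kq1 ew]]]] := (coord 1, coord w).
have [x0 [x1 [Kx0 Kx1 ->]]] := coord x.
pose D := p0 * q1 - p1 * q0.
have b0E : D * b 0 = q1 - p1 * w.
  transitivity (q1 * 1 - p1 * w); last by rewrite mulr1.
  by rewrite e1 ew /D; ring.
have b1E : D * b 1 = p0 * w - q0.
  transitivity (p0 * w - q0 * 1); last by rewrite mulr1.
  by rewrite e1 ew /D; ring.
have D0 : D != 0.
  apply/eqP => D0; move: b0E b1E; rewrite D0 !mul0r => b0E b1E.
  have [p00|p00] := eqVneq p0 0; last first.
    case/negP: wK; suff -> : w = q0 / p0 by rewrite rpred_div.
    apply: (mulfI p00); rewrite mulrCA divff // mulr1.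
    by apply/eqP; rewrite -subr_eq0 -b1E.
  have [p10|p10] := eqVneq p1 0.
    by move: e1; rewrite p00 p10 !mul0r addr0 => /eqP; rewrite oner_eq0.
  case/negP: wK; suff -> : w = q1 / p1 by rewrite rpred_div.
  apply: (mulfI p10); rewrite mulrCA divff // mulr1.
  by apply/eqP; rewrite eq_sym -subr_eq0 -b0E.
exists ((x0 * q1 - x1 * q0) / D, (x1 * p0 - x0 * p1) / D) => /=.
  by rewrite !rpred_div // rpredB // rpredM.
apply: (mulfI D0); rewrite mulrDr [D * (x0 * _)]mulrCA [D * (x1 * _)]mulrCA b0E b1E.
by field.
Qed.

Section QuadraticConj.
Variables (F : fieldType) (Q : quadratic F).
Hypothesis two_neq0 : (2%:R : F) != 0.
Local Notation K := (qbase Q).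
Local Notation w := (qgen Q).

Definition qcoord (x : F) : F * F :=
  xget (0, 0) [set p | [/\ p.1 \in K, p.2 \in K & x = p.1 + p.2 * w]]%classic.

Definition qconj : F -> F := locked (fun x => (qcoord x).1 - (qcoord x).2 * w).

Lemma qcoord_uniq p q p' q' : p \in K -> q \in K -> p' \in K -> q' \in K ->
  p + q * w = p' + q' * w -> p = p' /\ q = q'.
Proof.
move=> Kp Kq Kp' Kq' e.
have e' : (q - q') * w = p' - p.
  by apply/eqP; rewrite mulrBl subr_eq addrAC -e addrAC subrr add0r.
have [qq|qq] := eqVneq (q - q') 0.
  move/eqP: e'; rewrite qq mul0r eq_sym subr_eq0 => /eqP->; split=> //.
  by apply/eqP; rewrite -subr_eq0 qq.
case/negP: (qgen_notin Q); suff -> : w = (p' - p) / (q - q').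
  by rewrite rpred_div // rpredB.
by rewrite -e' mulrAC divff // mul1r.
Qed.

Lemma qcoordE p q : p \in K -> q \in K -> qcoord (p + q * w) = (p, q).
Proof.
move=> Kp Kq; rewrite /qcoord; case: xgetP => [[p' q'] _ /= [Kp' Kq' e]|/(_ (p, q))[]//].
by have [-> ->] := qcoord_uniq Kp Kq Kp' Kq' e.
Qed.

Lemma qconjE p q : p \in K -> q \in K -> qconj (p + q * w) = p - q * w.
Proof. by move=> Kp Kq; rewrite /qconj -lock qcoordE. Qed.

Lemma qconj_base x : x \in K -> qconj x = x.
Proof.
by move=> Kx; rewrite -{1}[x]addr0 -(mul0r w) qconjE ?rpred0 // mul0r subr0.
Qed.

Fact qconj_zmod_morphism : zmod_morphism qconj.
Proof.
move=> x y; have [[p q] /= /andP[Kp Kq] ->] := qspan Q x.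
have [[p' q'] /= /andP[Kp' Kq'] ->] := qspan Q y.
rewrite opprD addrACA -mulrBl !qconjE ?rpredB //; ring.
Qed.

Fact qconj_monoid_morphism : monoid_morphism qconj.
Proof.
split=> [|x y]; first by rewrite qconj_base ?rpred1.
have [[p q] /= /andP[Kp Kq] ->] := qspan Q x.
have [[p' q'] /= /andP[Kp' Kq'] ->] := qspan Q y.
have -> : (p + q * w) * (p' + q' * w) =
    (p * p' + q * q' * w ^+ 2) + (p * q' + q * p') * w by ring.
have KA : p * p' + q * q' * w ^+ 2 \in K.
  by apply: rpredD; do ?[exact: qgen_sqr|apply: rpredM => //].
have KB : p * q' + q * p' \in K by apply: rpredD; apply: rpredM.
by rewrite !qconjE //; ring.
Qed.
HB.instance Definition _ := GRing.isZmodMorphism.Build F F qconj qconj_zmod_morphism.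
HB.instance Definition _ :=
  GRing.isMonoidMorphism.Build F F qconj qconj_monoid_morphism.

Lemma qconjK : involutive qconj.
Proof.
move=> x; have [[p q] /= /andP[Kp Kq] ->] := qspan Q x.
by rewrite qconjE // -mulNr qconjE ?rpredN // mulNr opprK.
Qed.

Lemma qconj_fixed x : qconj x = x -> x \in K.
Proof.
have [[p q] /= /andP[Kp Kq] ->] := qspan Q x.
rewrite qconjE // => e; have : 2%:R * (q * w) = 0.
  by move/eqP: e; rewrite -subr_eq0 => /eqP e; rewrite -[RHS]oppr0 -e; ring.
by move/eqP; rewrite mulf_eq0 (negbTE two_neq0) => /eqP->; rewrite addr0.
Qed.

Lemma qconj_gen : qconj w = - w.
Proof. by rewrite -{1}[w]mul1r -[1 * w]add0r qconjE ?rpred0 ?rpred1 // mul1r sub0r. Qed.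

(** The conjugation is built from one generator, whereas the [w i] of a given parity may all differ;
    each of them is still negated. *)
Lemma qconj_sqrt v : v \notin K -> v ^+ 2 \in K -> qconj v = - v.
Proof.
move=> vK v2; have : (qconj v - v) * (qconj v + v) = 0.
  by rewrite -subr_sqr -rmorphXn /= qconj_base // subrr.
move/eqP; rewrite mulf_eq0 subr_eq0 => /orP[/eqP/qconj_fixed v'|]; first by rewrite v' in vK.
by rewrite addr_eq0 => /eqP.
Qed.
End QuadraticConj.

(** The element of [F (x) F] given by a sequence of pairs, evaluated at the
    endomorphism [alpha] of [F]. *)
Definition ev (F : fieldType) (z : seq (F * F)) (alpha : F -> F) : F :=
  \sum_(p <- z) p.1 * alpha p.2.

Section Separation.
Variable F : fieldType.
Implicit Types z : seq (F * F).

Definition ev_prod z z' : seq (F * F) :=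
  [seq (p.1 * q.1, p.2 * q.2) | p <- z, q <- z'].

Lemma ev_prodE z z' (alpha : {rmorphism F -> F}) :
  ev (ev_prod z z') alpha = ev z alpha * ev z' alpha.
Proof.
rewrite /ev big_allpairs_dep /= mulr_suml; apply: eq_bigr => p _.
rewrite mulr_sumr; apply: eq_bigr => q _.
by rewrite rmorphM mulrACA.
Qed.

Lemma ev_cat z z' alpha : ev (z ++ z') alpha = ev z alpha + ev z' alpha.
Proof. by rewrite /ev big_cat. Qed.

Lemma ev_scale c d z (alpha : {rmorphism F -> F}) :
  ev [seq (c * p.1, d * p.2) | p <- z] alpha = c * alpha d * ev z alpha.
Proof.
rewrite /ev big_map mulr_sumr; apply: eq_bigr => p _ /=.
by rewrite rmorphM mulrACA.
Qed.

(** For one pair, [1 (x) c - b_t(c) (x) 1] divided by [a_s(c) - b_t(c)] is [1] at [a_s] and [0] at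
    [b_t]. Products over [t] vanish on all of [B]; they are combined over [s] by [y + z - y z],
    which keeps the value [1] wherever [y] or [z] has it. *)
Lemma separate (T : eqType) (a b : T -> {rmorphism F -> F}) (A B : seq T) :
  (forall s t, exists c, a s c != b t c) ->
  exists z, (forall s, s \in A -> ev z (a s) = 1) /\
            (forall t, t \in B -> ev z (b t) = 0).
Proof.
move=> ab.
have ev1 (alpha : {rmorphism F -> F}) : ev [:: (1, 1)] alpha = 1.
  by rewrite /ev big_seq1 /= rmorph1 mulr1.
have one s : exists z, ev z (a s) = 1 /\ (forall t, t \in B -> ev z (b t) = 0).
  elim: B => [|t B [z [z1 z0]]]; first by exists [:: (1, 1)].
  have [c cst] := ab s t.
  have d0 : a s c - b t c != 0 by rewrite subr_eq0.
  pose y := [:: ((a s c - b t c)^-1, c); (- (a s c - b t c)^-1 * b t c, 1)].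
  exists (ev_prod y z); split.
    rewrite ev_prodE z1 mulr1 /ev big_cons big_seq1 /= rmorph1.
    by rewrite mulr1 mulNr -mulrBr mulVf.
  move=> u; rewrite inE ev_prodE => /predU1P[->|/z0->]; last by rewrite mulr0.
  by rewrite /ev big_cons big_seq1 /= rmorph1 mulr1 mulNr subrr mul0r.
elim: A => [|s A [z [z1 z0]]]; first by exists [::]; split=> // t _; rewrite /ev big_nil.
have [y [y1 y0]] := one s.
exists (y ++ z ++ [seq (- 1 * p.1, 1 * p.2) | p <- ev_prod y z]); split=> u.
  rewrite inE !ev_cat ev_scale rmorph1 mulr1 ev_prodE mulN1r.
  by move=> /predU1P[->|/z1->]; rewrite ?y1 ?mul1r ?mulr1; ring.
by move=> uB; rewrite !ev_cat ev_scale ev_prodE y0 // z0 // !(mul0r, mulr0, addr0).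
Qed.
End Separation.

Section QuadraticPair.
Variables (F : fieldType) (Q0 Q1 : quadratic F).
Hypothesis two_neq0 : (2%:R : F) != 0.
Local Notation tau0 := (qconj Q0).
Local Notation tau1 := (qconj Q1).
Local Notation w := (qgen Q0).

Definition sigma : {rmorphism F -> F} := (tau1 \o tau0 : F -> F).
Definition sigmaV : {rmorphism F -> F} := (tau0 \o tau1 : F -> F).

Lemma sigmaK : cancel sigma sigmaV.
Proof. by move=> x; rewrite /= !qconjK. Qed.

Lemma sigmaVK : cancel sigmaV sigma.
Proof. by move=> x; rewrite /= !qconjK. Qed.

Lemma tau_sigma x : tau0 (sigma (tau0 x)) = sigmaV x.
Proof. by rewrite /= !qconjK. Qed.

Local Notation spow := (spow sigma sigmaV).
Local Notation mon := (mon sigmaK sigmaVK).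
Local Notation theta := (theta tau0).
Local Notation laurent := (laurent sigmaK sigmaVK).
Local Notation E := (zend (int -> F)).

Let spowS := spowS sigmaVK.
Let spowP := spowP sigmaK sigmaVK.
Let spowD := spowD sigmaK sigmaVK.
Let tau_spow := tau_spow sigmaK sigmaVK (qconjK Q0) tau_sigma.

Lemma gen_neq0 (Q : quadratic F) : qgen Q != 0.
Proof. by apply/eqP => w0; have := qgen_notin Q; rewrite w0 rpred0. Qed.

Lemma gen_neqN (Q : quadratic F) : - qgen Q <> qgen Q.
Proof.
move=> e; have /eqP : 2%:R * qgen Q = 0 by rewrite mulr_natl mulr2n -{1}e addNr.
by rewrite mulf_eq0 (negbTE two_neq0) (negbTE (gen_neq0 Q)).
Qed.

(** In the group generated by [tau0] and [tau1], a rotation is never a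
    reflection: if [tau0] were a power of [sigma], it would commute with
    [sigma], hence [sigma] would have order at most 2 and [tau0] would be [1] or
    [sigma = tau1 tau0]. *)
Lemma rotation_neq_reflection n m : exists c, spow n c != spow m (tau0 c).
Proof.
apply/not_existsP => h.
have tauE x : tau0 x = spow (n - m) x.
  have /negP/negPn/eqP e := h x.
  by rewrite addrC spowD e -spowD addNr.
have sC k x : sigma (spow k x) = spow k (sigma x).
  by rewrite -spowS spowD.
have ssV x : sigma x = sigmaV x.
  by rewrite -tau_sigma !tauE sC -!tauE qconjK.
have [e|e] : (forall x, spow (n - m) x = x) \/ (forall x, spow (n - m) x = sigma x).
  elim/spow_ind: (n - m) => [|k IHk|k IHk]; first by left.
    case: IHk => IHk; [right|left] => x; rewrite spowS IHk //.
    by rewrite [LHS]ssV sigmaK.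
  case: IHk => IHk; [right|left] => x; rewrite spowP IHk ?sigmaK // ssV.
- by apply: (@gen_neqN Q0); rewrite -(qconj_gen Q0) tauE e.
apply: (@gen_neqN Q1); rewrite -(qconj_gen Q1) -[X in qconj Q1 X](qconjK Q0).
by rewrite -[LHS]/(sigma (tau0 (qgen Q1))) -e -tauE qconjK.
Qed.

(** Take [v (x) v^-1] times an element that is [1] on rotations and [0] on
    reflections, and apply the trace of [F] over [K_0] in both factors. *)
Lemma base_pairs (v : F) (A : seq int) : v != 0 -> tau0 v = - v ->
  exists z : seq (F * F),
    (forall p, p \in z -> (p.1 \in qbase Q0) && (p.2 \in qbase Q0)) /\
    (forall n, n \in A -> ev z (spow n) = v * spow n v^-1).
Proof.
move=> v0 tauv.
pose a n := spow_rmorphism sigmaK sigmaVK n.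
pose b n : {rmorphism F -> F} := (a n \o tau0 : F -> F).
(* The opposite exponents are included because [tau0] conjugates [sigma^n] to [sigma^-n]. *)
have [y [y1 y0]] := @separate F int a b (A ++ map -%R A) (A ++ map -%R A)
  rotation_neq_reflection.
pose u := [seq (v * p.1, v^-1 * p.2) | p <- y].
have uE (alpha : {rmorphism F -> F}) : ev u alpha = v * alpha v^-1 * ev y alpha.
  exact: ev_scale.
exists [seq ((p.1 + tau0 p.1) / 2%:R, p.2 + tau0 p.2) | p <- u]; split.
  have base x : x + tau0 x \in qbase Q0.
    by apply: (qconj_fixed two_neq0); rewrite rmorphD /= qconjK addrC.
  move=> _ /mapP[p _ ->]; apply/andP; split; last exact: base.
  by apply: rpred_div; [exact: base|exact: rpred_nat].
move=> n nA.
have nA1 : n \in A ++ map -%R A by rewrite mem_cat nA.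
have nA2 : - n \in A ++ map -%R A by rewrite mem_cat map_f ?orbT.
have tauN d : tau0 (spow (- n) (tau0 d)) = spow n d by rewrite tau_spow opprK.
have term c d : (c + tau0 c) / 2%:R * spow n (d + tau0 d) =
    (c * spow n d + c * spow n (tau0 d) + tau0 (c * spow (- n) (tau0 d)) +
     tau0 (c * spow (- n) d)) / 2%:R.
  have -> : spow n (d + tau0 d) = spow n d + spow n (tau0 d) := rmorphD (a n) _ _.
  rewrite !(rmorphM tau0) /= tauN -[d in spow (- n) d](qconjK Q0) tauN.
  by move: (spow n d) (spow n (tau0 d)) (tau0 c) => x x' c'; field; exact: two_neq0.
(* The product of the two traces expands into four terms. Those at the reflections [b n] and
   [b (- n)] vanish, the other two coincide since [tau0 v = - v], and the division by 2 leaves one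
   copy. *)
transitivity ((ev u (a n) + ev u (b n) + tau0 (ev u (b (- n))) +
               tau0 (ev u (a (- n)))) / 2%:R).
  rewrite /ev big_map !rmorph_sum -!big_split /= mulr_suml; apply: eq_bigr => p _.
  exact: term.
rewrite !uE !(y1 _ nA1) !(y1 _ nA2) !(y0 _ nA1) !(y0 _ nA2) !mulr0 rmorph0 !addr0 !mulr1.
have -> : tau0 (v * a (- n) v^-1) = v * spow n v^-1.
  transitivity (tau0 v * tau0 (spow (- n) v^-1)); first exact: (rmorphM tau0).
  have tauv1 : tau0 v^-1 = - v^-1 by rewrite fmorphV /= tauv invrN.
  rewrite -[v^-1 in LHS](qconjK Q0) tauN tauv tauv1.
  have -> : spow n (- v^-1) = - spow n v^-1 := rmorphN (a n) _.
  by rewrite mulrNN.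
rewrite -[a n _]/(spow n v^-1); move: (spow n v^-1) => x.
by field; exact: two_neq0.
Qed.

Local Notation S := (laurent_ring sigmaK sigmaVK).

Section FixedOperators.
Variables (R : pzRingType) (psi : R -> E).
Hypothesis psiB : forall a b, psi (a - b) = psi a - psi b.
Hypothesis psiM : forall a b, psi (a * b) = psi a * psi b.
Hypothesis psi1 : psi 1 = 1.
Hypothesis psi_inj : injective psi.
Hypothesis psiP : forall x, (S x /\ theta x = x) <-> exists a, x = psi a.

Let theta_mon := theta_mon sigmaK sigmaVK (qconjK Q0) tau_sigma.
Let mon_mul := mon_mul sigmaK sigmaVK.
Let spow0 x : spow 0 x = x. Proof. by []. Qed.

(** On each of the finitely many monomials of [psi a], conjugation by [v] agrees with a sum of
    two-sided multiplications by elements of [K_0]. These belong to [R], so the result stays in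
    [I]. *)
Lemma conj_ideal (v : F) (I : set R) : v != 0 -> tau0 v = - v ->
  two_sided_ideal I -> forall a, I a ->
  exists2 b, I b & mon v 0 * psi a * mon v^-1 0 = psi b.
Proof.
move=> v0 tauv [[I0 ID Il] Ir] a Ia.
have [[m [n La]] _] : S (psi a) /\ theta (psi a) = psi a by apply/psiP; exists a.
have [k kE] : exists k : nat, n <= m + k%:Z by exists `|(n - m)%R|%N; lia.
have [z [zK zE]] := base_pairs [seq m + i%:Z | i <- iota 0 k] v0 tauv.
have -> : mon v 0 * psi a * mon v^-1 0 = \sum_(p <- z) mon p.1 0 * psi a * mon p.2 0.
  elim: La => [|c l b lmn _ IHb].
    by rewrite mulr0 mul0r big1 // => p _; rewrite mulr0 mul0r.
  rewrite mulrDr mulrDl IHb.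
  have -> : \sum_(p <- z) mon p.1 0 * (b + mon c l) * mon p.2 0 =
      \sum_(p <- z) mon p.1 0 * b * mon p.2 0 + mon (c * ev z (spow l)) l.
    rewrite /ev mulr_sumr.
    elim: (z) => [|p y IHy]; first by rewrite !big_nil mon0 addr0.
    rewrite !big_cons monD IHy mulrDr mulrDl !mon_mul spow0 add0r addr0 [c * _]mulrCA.
    by rewrite addrACA mulrA.
  rewrite zE; last first.
    by apply/mapP; exists `|(l - m)%R|%N; [rewrite mem_iota|]; lia.
  by rewrite !mon_mul spow0 add0r addr0 mulrCA mulrA.
have base c : c \in qbase Q0 -> exists r, mon c 0 = psi r.
  move=> Kc; apply/psiP; split; first exact: laurent_ring_mon.
  by rewrite theta_mon oppr0 /= qconj_base.
have psi0 : psi 0 = 0 by rewrite -(subrr 0) psiB subrr.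
elim: z zK {zE} => [|p z IHz] zK; first by exists 0; rewrite // big_nil psi0.
have [|b Ib bE] := IHz; first by move=> q qz; apply: zK; rewrite inE qz orbT.
have /andP[/base[c cE] /base[d dE]] := zK p (mem_head _ _).
exists (c * a * d + b); first by apply: ID => //; apply: Ir; exact: Il.
rewrite big_cons bE cE dE -!psiM -{2}[b]opprK psiB -[- b]sub0r psiB psi0 sub0r opprK.
by [].
Qed.

Lemma laurent_fixed_ring : fixed_ring S theta (mon w 0) (mon w^-1 0) psi.
Proof.
have w0 : w != 0 := gen_neq0 Q0.
have ww : mon w 0 * mon w^-1 0 = 1 by rewrite mon_mul spow0 divff // mon1.
have w'w : mon w^-1 0 * mon w 0 = 1 by rewrite mon_mul spow0 mulVf // mon1.
split=> //.
- move=> /(congr1 (fun a : E => cf a 0)); rewrite -(mon1 sigmaK sigmaVK) cf_mon cf0 /=.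
  by move/eqP; rewrite oner_eq0.
- exact: laurent_ring1.
- exact: laurent_ringB.
- exact: laurent_ringM.
- exact: laurent_ring_domain.
- exists (mon 2%:R^-1 0); first exact: laurent_ring_mon.
  by rewrite -monD -(mon1 sigmaK sigmaVK); congr (mon _ _); field; exact: two_neq0.
- exact: thetaB.
- exact: thetaM (qconjK Q0).
- exact: thetaK (qconjK Q0).
- exact: (laurent_ring_theta (qconjK Q0) tau_sigma).
- exact: laurent_ring_mon.
- exact: laurent_ring_mon.
- by rewrite theta_mon /= qconj_gen oppr0 monN.
- exact: laurent_lprincipal.
- exact: laurent_rprincipal.
move=> I I2 a Ia; split.
  have [b Ib bE] := conj_ideal w0 (qconj_gen Q0) I2 Ia.
  by exists b => //; rewrite -bE -[RHS]mulrA w'w mulr1.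
have [||b Ib] := conj_ideal (v := w^-1) _ _ I2 Ia.
- by rewrite invr_eq0.
- by rewrite fmorphV /= qconj_gen invrN.
rewrite invrK => bE.
by exists b => //; rewrite -bE !mulrA ww mul1r.
Qed.
End FixedOperators.
End QuadraticPair.

(** * The representation of the noncommutative symmetric algebra *)

Section QuotientLift.
Variables (C : zalg) (r : forall i j, set (C i j)) (E : pzRingType).
Variable phi : forall i j, C i j -> E.
Hypothesis phiB : forall i j (a b : C i j), phi (a - b) = phi a - phi b.
Hypothesis phiM : forall i j l (a : C i j) (b : C j l),
  phi (zmul a b) = phi a * phi b.
Hypothesis phir : forall i j (a : C i j), r a -> phi a = 0.

Definition zlift i j (a : zquot r i j) : E := phi (repr a).

Lemma zlift_pi i j (a : C i j) : zlift (zpi r a) = phi a.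
Proof.
have Ia : zideal_gen r (a - repr (zpi r a)) by apply/zpi_eq; rewrite zpiK.
suff /eqP : phi (a - repr (zpi r a)) = 0 by rewrite phiB subr_eq0 eq_sym => /eqP.
apply: (Ia (fun i j => [set a | phi a = 0]%classic)) => //.
split=> /=.
- by move=> i' j'; rewrite -(subrr (0 : C i' j')) phiB subrr.
- by move=> i' j' x y x0 y0; rewrite phiB x0 y0 subrr.
- by move=> i' j' l x y y0; rewrite phiM y0 mulr0.
- by move=> i' j' l x y x0; rewrite phiM x0 mul0r.
Qed.

Lemma zliftB i j (a b : zquot r i j) : zlift (a - b) = zlift a - zlift b.
Proof.
rewrite -[a]zpiK -[b]zpiK !zlift_pi -phiB -zlift_pi; congr zlift.
by rewrite /zpi raddfB.
Qed.

Lemma zlift0 i j : zlift (0 : zquot r i j) = 0.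
Proof. by rewrite -(subrr 0) zliftB subrr. Qed.

Lemma zliftD i j (a b : zquot r i j) : zlift (a + b) = zlift a + zlift b.
Proof. by rewrite -{1}[b]opprK zliftB -[- b]sub0r zliftB zlift0 sub0r opprK. Qed.

Lemma zliftM i j l (a : zquot r i j) (b : zquot r j l) :
  zlift (zmul a b) = zlift a * zlift b.
Proof. by rewrite -[a]zpiK -[b]zpiK -[zmul _ _]/(zquot_mul _ _) -zpiM !zlift_pi phiM. Qed.
End QuotientLift.

Lemma oddz_addr1 (i : int) : odd `|(i + 1)%R|%N = ~~ odd `|i|%N.
Proof. by lia. Qed.

Section Representation.
Variables (F : fieldType) (Q0 Q1 : quadratic F).
Hypothesis two_neq0 : (2%:R : F) != 0.
Local Notation tau0 := (qconj Q0).
Local Notation tau1 := (qconj Q1).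
Local Notation K := (alternate (qbase Q0) (qbase Q1)).
Local Notation sigma := (sigma Q0 Q1).
Local Notation sigmaV := (sigmaV Q0 Q1).
Local Notation sigmaK := (sigmaK Q0 Q1).
Local Notation sigmaVK := (sigmaVK Q0 Q1).
Local Notation spow := (spow sigma sigmaV).
Local Notation mon := (mon sigmaK sigmaVK).
Local Notation theta := (theta tau0).
Local Notation laurent := (laurent sigmaK sigmaVK).
Local Notation E := (zend (int -> F)).

Let monM := mon_mul sigmaK sigmaVK.

Definition tau (i : int) : {rmorphism F -> F} := qconj (if odd `|i|%N then Q1 else Q0).

Lemma tau_base i k : k \in K i -> tau i k = k.
Proof. by rewrite /alternate /tau; case: ifP => _; exact: qconj_base. Qed.

Lemma tau_sqrt i v : v \notin K i -> v ^+ 2 \in K i -> tau i v = - v.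
Proof. by rewrite /alternate /tau; case: ifP => _; exact: qconj_sqrt. Qed.

Lemma tau_fixed i x : tau i x = x -> x \in K i.
Proof. by rewrite /alternate /tau; case: ifP => _; exact: qconj_fixed. Qed.

Lemma tauK i : involutive (tau i).
Proof. by rewrite /tau; case: ifP => _; exact: qconjK. Qed.

Lemma base2 i : K (i + 2) = K i.
Proof. by rewrite /alternate -[2]/(1 + 1) addrA !oddz_addr1 negbK. Qed.

Lemma tau2 i : tau (i + 2) = tau i.
Proof. by rewrite /tau -[2]/(1 + 1) addrA !oddz_addr1 negbK. Qed.

(** In the skew group ring of the infinite dihedral group, with generators
    [s_0, s_1] acting as [tau0, tau1], the letter [x] in degree [(i, i+1)] is
    [x s_(i+1) + (-1)^i s_i x]. Multiplying elements of degree [(i, j)] by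
    [s_0 ^ i] on the left and [s_0 ^ j] on the right moves everything to the
    rotations, with [t = s_1 s_0]; a scalar [k] becomes [tau0 k]. *)
Definition letter (i : int) (x : F) : E :=
  if odd `|i|%N then mon (tau0 x) 0 - mon (sigmaV x) (-1)
  else mon (tau0 x) 0 + mon x 1.

Lemma letterD i x y : letter i (x + y) = letter i x + letter i y.
Proof.
rewrite /letter; case: ifP => _; rewrite !rmorphD !monD ?opprD; exact: addrACA.
Qed.

Lemma letter_basel i k x : k \in K i -> letter i (k * x) = mon (tau0 k) 0 * letter i x.
Proof.
rewrite /alternate /letter; case: ifP => _ Kk.
  rewrite mulrBr !monM !add0r !rmorphM /=.
  by rewrite (qconj_base Kk).
by rewrite mulrDr !monM !add0r !rmorphM /= (qconj_base Kk).
Qed.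

Lemma letter_baser i k x : k \in K (i + 1) ->
  letter i (x * k) = letter i x * mon (tau0 k) 0.
Proof.
rewrite /alternate /letter oddz_addr1; case: (odd _) => /= Kk.
  by rewrite mulrBl !monM !addr0 !rmorphM /= (qconj_base Kk).
by rewrite mulrDl !monM !addr0 !rmorphM /= !qconjK (qconj_base Kk).
Qed.

(** The constant term depends only on [x * y], the two others only on [x * tau (i + 1) y]. This is
    why they can be made to cancel separately. *)
Lemma letter_mul i x y :
  letter i x * letter (i + 1) y =
  if odd `|i|%N then mon (tau0 (x * y) - sigmaV (x * y)) 0 +
    (mon (tau0 x * y) 1 - mon (sigmaV (x * tau0 y)) (-1))
  else mon (tau0 (x * y) - x * y) 0 +
    (mon (x * tau1 y) 1 - mon (tau0 (x * tau1 y)) (-1)).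
Proof.
have s1 z : spow 1 z = sigma z by [].
have sN1 z : spow (-1) z = sigmaV z by [].
have s0 z : spow 0 z = z by [].
rewrite /letter oddz_addr1; case: (odd _).
  rewrite mulrBl !mulrDr !monM !s0 !sN1 !rmorphM !add0r monB !addr0 addNr.
  by rewrite opprD [X in _ + X = _]addrC addrACA.
rewrite mulrDl !mulrBr !monM !s0 !s1 !rmorphM !add0r monB !addr0 addrN /= !qconjK.
by rewrite [X in _ + X = _]addrC addrACA [X in _ + X = _]addrC.
Qed.

(** The Casimir element [x (x) 1 + x v^-1 (x) v] kills the terms in [t] and
    [t ^ -1]. *)
Lemma letter_casimir i x v : v != 0 -> tau (i + 1) v = - v ->
  letter i x * letter (i + 1) 1 + letter i (x * v^-1) * letter (i + 1) v =
  mon (2%:R * (if odd `|i|%N then tau0 (x - tau1 x) else tau0 x - x)) 0.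
Proof.
have cancel (a b c : E) : a + (b - c) + (a + (- b - - c)) = a + a.
  by rewrite -opprD addrACA addrN addr0.
move=> v0 tauv.
have e1 : x * v^-1 * v = x by rewrite divfK.
have e2 : x * v^-1 * tau (i + 1) v = - x by rewrite tauv mulrN e1.
rewrite !letter_mul; move: tauv e2; rewrite /tau oddz_addr1; case: (odd _) => /= tauv e2.
  have e3 : tau0 (x * v^-1) * v = - tau0 x.
    by rewrite rmorphM fmorphV /= tauv invrN mulrN mulNr divfK.
  rewrite e1 e2 e3 rmorph1 !mulr1 !rmorphN !monN cancel -monD; congr (mon _ _).
  by rewrite rmorphB mulr_natl mulr2n.
rewrite e1 e2 rmorph1 !mulr1 rmorphN !monN cancel -monD; congr (mon _ _).
by rewrite mulr_natl mulr2n.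
Qed.

Fixpoint word_tail (i : int) (s : seq F) : E :=
  if s is x :: s' then letter i x * word_tail (i + 1) s' else 1.

Definition word_val (i : int) (s : seq F) : E :=
  if s is k :: s' then mon (tau0 k) 0 * word_tail i s' else 0.

Lemma word_tail_cat i s t :
  word_tail i (s ++ t) = word_tail i s * word_tail (i + (size s)%:Z) t.
Proof.
elim: s i => [|x s IHs] i /=; first by rewrite addr0 mul1r.
by rewrite IHs -addrA -PoszD add1n mulrA.
Qed.

Lemma word_val_cat i j l s t : is_word K i j s -> is_word K j l t ->
  word_val i (cat_word s t) = word_val i s * word_val j t.
Proof.
case: s t => [|k s] // [|y t] //= /andP[Kk /eqP->] /andP[Ky _].
case/lastP: s Ky => [|s x] Ky.
  by rewrite /= mulr1 mulrA monM !addr0 /= rmorphM.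
have e : i + (size (rcons s x))%:Z = i + (size s)%:Z + 1.
  by rewrite size_rcons -addrA -PoszD addn1.
rewrite e in Ky *; rewrite belast_rcons last_rcons -cats1 /= !word_tail_cat /= mulr1.
by rewrite letter_baser // !mulrA.
Qed.

Definition rep_free i j (a : free_zalg K i j) : E :=
  fglift (fun u : word K i j => word_val i (val u) : zmodule E) a.

Lemma rep_freeB i j (a b : free_zalg K i j) :
  rep_free (a - b) = rep_free a - rep_free b.
Proof.
exact: (raddfB (fglift (fun u : word K i j => word_val i (val u) : zmodule E))).
Qed.

Lemma rep_freeD i j (a b : free_zalg K i j) :
  rep_free (a + b) = rep_free a + rep_free b.
Proof.
exact: (raddfD (fglift (fun u : word K i j => word_val i (val u) : zmodule E))).
Qed.

Lemma rep_freeU i j (u : word K i j) : rep_free << u >> = word_val i (val u).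
Proof. by rewrite /rep_free liftU scale1r. Qed.

Lemma rep_free0 i j : rep_free (0 : free_zalg K i j) = 0.
Proof.
exact: (raddf0 (fglift (fun u : word K i j => word_val i (val u) : zmodule E))).
Qed.

Lemma rep_freeM i j l (a : free_zalg K i j) (b : free_zalg K j l) :
  rep_free (zmul a b) = rep_free a * rep_free b.
Proof.
elim/free_ind: a => [|a a' IHa IHa'|s].
- by rewrite zmul0l !rep_free0 mul0r.
- by rewrite zmulBl !rep_freeB IHa IHa' mulrBl.
elim/free_ind: b => [|b b' IHb IHb'|t].
- by rewrite zmul0r !rep_free0 mulr0.
- by rewrite zmulBr !rep_freeB IHb IHb' mulrBr.
rewrite [zmul _ _]free_mulU !rep_freeU; exact: word_val_cat (valP s) (valP t).
Qed.

Lemma rep_free_gen i j s : is_word K i j s -> rep_free (free_gen K i j s) = word_val i s.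
Proof. by move=> ws; rewrite /free_gen insubT rep_freeU. Qed.

Lemma is_wordD i j u x y v : is_word K i j (u ++ x :: v) -> is_word K i j (u ++ y :: v) ->
  is_word K i j (u ++ (x + y) :: v).
Proof.
case: u => [|k u] /=; first by move=> /andP[Kx ->] /andP[Ky _]; rewrite rpredD.
by rewrite !size_cat.
Qed.

Lemma rep_tensor_rel i j (a : free_zalg K i j) : tensor_rel a -> rep_free a = 0.
Proof.
case=> {i j a} [i j u x y v wx wy|i j u x k y v Kk w1 w2].
  rewrite rep_freeB rep_freeD !rep_free_gen //; last exact: is_wordD.
  apply/eqP; rewrite subr_eq0; apply/eqP.
  case: u {wx wy} => [|l u] /=; first by rewrite rmorphD monD mulrDl.
  by rewrite !word_tail_cat /= letterD !(mulrDl, mulrDr).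
rewrite rep_freeB !rep_free_gen //; apply/eqP; rewrite subr_eq0; apply/eqP.
case: u Kk {w1 w2} => [|l u] /= Kk.
  by rewrite addr0 in Kk; rewrite letter_basel // !mulrA monM addr0 rmorphM.
rewrite !word_tail_cat /= letter_baser; last by rewrite -addrA -PoszD addn1.
by rewrite letter_basel ?mulrA // -addrA -PoszD addn1.
Qed.

Definition rep_tensor i j : tensor_zalg K i j -> E := @zlift _ _ _ rep_free i j.

Lemma rep_tensorE i j s : is_word K i j s -> rep_tensor (tensor K i j s) = word_val i s.
Proof.
move=> ws; rewrite /rep_tensor /tensor zlift_pi ?rep_free_gen //.
- exact: rep_freeB.
- exact: rep_freeM.
- exact: rep_tensor_rel.
Qed.


Lemma rep_tensorB i j (a b : tensor_zalg K i j) :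
  rep_tensor (a - b) = rep_tensor a - rep_tensor b.
Proof.
apply: zliftB => [*|*|]; [exact: rep_freeB|exact: rep_freeM|exact: rep_tensor_rel].
Qed.

Lemma rep_tensorD i j (a b : tensor_zalg K i j) :
  rep_tensor (a + b) = rep_tensor a + rep_tensor b.
Proof.
apply: zliftD => [*|*|]; [exact: rep_freeB|exact: rep_freeM|exact: rep_tensor_rel].
Qed.

Lemma rep_tensorM i j l (a : tensor_zalg K i j) (b : tensor_zalg K j l) :
  rep_tensor (zmul a b) = rep_tensor a * rep_tensor b.
Proof.
apply: zliftM => [*|*|]; [exact: rep_freeB|exact: rep_freeM|exact: rep_tensor_rel].
Qed.

Variable w : int -> F.
Hypothesis w_notin : forall i, w i \notin K i.
Hypothesis w_sqr : forall i, w i ^+ 2 \in K i.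
Hypothesis w_notin_prev : forall i, w (i + 1) \notin K i.
Local Notation A := (nc_sym K w).

Lemma w_neq0 i : w i != 0.
Proof. by apply/eqP => w0; have := w_notin i; rewrite w0 rpred0. Qed.

Lemma tau_w i : tau i (w i) = - w i.
Proof. by apply: tau_sqrt => //; exact: w_sqr. Qed.

Definition g_val (i : int) : F :=
  2%:R * (if odd `|i|%N then tau0 (w (i + 1) - tau1 (w (i + 1)))
          else tau0 (w (i + 1)) - w (i + 1)).

(** Up to sign and [tau0], this is twice [tau i (w (i + 1)) - w (i + 1)], so the condition
    [w (i + 1) \notin K i] is what makes [g_i] act as a unit. *)
Lemma g_val_neq0 i : g_val i != 0.
Proof.
rewrite mulf_neq0 //; have := @tau_fixed i (w (i + 1)).
rewrite /tau; case: (odd _) => h.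
  by rewrite fmorph_eq0 subr_eq0 eq_sym; apply: contraNneq (w_notin_prev i) => /h.
by rewrite subr_eq0; apply: contraNneq (w_notin_prev i) => /h.
Qed.

Lemma is_word_pair i x y : is_word K i (i + 2) [:: 1; x; y].
Proof. by rewrite /= rpred1 eqxx. Qed.

Lemma rep_sym_mul x i :
  rep_tensor (sym_mul K w x i) =
  mon (2%:R * (if odd `|i|%N then tau0 (x - tau1 x) else tau0 x - x)) 0.
Proof.
rewrite /sym_mul rep_tensorD !rep_tensorE ?is_word_pair //= !rmorph1.
rewrite -[mon 1 0]/(mon 1 0) mon1 !mul1r !mulr1.
by apply: letter_casimir; [exact: w_neq0|exact: tau_w].
Qed.

Lemma rep_sym_rel i j (a : tensor_zalg K i j) : sym_rel w a -> rep_tensor a = 0.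
Proof.
case=> {i j a} i; rewrite rep_sym_mul !rmorph1 !subrr rmorph0 if_same mulr0.
exact: mon0.
Qed.

Definition rep i j : A i j -> E := @zlift _ _ _ rep_tensor i j.

Lemma rep_pi i j (a : tensor_zalg K i j) : rep (zpi _ a : A i j) = rep_tensor a.
Proof.
apply: zlift_pi => [*|*|]; [exact: rep_tensorB|exact: rep_tensorM|exact: rep_sym_rel].
Qed.

Lemma repB i j (a b : A i j) : rep (a - b) = rep a - rep b.
Proof.
apply: zliftB => [*|*|]; [exact: rep_tensorB|exact: rep_tensorM|exact: rep_sym_rel].
Qed.

Lemma repM i j l (a : A i j) (b : A j l) : rep (zmul a b) = rep a * rep b.
Proof.
apply: zliftM => [*|*|]; [exact: rep_tensorB|exact: rep_tensorM|exact: rep_sym_rel].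
Qed.

Lemma rep0 i j : rep (0 : A i j) = 0.
Proof. by rewrite -(subrr 0) repB subrr. Qed.

Lemma repD i j (a b : A i j) : rep (a + b) = rep a + rep b.
Proof.
apply: zliftD => [*|*|]; [exact: rep_tensorB|exact: rep_tensorM|exact: rep_sym_rel].
Qed.

Lemma rep_g i : rep (sym_g K w i) = mon (g_val i) 0.
Proof. by rewrite rep_pi rep_sym_mul. Qed.

(** * Words, Casimir elements and normality of the [g_i] *)

Definition wd i j (s : seq F) : A i j := zpi _ (tensor K i j s).

Lemma rep_wd i j s : is_word K i j s -> rep (wd i j s) = word_val i s.
Proof. by move=> ws; rewrite rep_pi rep_tensorE. Qed.

Lemma wd_mul i j l s t : is_word K i j s -> is_word K j l t ->
  zmul (wd i j s) (wd j l t) = wd i l (cat_word s t).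
Proof.
move=> ws wt; rewrite /wd -[zmul _ _]/(zquot_mul _ _) -zpiM; congr zpi.
rewrite /tensor -[zmul _ _]/(zquot_mul _ _) -zpiM; congr zpi.
rewrite /free_gen !insubT ?(cat_wordP ws wt) // => wst; rewrite [zmul _ _]free_mulU.
by congr << _ >>; exact: val_inj.
Qed.

Lemma wd1 i : wd i i [:: 1] = zone i.
Proof.
rewrite /wd /tensor /free_gen insubT ?is_word1 // => w1.
by rewrite (_ : Sub _ w1 = Sub [:: 1] (is_word1 K i)) //; exact: val_inj.
Qed.

Lemma rep1 i : rep (zone i : A i i) = 1.
Proof. by rewrite -wd1 rep_wd ?is_word1 //= rmorph1 mulr1 (mon1 sigmaK sigmaVK). Qed.

Lemma wdD i j u x y v : is_word K i j (u ++ x :: v) -> is_word K i j (u ++ y :: v) ->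
  wd i j (u ++ (x + y) :: v) = wd i j (u ++ x :: v) + wd i j (u ++ y :: v).
Proof.
move=> wx wy; rewrite /wd -zpiD; congr zpi; rewrite /tensor -zpiD; apply/zpi_eq.
by move=> J _; apply; exact: TensorAdd.
Qed.

Lemma wd_bal i j u x k y v : k \in K (i + (size u)%:Z) ->
  is_word K i j (u ++ x * k :: y :: v) -> is_word K i j (u ++ x :: k * y :: v) ->
  wd i j (u ++ x * k :: y :: v) = wd i j (u ++ x :: k * y :: v).
Proof.
move=> Kk w1 w2; rewrite /wd; congr zpi; apply/zpi_eq.
by move=> J _; apply; exact: TensorBal.
Qed.

(** [sym_g j] with a free target degree, to be used when [l = j + 2]. *)
Definition gword j l : A j l :=
  wd j l [:: 1; w (j + 1); 1] + wd j l [:: 1; 1; w (j + 1)].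

Lemma sym_gE j : sym_g K w j = gword j (j + 2).
Proof. by rewrite /sym_g /sym_mul zpiD divff ?w_neq0. Qed.

(** The class of [x h_j], with a free target degree. *)
Definition casimir j l x : A j l :=
  wd j l [:: 1; x; 1] + wd j l [:: 1; x * (w (j + 1))^-1; w (j + 1)].

Lemma wd3 j l x y : l = j + 2 -> is_word K j l [:: 1; x; y].
Proof. by move=> ->; exact: is_word_pair. Qed.

Lemma wd_scalar i l k x v : k \in K i -> is_word K i l (1 :: x :: v) ->
  wd i l [:: k, x & v] = wd i l [:: 1, k * x & v].
Proof.
move=> Kk /= /andP[_ li]; have := @wd_bal i l [::] 1 k x v.
by rewrite /= mul1r addr0 rpred1 Kk li; apply.
Qed.

Lemma casimir_base j l k : l = j + 2 -> k \in K j -> casimir j l k = 0.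
Proof.
move=> lj Kk; have wk : is_word K j j [:: k] by rewrite /= Kk addr0 eqxx.
have -> : casimir j l k = zmul (wd j j [:: k]) (casimir j l 1).
  rewrite /casimir zmulDr !wd_mul ?wd3 //= !mulr1 mul1r.
  by rewrite !(wd_scalar Kk) ?wd3 // mulr1.
suff -> : casimir j l 1 = 0 by rewrite zmul0r.
rewrite {}lj /casimir /wd -zpiD -[LHS]/(zpi _ (sym_mul K w 1 j)).
have -> : (0 : A j (j + 2)) = zpi _ 0 by rewrite /zpi raddf0.
by apply/zpi_eq => J _; rewrite subr0; apply; exact: SymRel.
Qed.

Lemma w_coord i z : exists k m, [/\ k \in K i, m \in K i & z = k + m * w i].
Proof.
have v0 := w_neq0 i; pose m := (z - tau i z) / (2%:R * w i).
have Km : m \in K i.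
  apply: (@tau_fixed i); rewrite fmorph_div rmorphB rmorphM /= tauK tau_w.
  by rewrite rmorph_nat /m; field; rewrite oppr_eq0 two_neq0 v0.
exists (z - m * w i), m; split=> //; last by rewrite subrK.
apply: (@tau_fixed i); rewrite rmorphB rmorphM /= (tau_base Km) tau_w /m.
by field; rewrite two_neq0 v0.
Qed.

Lemma wd3_bal j l a k b : l = j + 2 -> k \in K (j + 1) ->
  wd j l [:: 1; a * k; b] = wd j l [:: 1; a; k * b].
Proof. by move=> lj Kk; apply: (@wd_bal j l [:: 1]); rewrite ?wd3. Qed.

Lemma wd3_addl j l a b c : l = j + 2 ->
  wd j l [:: 1; a + b; c] = wd j l [:: 1; a; c] + wd j l [:: 1; b; c].
Proof. by move=> lj; apply: (@wdD j l [:: 1]); rewrite ?wd3. Qed.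

Lemma wd3_addr j l a b c : l = j + 2 ->
  wd j l [:: 1; a; b + c] = wd j l [:: 1; a; b] + wd j l [:: 1; a; c].
Proof. by move=> lj; apply: (@wdD j l [:: 1; a]); rewrite ?wd3. Qed.

(** This is [h_j z = z h_j]. For [z = k + m v], the scalar [k] moves across the tensor sign, while
    multiplication by [m v] exchanges the two summands of [h_j]. *)
Lemma casimir_balance j l x z : l = j + 2 ->
  wd j l [:: 1; x; z] + wd j l [:: 1; x * (w (j + 1))^-1; w (j + 1) * z] =
  casimir j l (x * z).
Proof.
move=> lj; set v := w (j + 1); have v0 : v != 0 := w_neq0 _.
have [k [m [Kk Km ->]]] := w_coord (j + 1) z.
have Kmv : m * (v * v) \in K (j + 1) by rewrite rpredM // -expr2; exact: w_sqr.
rewrite /casimir -/v [x * (_ + _)]mulrDr wd3_addr //.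
have e1 : wd j l [:: 1; x; k] = wd j l [:: 1; x * k; 1] by rewrite wd3_bal ?mulr1.
have e2 : wd j l [:: 1; x; m * v] = wd j l [:: 1; x * m; v] by rewrite wd3_bal.
have e3 : wd j l [:: 1; x / v; v * (k + m * v)] =
    wd j l [:: 1; x / v * k; v] + wd j l [:: 1; x * (m * v); 1].
  have -> : v * (k + m * v) = k * v + (m * (v * v)) * 1 by ring.
  rewrite wd3_addr // -!wd3_bal //.
  by have -> : x / v * (m * (v * v)) = x * (m * v) by field.
rewrite e1 e2 e3 [_ * v^-1 in RHS]mulrDl !wd3_addl //.
rewrite [X in _ + X = _]addrC addrACA; congr (_ + _).
have <- : x / v * k = x * k / v by field.
have -> : x * (m * v) / v = x * m by field.
exact: addrC.
Qed.

(** The coefficient of [w (j + 1)] in the expansion of [x] over [K_j] on the basis [1, w (j + 1)].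
    As [K_j h_j = 0], only this coefficient survives in [x h_j]. *)
Definition dcoef j (x : F) : F :=
  (x - tau j x) / (w (j + 1) - tau j (w (j + 1))).

Lemma w_sub_tau_neq0 j : w (j + 1) - tau j (w (j + 1)) != 0.
Proof.
rewrite subr_eq0 eq_sym; apply: contraNneq (w_notin_prev j); exact: tau_fixed.
Qed.

Lemma dcoef_base j x : dcoef j x \in K j.
Proof.
apply: tau_fixed; rewrite fmorph_div !rmorphB /= !tauK -[in LHS]opprB -[X in _ / X]opprB.
by rewrite invrN mulrNN.
Qed.

Lemma is_word1k j k : k \in K j -> is_word K j j [:: k].
Proof. by move=> /= ->; rewrite addr0 eqxx. Qed.

Lemma casimir_gword j l x : l = j + 2 ->
  casimir j l x = zmul (wd j j [:: dcoef j x]) (gword j l).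
Proof.
move=> lj; set d := dcoef j x; set v := w (j + 1).
have Kd : d \in K j := dcoef_base j x.
have v0 : v != 0 := w_neq0 _.
have Kc : x - d * v \in K j.
  apply: tau_fixed; rewrite rmorphB rmorphM /= (tau_base Kd) /d /dcoef -/v.
  by have := w_sub_tau_neq0 j; rewrite -/v => h; field.
have -> : casimir j l x = casimir j l (x - d * v) + casimir j l (d * v).
  by rewrite /casimir addrACA -!wd3_addl // -mulrDl subrK.
rewrite (casimir_base lj Kc) add0r /casimir /gword zmulDr !wd_mul ?wd3 ?is_word1k //= !mulr1.
by rewrite !(wd_scalar Kd) ?wd3 // -/v mulr1 mulfK.
Qed.

Lemma gword_scalar j l k : l = j + 2 -> k \in K j ->
  zmul (gword j l) (wd l l [:: k]) = zmul (wd j j [:: k]) (gword j l).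
Proof.
move=> lj Kk; set v := w (j + 1); have v0 : v != 0 := w_neq0 _.
have Kl : k \in K l by rewrite lj base2.
rewrite /gword zmulDl zmulDr !wd_mul ?wd3 ?is_word1k //= -/v mul1r !mulr1.
rewrite !(wd_scalar Kk) ?wd3 // mulr1.
have := casimir_balance (k * v) 1 lj; have := casimir_balance v k lj.
rewrite -/v !mulr1 divff // mulfK // [v * k]mulrC => -> ->.
by [].
Qed.

(** The same four words are grouped in two ways, as [x h_j (x) 1 + x u^-1 h_j (x) u] and as
    [x (x) h_j' + x v^-1 (x) v h_j']. One side is a multiple of [g_j], the other a multiple of
    [g_j'], since [h_j' = 0]. *)
Lemma gword_normal j l j' l' y : l = j + 2 -> j' = j + 1 -> l' = l + 1 ->
  exists y', zmul (gword j l) (wd l l' [:: 1; y]) = zmul (wd j j' [:: 1; y']) (gword j' l').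
Proof.
move=> lj j'j l'l.
have l'j' : l' = j' + 2 by rewrite l'l j'j lj addrAC.
set v := w (j + 1); set u := w (j' + 1).
have [v0 u0] : v != 0 /\ u != 0 by split; exact: w_neq0.
have tauu : tau j u = - u.
  have e : j' + 1 = j + 2 by rewrite j'j -addrA.
  by rewrite /u e -tau2 tau_w.
have w2 a b c x : b = a + 1 -> c = b + 1 -> is_word K a b [:: 1; x].
  by move=> -> _ /=; rewrite rpred1 /= eqxx.
have wjj' x : is_word K j j' [:: 1; x] by rewrite /= rpred1 j'j eqxx.
have wll' x : is_word K l l' [:: 1; x] by rewrite /= rpred1 l'l eqxx.
(* As [tau j u = - u], the letter to the right of [g_j] is [dcoef j x + dcoef j (x / u) * u = 2 x /
   (v - tau j v)]; this choice of [x] makes it [y]. *)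
have [x xE] : exists x, x = y * (v - tau j v) / 2%:R by exists (y * (v - tau j v) / 2%:R).
exists (x / v * dcoef j' v).
have key : zmul (casimir j l x) (wd l l' [:: 1; 1]) +
      zmul (casimir j l (x / u)) (wd l l' [:: 1; u]) =
    zmul (wd j j' [:: 1; x]) (casimir j' l' 1) +
      zmul (wd j j' [:: 1; x / v]) (casimir j' l' v).
  rewrite -[casimir j l (x / u)]casimir_balance // {1}/casimir.
  rewrite !zmulDl !zmulDr !wd_mul ?wd3 ?wjj' ?wll' //= -/v -/u !(mulr1, mul1r).
  exact: addrACA.
move: key; rewrite (casimir_base l'j' (rpred1 _)) zmul0r add0r !casimir_gword //.
rewrite -!(@gword_scalar j l) ?dcoef_base // -!zmulA -zmulDr.
have Kl a : dcoef j a \in K l by rewrite lj base2 dcoef_base.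
rewrite zmulA [in X in _ = X]wd_mul ?wjj' ?is_word1k ?dcoef_base //= => <-.
suff <- : wd l l' [:: 1; y] = zmul (wd l l [:: dcoef j x]) (wd l l' [:: 1; 1]) +
  zmul (wd l l [:: dcoef j (x / u)]) (wd l l' [:: 1; u]) by [].
rewrite !wd_mul ?is_word1k ?wll' //= !mulr1 !(wd_scalar (Kl _)) ?wll' // mulr1.
have addw a b : wd l l' [:: 1; a] + wd l l' [:: 1; b] = wd l l' [:: 1; a + b].
  by symmetry; apply: (@wdD l l' [:: 1]); exact: wll'.
rewrite addw; congr (wd _ _ [:: _; _]).
rewrite /dcoef -/v fmorph_div tauu.
have := w_sub_tau_neq0 j; rewrite -/v; move: (tau j x) xE; move: (tau j v) => v' x' -> h.
by field; rewrite h two_neq0 oppr_eq0 u0.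
Qed.

(** * Normal form modulo the normal elements *)

Definition top_word i l n x : A i l := wd i l [:: 1, x & nseq n 1].

Definition spanned i j l n (a : A i l) : Prop :=
  exists x (b : A i j), a = top_word i l n x + zmul b (gword j l).

Lemma is_word_top i l n x : l = i + n%:Z + 1 -> is_word K i l [:: 1, x & nseq n 1].
Proof. by move=> ->; rewrite /= rpred1 size_nseq /=; lia. Qed.

Lemma is_word2 i j x : j = i + 1 -> is_word K i j [:: 1; x].
Proof. by move=> ->; rewrite /= rpred1 eqxx. Qed.

Lemma topD i l n x y : l = i + n%:Z + 1 ->
  top_word i l n (x + y) = top_word i l n x + top_word i l n y.
Proof. by move=> li; apply: (@wdD i l [:: 1]); exact: is_word_top. Qed.

Lemma top0 i l n : l = i + n%:Z + 1 -> top_word i l n 0 = 0.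
Proof. by move=> li; apply: (addrI (top_word i l n 0)); rewrite -topD // !addr0. Qed.

Lemma top_mul i l l' n x : l = i + n%:Z + 1 -> l' = l + 1 ->
  zmul (top_word i l n x) (wd l l' [:: 1; 1]) = top_word i l' n.+1 x.
Proof.
move=> li l'l; rewrite wd_mul ?is_word2 ?is_word_top // /top_word; congr wd.
rewrite /= mulr1; congr (_ :: _); rewrite -cat_rcons -lastI cats1 rcons_cons.
by rewrite -cats1 -(nseqD n 1) addn1.
Qed.

Lemma spannedD i j l n (a b : A i l) : l = i + n%:Z + 1 ->
  spanned j n a -> spanned j n b -> spanned j n (a + b).
Proof.
move=> li [x [c ->]] [y [d ->]]; exists (x + y), (c + d).
by rewrite topD // zmulDl addrACA.
Qed.

(** For [y = k + m v], the multiple [x m v h_i = x m v (x) 1 + x m (x) v] replaces [x (x) m v] by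
    [- x m v (x) 1]; this sign is the conjugation of [y]. *)
Lemma pair_reduce i l x y : l = i + 2 -> exists2 d, d \in K i &
  wd i l [:: 1; x; y] =
  wd i l [:: 1; x * tau (i + 1) y; 1] + zmul (wd i i [:: d]) (gword i l).
Proof.
move=> li; set v := w (i + 1); have v0 : v != 0 := w_neq0 _.
have [k [m [Kk Km ->]]] := w_coord (i + 1) y.
exists (dcoef i (x * m * v)); first exact: dcoef_base.
rewrite -casimir_gword // /casimir -/v mulfK // addrA -wd3_addl //.
rewrite wd3_addr // rmorphD rmorphM /= tau_w !tau_base // -/v.
have -> : x * (k + m * - v) + x * m * v = x * k by ring.
by rewrite !wd3_bal // mulr1.
Qed.

Lemma spanned_gword i j l j' l' n (b : A i j) y :
  l = i + n%:Z + 1 -> l = j + 2 -> j' = j + 1 -> l' = l + 1 ->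
  spanned j' n.+1 (zmul (zmul b (gword j l)) (wd l l' [:: 1; y])).
Proof.
move=> li lj j'j l'l; rewrite -zmulA; have [y' ->] := gword_normal y lj j'j l'l.
exists 0, (zmul b (wd j j' [:: 1; y'])).
by rewrite top0 ?add0r ?zmulA // l'l li -addn1 PoszD addrA.
Qed.

(** Moving a letter to the left past the trailing ones only costs multiples of
    [gword], which is normal. *)
Lemma spanned_step i j l j' l' n (a : A i l) y :
  l = i + n%:Z + 1 -> l = j + 2 -> j' = j + 1 -> l' = l + 1 ->
  spanned j n a -> spanned j' n.+1 (zmul a (wd l l' [:: 1; y])).
Proof.
elim: n i j l j' l' a y => [|n IHn] i j l j' l' a y li lj j'j l'l [x [b ->]].
  rewrite zmulDl; apply: spannedD; last exact: spanned_gword.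
    by lia.
  have ij' : j' = i by lia.
  have li1 : l = i + 1 by lia.
  clear j'j; subst j'; rewrite /top_word wd_mul ?is_word2 //= mulr1.
  have [|d Kd ->] := @pair_reduce i l' x y; first by lia.
  by exists (x * tau (i + 1) y), (wd i i [:: d]).
rewrite zmulDl; apply: spannedD; last exact: spanned_gword.
  by lia.
have lj' : l = j' + 1 by lia.
have j'i : j' = i + n%:Z + 1 by lia.
have l'j' : l' = j' + 2 by lia.
rewrite -(top_mul x j'i lj') -zmulA wd_mul ?is_word2 // [cat_word _ _]/= mulr1.
have [d Kd ->] := pair_reduce 1 y l'j'.
rewrite [zmul (top_word _ _ _ _) _]zmulDr [X in _ + X]zmulA mul1r.
apply: spannedD; first by lia.
  have -> : wd j' l' [:: 1; tau (j' + 1) y; 1] =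
      zmul (wd j' l [:: 1; tau (j' + 1) y]) (wd l l' [:: 1; 1]).
    by rewrite wd_mul ?is_word2 //= mulr1.
  rewrite zmulA.
  have [|||||x' [b' ->]] := IHn i (j - 1) j' j l (top_word i j' n x) (tau (j' + 1) y).
  - exact: j'i.
  - by lia.
  - by rewrite subrK.
  - exact: lj'.
  - by exists x, 0; rewrite zmul0l addr0.
  rewrite zmulDl (top_mul x' li l'l); apply: spannedD; last exact: spanned_gword.
    by lia.
  by exists x', 0; rewrite zmul0l addr0.
exists 0, (zmul (top_word i j' n x) (wd j' j' [:: d])).
by rewrite top0 ?add0r ?zmulA //; lia.
Qed.

Lemma span_word i j l n s : l = i + n%:Z + 1 -> l = j + 2 -> is_word K i l s ->
  spanned j n (wd i l s).
Proof.
elim: n j l s => [|n IHn] j l s li lj ws.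
  case: s ws => [|k [|x [|y s]]] //=; [lia| |lia].
  move=> /andP[Kk _]; exists (k * x), 0; rewrite zmul0l addr0 /top_word -(wd_scalar Kk) //.
  by rewrite is_word2 //; lia.
case/lastP: s ws => [|s x] // ws.
have ws1 : is_word K i (l - 1) s.
  case: s ws => [|k s] /=; first by move=> /andP[_]; lia.
  by rewrite size_rcons => /andP[->]; lia.
have -> : wd i l (rcons s x) = zmul (wd i (l - 1) s) (wd (l - 1) l [:: 1; x]).
  rewrite wd_mul ?is_word2 ?subrK //; congr wd.
  by case: (s) ws1 => [|k t] //= _; rewrite mulr1 -cat_rcons -lastI cats1.
apply: (@spanned_step i (j - 1)); try lia.
by apply: IHn => //; lia.
Qed.

Lemma wd_ind i l (P : A i l -> Prop) :
  P 0 -> (forall a b, P a -> P b -> P (a - b)) ->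
  (forall s, is_word K i l s -> P (wd i l s)) -> forall a, P a.
Proof.
move=> P0 PB Pw a; rewrite -[a]zpiK; move: (repr a) => {}a; rewrite -[a]zpiK.
pose pi2 (u : free_hom K i l) : A i l := zpi (sym_rel w) (zpi (@tensor_rel F K) u).
have pi2B u v : pi2 (u - v) = pi2 u - pi2 v by rewrite /pi2 /zpi !raddfB.
rewrite -[zpi _ _]/(pi2 (repr a)).
elim/free_ind: (repr a) => [|u v Pu Pv|s]; first by rewrite /pi2 /zpi !raddf0.
  by rewrite pi2B; exact: PB.
have -> : pi2 << s >> = wd i l (val s) by rewrite /wd /tensor /free_gen valK.
exact: Pw (valP s).
Qed.

Lemma spanned_all i j l n (a : A i l) : l = i + n%:Z + 1 -> l = j + 2 -> spanned j n a.
Proof.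
move=> li lj; elim/wd_ind: a => [|a b Pa [x [c ->]]|s ws]; last exact: span_word.
  by exists 0, 0; rewrite zmul0l addr0 top0.
apply: spannedD => //; exists (- x), (- c); rewrite opprD zmulNl; congr (_ + _).
by apply/eqP; rewrite eq_sym -addr_eq0 -topD // addNr top0.
Qed.

(** * Kernel and image of the representation *)

Lemma top_word_rep i l n x : l = i + n%:Z + 1 ->
  rep (top_word i l n x) = letter i x * word_tail (i + 1) (nseq n 1).
Proof.
by move=> li; rewrite rep_wd ?is_word_top //= rmorph1 (mon1 sigmaK sigmaVK) mul1r.
Qed.

Let mon1E : mon 1 0 = 1.
Proof. exact: mon1. Qed.

Lemma mulmonK c (a : E) : c != 0 -> a * mon c 0 * mon c^-1 0 = a.
Proof.
by move=> c0; rewrite -mulrA monM addr0 -[spow 0 _]/(c^-1) mulfV // mon1E mulr1.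
Qed.

Lemma letter_even i x : ~~ odd `|i|%N -> laurent 0 2 (letter i x) /\ cf (letter i x) 1 = x.
Proof.
rewrite /letter => /negbTE->; split; first by apply: laurent_add; exact: laurent_mon.
by rewrite cfD !cf_mon add0r.
Qed.

Lemma letter_odd1 i : odd `|i|%N -> laurent (-1) 1 (letter i 1) /\ cf (letter i 1) 0 = 1.
Proof.
rewrite /letter => ->; split; first by apply: laurent_sub; exact: laurent_mon.
by rewrite cfB !cf_mon /= rmorph1 subr0.
Qed.

(** A letter of odd degree has top term in [t^0], one of even degree in [t^1]. Of the [2 k + 1]
    letters, [k] have even degree. *)
Lemma word_tail_ones k i : odd `|i|%N ->
  laurent (- k%:Z - 1) (k%:Z + 1) (word_tail i (nseq k.*2.+1 1)) /\
  cf (word_tail i (nseq k.*2.+1 1)) k%:Z = 1.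
Proof.
elim: k i => [|k IHk] i iodd; have [L1 c1] := letter_odd1 iodd.
  by rewrite /= mulr1; split=> //; apply: laurent_widen L1.
have i1even : ~~ odd `|(i + 1)%R|%N by rewrite oddz_addr1 negbK.
have [L2 c2] := letter_even 1 i1even.
have [|L3 c3] := IHk (i + 1 + 1); first by rewrite !oddz_addr1 negbK.
have L12 : laurent (-1) (1 + 1) (letter i 1 * letter (i + 1) 1).
  by apply: laurent_widen (laurent_mul L1 L2).
have c12 : cf (letter i 1 * letter (i + 1) 1) 1 = 1.
  have := @cf_top_mul _ _ _ sigmaK sigmaVK (-1) 0 0 1 _ _ L1 L2.
  by rewrite c1 c2 mul1r /=.
rewrite doubleS; rewrite [nseq _ _]/= [word_tail _ _]/= mulrA; split.
  by apply: laurent_widen (laurent_mul L12 L3); lia.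
have -> : k.+1%:Z = 1 + k%:Z by rewrite -add1n.
rewrite (cf_top_mul L12 L3) c12 c3 mul1r.
exact: (rmorph1 (spow_rmorphism sigmaK sigmaVK 1)).
Qed.

Lemma rep_top_word l m x : l = m.+1.*2%:Z ->
  laurent (- m.+1%:Z) (m.+1%:Z + 1) (rep (top_word 0 l m.*2.+1 x)) /\
  cf (rep (top_word 0 l m.*2.+1 x)) m.+1%:Z = x.
Proof.
move=> lm; rewrite top_word_rep; last by lia.
have [L1 c1] := @letter_even 0 x isT.
have [|L2 c2] := @word_tail_ones m (0 + 1); first by [].
split; first by apply: laurent_widen (laurent_mul L1 L2); lia.
have -> : m.+1%:Z = 1 + m%:Z by rewrite -add1n.
rewrite (@cf_top_mul _ _ _ sigmaK sigmaVK 0 1 _ _ _ _ L1 L2) c1 c2.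
by rewrite (rmorph1 (spow_rmorphism sigmaK sigmaVK 1)) mulr1.
Qed.

Lemma rep_gword j l : l = j + 2 -> rep (gword j l) = mon (g_val j) 0.
Proof. by move=> ->; rewrite -sym_gE rep_g. Qed.

Lemma A00_scalar (a : A 0 0) : exists2 k, k \in K 0 & a = wd 0 0 [:: k].
Proof.
have wk k : k \in K 0 -> is_word K 0 0 ([::] ++ [:: k]) by move=> /= ->.
elim/wd_ind: a => [|a b [k Kk ->] [m Km ->]|[|k [|x s]]] //=.
- exists 0; first exact: rpred0.
  apply: (addrI (wd 0 0 ([::] ++ [:: 0]))); rewrite -wdD ?wk ?rpred0 //.
  by rewrite !addr0.
- exists (k - m); first exact: rpredB.
  apply/eqP; rewrite subr_eq -[[:: k - m]]/([::] ++ [:: k - m]) -[[:: m]]/([::] ++ [:: m]).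
  by rewrite -wdD ?wk ?rpredB // subrK.
- by move=> /andP[Kk _]; exists k.
by move=> /andP[_]; lia.
Qed.

Lemma rep_scalar k : k \in K 0 -> rep (wd 0 0 [:: k]) = mon k 0.
Proof.
move=> Kk; rewrite rep_wd ?is_word1k //= mulr1; congr (mon _ _).
exact: (tau_base Kk).
Qed.

Lemma rep_laurent m l (a : A 0 l) : l = m.*2%:Z -> laurent (- m%:Z) (m%:Z + 1) (rep a).
Proof.
elim: m l a => [|m IHm] l a lm.
  subst l; have [k Kk ->] := A00_scalar a.
  by rewrite rep_scalar //; apply: laurent_mon.
have [||x [b ->]] := @spanned_all 0 m.*2%:Z l m.*2.+1 a; try lia.
rewrite repD repM rep_gword; last by lia.
apply: laurent_add; first exact: (rep_top_word x lm).1.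
have L0 : laurent 0 1 (mon (g_val m.*2%:Z) 0) by exact: laurent_mon.
by apply: laurent_widen (laurent_mul (IHm _ b (erefl _)) L0); lia.
Qed.

(** In the normal form [x (x) 1 ... (x) 1 + b g], only the first term reaches [t^(m+1)], with
    coefficient [x]. Hence [x = 0], and induction applies to [b] because [g] acts as a unit. *)
Lemma rep_inj0 m l (a : A 0 l) : l = m.*2%:Z -> rep a = 0 -> a = 0.
Proof.
elim: m l a => [|m IHm] l a lm.
  subst l; have [k Kk ->] := A00_scalar a.
  rewrite rep_scalar // => /(congr1 (fun u : E => cf u 0)); rewrite cf_mon cf0 /= => ->.
  have [] := A00_scalar 0.
  move=> k' Kk' e; have := congr1 (@rep 0 0) e.
  rewrite rep0 rep_scalar // => /(congr1 (fun u : E => cf u 0)); rewrite cf_mon cf0 /= => k0.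
  by rewrite e -k0.
have [||x [b ->]] := @spanned_all 0 m.*2%:Z l m.*2.+1 a; try lia.
rewrite repD repM rep_gword; last by lia.
have L0 : laurent 0 1 (mon (g_val m.*2%:Z) 0) by exact: laurent_mon.
have Lb := laurent_mul (rep_laurent b (erefl _)) L0.
move=> e; have := congr1 (fun u : E => cf u m.+1%:Z) e.
rewrite cfD (rep_top_word x lm).2 (cf_laurent Lb) ?cf0 ?addr0; last by lia.
move=> x0; move: e; rewrite x0 top0 ?rep0 ?add0r; try lia.
move=> e; rewrite (IHm _ b (erefl _)) ?zmul0l //.
by rewrite -(mulmonK (rep b) (g_val_neq0 m.*2%:Z)) e mul0r.
Qed.

Fixpoint odd_count (i : int) (n : nat) : nat :=
  if n is m.+1 then odd `|i|%N + odd_count (i + 1) m else 0.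

Lemma odd_count_double i m : odd_count i m.*2 = m.
Proof.
elim: m i => [|m IHm] i //; rewrite doubleS /= IHm oddz_addr1.
by case: (odd _).
Qed.

(** In the skew group ring, a letter [X] of degree [(i, i+1)] satisfies [s_i X s_(i+1) = (-1)^i X].
    The powers of [t] correct for conjugating by [s_0] instead of [s_1] at odd indices, as
    [t^-1 = s_0 s_1]. *)
Lemma theta_letter i x :
  mon 1 (if odd `|i|%N then -1 else 0) * theta (letter i x) =
  (-1) ^+ odd `|i|%N * letter i x * mon 1 (if odd `|(i + 1)%R|%N then -1 else 0).
Proof.
have th := theta_mon sigmaK sigmaVK (qconjK Q0) (tau_sigma Q0 Q1).
have s1 z : spow 1 z = sigma z by [].
have sN1 z : spow (-1) z = sigmaV z by [].
have s0 z : spow 0 z = z by [].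
rewrite oddz_addr1 /letter; case: (odd _) => /=.
  rewrite thetaB !th mulrBr !monM !sN1 !mul1r expr1 mulN1r mon1E mulr1 opprB.
  by rewrite oppr0 !addr0 opprK addNr /= !qconjK.
rewrite thetaD !th mon1E expr0 !mul1r mulrDl !monM s0 s1 rmorph1 !mulr1.
by rewrite oppr0 add0r addrN /= qconjK addrC.
Qed.

Lemma theta_word_tail i s :
  mon 1 (if odd `|i|%N then -1 else 0) * theta (word_tail i s) =
  (-1) ^+ odd_count i (size s) * word_tail i s *
    mon 1 (if odd `|(i + (size s)%:Z)%R|%N then -1 else 0).
Proof.
elim: s i => [|x s IHs] i /=.
  have -> : theta 1 = 1 by rewrite /theta mulr1 (flipK (qconjK Q0)).
  by rewrite addr0 !mulr1 expr0 mul1r.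
rewrite (thetaM (qconjK Q0)) mulrA theta_letter -[LHS]mulrA IHs.
have -> : i + 1 + (size s)%:Z = i + (size s).+1%:Z by rewrite -addrA -PoszD add1n.
rewrite exprD !mulrA; congr (_ * _ * _); rewrite -!mulrA; congr (_ * _).
by rewrite -(commrX _ (commrN1 _)).
Qed.

(** Among the [2 m] letters of a word starting in degree [0], exactly [m] have odd degree, and the
    powers of [t] at the two even ends are trivial. *)
Lemma theta_rep m l (a : A 0 l) : l = m.*2%:Z -> theta (rep a) = (-1) ^+ m * rep a.
Proof.
move=> lm; elim/wd_ind: a => [|a b IHa IHb|s ws].
- by rewrite rep0 theta0 mulr0.
- by rewrite repB thetaB IHa IHb mulrBr.
rewrite rep_wd //; case: s ws => [|k s] //= /andP[Kk /eqP ls].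
have sm : size s = m.*2 by lia.
have := theta_word_tail 0 s; rewrite sm odd_count_double /= mon1E mul1r.
have -> : odd `|(0 + m.*2%:Z)%R|%N = false by rewrite add0r /= odd_double.
rewrite mon1E mulr1 => e; rewrite (thetaM (qconjK Q0)) e.
rewrite (theta_mon sigmaK sigmaVK (qconjK Q0) (tau_sigma Q0 Q1)) oppr0 /= qconjK.
rewrite (qconj_base (Kk : k \in qbase Q0)) !mulrA; congr (_ * _).
by rewrite -(commrX _ (commrN1 _)).
Qed.

Lemma cf_sign k (u : E) n : cf ((-1) ^+ k * u) n = (-1) ^+ k * cf u n.
Proof.
elim: k => [|k IHk]; first by rewrite !expr0 !mul1r.
by rewrite !exprS -!mulrA !mulN1r -sub0r cfB cf0 IHk sub0r.
Qed.

(** Symmetry under [theta] makes the bottom coefficient vanish together with the top one. *)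
Lemma laurent_shrink m k (v : E) : laurent (- m.+1%:Z) (m.+1%:Z + 1) v ->
  theta v = (-1) ^+ k * v -> cf v m.+1%:Z = 0 -> laurent (- m%:Z) (m%:Z + 1) v.
Proof.
move=> Lv thv v1; have vN : cf v (- m.+1%:Z) = 0.
  have := cf_theta (qconjK Q0) (tau_sigma Q0 Q1) m.+1%:Z Lv.
  rewrite thv cf_sign v1 mulr0 => /esym/eqP; rewrite fmorph_eq0 => /eqP //.
have := laurent_top Lv; rewrite v1 mon0 subr0 => /laurent_bot.
by rewrite vN mon0 subr0; apply: laurent_widen; lia.
Qed.

(** Subtract the top word with the same top coefficient; the support then shrinks at both ends. The
    value [c] of [g] satisfies [tau0 c = - c], so division by it lowers the exponent of the sign by
    one, as the induction requires. *)
Lemma rep_surj0 m l (u : E) : l = m.*2%:Z -> laurent (- m%:Z) (m%:Z + 1) u ->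
  theta u = (-1) ^+ m * u -> exists a : A 0 l, rep a = u.
Proof.
have th := theta_mon sigmaK sigmaVK (qconjK Q0) (tau_sigma Q0 Q1).
elim: m l u => [|m IHm] l u lm Lu thu.
  subst l; have := laurent_top (n := 0) Lu.
  move=> /laurent_eq0; rewrite oppr0 lexx => /(_ isT)/eqP; rewrite subr_eq0 => /eqP uE.
  have Kk : cf u 0 \in K 0.
    apply: (@qconj_fixed _ Q0 two_neq0).
    have := cf_theta (qconjK Q0) (tau_sigma Q0 Q1) 0 Lu.
    by rewrite thu expr0 mul1r oppr0 => <-.
  by exists (wd 0 0 [:: cf u 0]); rewrite rep_scalar.
pose x := cf u m.+1%:Z; pose v := u - rep (top_word 0 l m.*2.+1 x).
have [Lt ct] := rep_top_word x lm.
have thv : theta v = (-1) ^+ m.+1 * v.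
  by rewrite /v thetaB mulrBr thu (theta_rep _ lm).
have v1 : cf v m.+1%:Z = 0 by rewrite cfB ct subrr.
have {Lu Lt} Lv : laurent (- m.+1%:Z) (m.+1%:Z + 1) v by exact: laurent_sub.
have {}Lv := laurent_shrink Lv thv v1.
pose c := g_val m.*2%:Z; have c0 : c != 0 := g_val_neq0 _.
have tauc : tau0 c = - c.
  rewrite /c /g_val /= odd_double rmorphM rmorph_nat rmorphB /= qconjK.
  by rewrite -mulrN opprB.
have [||b bE] := IHm _ (v * mon c^-1 0) (erefl _).
- have L0 : laurent 0 1 (mon c^-1 0) by exact: laurent_mon.
  by apply: laurent_widen (laurent_mul Lv L0); lia.
- rewrite (thetaM (qconjK Q0)) thv th oppr0 fmorphV /= tauc invrN monN mulrN -mulNr.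
  by rewrite exprS mulN1r !mulNr opprK mulrA.
have lm2 : l = m.*2%:Z + 2 by lia.
exists (top_word 0 l m.*2.+1 x + zmul b (gword m.*2%:Z l)).
rewrite repD repM (rep_gword lm2) bE -/c.
have := mulmonK v (invr_neq0 c0); rewrite invrK => ->.
by rewrite addrC subrK.
Qed.
End Representation.

(** * The localisation *)

Section LocalisedRep.
Variables (A : zalg) (g : forall i, A i (i + 2)) (L : zalg).
Variable f : forall i j, A i j -> L i j.
Hypothesis f_loc : is_localisation g f.
Variables (E : pzRingType) (rep : forall i j, A i j -> E).
Hypothesis repB : forall i j (a b : A i j), rep (a - b) = rep a - rep b.
Hypothesis repM : forall i j l (a : A i j) (b : A j l), rep (zmul a b) = rep a * rep b.
Hypothesis rep1 : forall i, rep (zone i : A i i) = 1.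
Hypothesis rep_g_unit : forall i, exists v, rep (g i) * v = 1 /\ v * rep (g i) = 1.

Let fD i j (a b : A i j) : f (a + b) = f a + f b.
Proof. by case: f_loc => -[fD _ _] _ _ _; exact: fD. Qed.

Let fM i j l (a : A i j) (b : A j l) : f (zmul a b) = zmul (f a) (f b).
Proof. by case: f_loc => -[_ fM _] _ _ _; exact: fM. Qed.

Let f1 i : f (zone i) = zone i.
Proof. by case: f_loc => -[_ _ f1] _ _ _; exact: f1. Qed.

Let fB i j (a b : A i j) : f (a - b) = f a - f b.
Proof. by apply: (addIr (f b)); rewrite -fD !subrK. Qed.

(** Denominators range over all elements that become invertible on both sides. This class is closed
    under products, and no product [gprod] has to be transported between equal degrees. *)
Definition invertible_rep j m (x : A j m) : Prop :=
  (exists y, zinverse (f x) y) /\ (exists v, rep x * v = 1 /\ v * rep x = 1).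

Lemma invertible_rep_mul j m l (x : A j m) (y : A m l) :
  invertible_rep x -> invertible_rep y -> invertible_rep (zmul x y).
Proof.
move=> [[x' [xx' x'x]] [u [xu ux]]] [[y' [yy' y'y]] [v [yv vy]]]; split.
  exists (zmul y' x'); rewrite fM; split.
    by rewrite zmulA -(zmulA (f x)) yy' zmul1r.
  by rewrite zmulA -(zmulA y') x'x zmul1r.
exists (v * u); rewrite repM; split.
  by rewrite mulrA -(mulrA (rep x)) yv mulr1.
by rewrite mulrA -(mulrA v) ux mulr1.
Qed.

Lemma invertible_rep_one i : invertible_rep (zone i : A i i).
Proof.
split; first by exists (zone i); rewrite f1 /zinverse !zmul1l.
by exists 1; rewrite rep1 !mulr1.
Qed.

Lemma invertible_rep_gprod i n : invertible_rep (gprod g i n).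
Proof.
elim: n i => [|n IHn] i /=; first exact: invertible_rep_one.
apply: invertible_rep_mul => //; split=> //.
by case: f_loc => _ fg _ _; exact: fg.
Qed.

(** The kernel of [f] is torsion for the products of the [g_i], and these act as units. *)
Lemma rep_f_inj i j (a b : A i j) : f a = f b -> rep a = rep b.
Proof.
move=> ab; have [_ _ _ /(_ i j (a - b))[]] := f_loc; first by rewrite fB ab subrr.
move=> r e; have [_ [v [gv _]]] := invertible_rep_gprod j r.
have rep0 i' j' : rep (0 : A i' j') = 0 by rewrite -(subrr 0) repB subrr.
have : rep (a - b) * rep (gprod g j r) = 0 by rewrite -repM e rep0.
move/(congr1 ( *%R^~ v)); rewrite /= -mulrA gv mulr1 mul0r repB => /eqP.
by rewrite subr_eq0 => /eqP.
Qed.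

(** The Ore condition is extracted from [L]: the element [x^-1 a] is itself a right fraction
    [b u^-1]. *)
Lemma common_multiple j m m' (x : A j m) (a : A j m') : invertible_rep x ->
  exists p (b : A m p) (u : A m' p), [/\ invertible_rep u,
    zmul (f a) (f u) = zmul (f x) (f b) & rep a * rep u = rep x * rep b].
Proof.
move=> [[y [xy yx]] _]; have [_ _ /(_ m m' (zmul y (f a))) fracs _] := f_loc.
have [r [b [y' [[gy' y'g] e]]]] := fracs.
have e' : zmul (f a) (f (gprod g m' r)) = zmul (f x) (f b).
  have -> : f a = zmul (f x) (zmul (f b) y') by rewrite -e zmulA xy zmul1l.
  by rewrite -!zmulA y'g zmul1r.
exists (shift2 m' r), b, (gprod g m' r); split=> //.
  exact: invertible_rep_gprod.
by rewrite -!repM; apply: rep_f_inj; rewrite !fM.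
Qed.

Definition extends i j (z : L i j) (s : E) : Prop :=
  exists m (x : A j m) (a : A i m),
    [/\ invertible_rep x, zmul z (f x) = f a & s * rep x = rep a].

Lemma extends_exists i j (z : L i j) : exists s, extends z s.
Proof.
have [_ _ /(_ i j z)[r [a [y [[gy yg] ->]]]] _] := f_loc.
have Gg := invertible_rep_gprod j r; have [_ [v [gv vg]]] := Gg.
exists (rep a * v), (shift2 j r), (gprod g j r), a; split=> //.
  by rewrite -zmulA yg zmul1r.
by rewrite -mulrA vg mulr1.
Qed.

Lemma invertible_rep_cancel j m (x : A j m) (s t : E) :
  invertible_rep x -> s * rep x = t * rep x -> s = t.
Proof.
by move=> [_ [v [xv _]]] e; rewrite -[s]mulr1 -[t]mulr1 -xv !mulrA e.
Qed.

Lemma extends_common i j (z z' : L i j) s s' : extends z s -> extends z' s' ->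
  exists m (x : A j m) (a a' : A i m), [/\ invertible_rep x, zmul z (f x) = f a,
    zmul z' (f x) = f a', s * rep x = rep a & s' * rep x = rep a'].
Proof.
move=> [m [x [a [Gx zx sx]]]] [m' [x' [a' [Gx' zx' sx']]]].
have [p [b [u [Gu e e']]]] := common_multiple x' Gx.
exists p, (zmul x' u), (zmul a b), (zmul a' u); split.
- exact: invertible_rep_mul.
- by rewrite fM e zmulA zx fM.
- by rewrite fM zmulA zx' fM.
- by rewrite repM e' mulrA sx repM.
- by rewrite repM mulrA sx' repM.
Qed.

Lemma extends_uniq i j (z : L i j) s s' : extends z s -> extends z s' -> s = s'.
Proof.
move=> zs zs'; have [m [x [a [a' [Gx e e' sx sx']]]]] := extends_common zs zs'.
apply: (invertible_rep_cancel Gx); rewrite sx sx'; apply: rep_f_inj.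
by rewrite -e -e'.
Qed.

Definition loc_rep i j (z : L i j) : E := xget 0 [set s | extends z s]%classic.

Lemma loc_repP i j (z : L i j) : extends z (loc_rep z).
Proof.
have [s zs] := extends_exists z; rewrite /loc_rep.
by case: xgetP => [t _ //|/(_ s)].
Qed.

Lemma loc_repE i j (z : L i j) s : extends z s -> loc_rep z = s.
Proof. by apply: extends_uniq; exact: loc_repP. Qed.

Lemma loc_repB i j (z z' : L i j) : loc_rep (z - z') = loc_rep z - loc_rep z'.
Proof.
have [m [x [a [a' [Gx e e' sx sx']]]]] := extends_common (loc_repP z) (loc_repP z').
apply: loc_repE; exists m, x, (a - a'); split=> //.
  by rewrite zmulBl e e' fB.
by rewrite mulrBl sx sx' repB.
Qed.

Lemma loc_repM i j l (z : L i j) (z' : L j l) :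
  loc_rep (zmul z z') = loc_rep z * loc_rep z'.
Proof.
have [m [x [a [Gx zx sx]]]] := loc_repP z.
have [m' [x' [a' [Gx' zx' sx']]]] := loc_repP z'.
have [p [b [u [Gu e e']]]] := common_multiple a' Gx.
apply: loc_repE; exists p, (zmul x' u), (zmul a b); split.
- exact: invertible_rep_mul.
- by rewrite fM zmulA -(zmulA z) zx' -(zmulA z) e zmulA zx fM.
- by rewrite repM mulrA -(mulrA (loc_rep z)) sx' -mulrA e' mulrA sx repM.
Qed.

Lemma loc_rep_f i j (a : A i j) : loc_rep (f a) = rep a.
Proof.
apply: loc_repE; exists j, (zone j), a; split; first exact: invertible_rep_one.
  by rewrite f1 zmul1r.
by rewrite rep1 mulr1.
Qed.

Lemma loc_rep1 i : loc_rep (zone i : L i i) = 1.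
Proof. by rewrite -f1 loc_rep_f rep1. Qed.

Lemma loc_frac i j (z : L i j) : exists r (a : A i (shift2 j r)) y,
  zinverse (f (gprod g j r)) y /\ z = zmul (f a) y.
Proof. by case: f_loc => _ _ fracs _; exact: fracs. Qed.

Lemma loc_rep_frac i j r (a : A i (shift2 j r)) y :
  zinverse (f (gprod g j r)) y ->
  loc_rep (zmul (f a) y) * rep (gprod g j r) = rep a.
Proof.
by move=> [gy yg]; rewrite -loc_rep_f -loc_repM -zmulA yg zmul1r loc_rep_f.
Qed.
End LocalisedRep.

Lemma shift2_0 n : shift2 0 n = n.*2%:Z.
Proof. by rewrite shift2E; lia. Qed.

(** * The corner ring as a ring of invariants *)

Section Corner.
Variables (F : fieldType) (Q0 Q1 : quadratic F).
Hypothesis two_neq0 : (2%:R : F) != 0.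
Local Notation tau0 := (qconj Q0).
Local Notation K := (alternate (qbase Q0) (qbase Q1)).
Local Notation sigmaK := (sigmaK Q0 Q1).
Local Notation sigmaVK := (sigmaVK Q0 Q1).
Local Notation mon := (mon sigmaK sigmaVK).
Local Notation theta := (theta tau0).
Local Notation laurent := (laurent sigmaK sigmaVK).
Local Notation S := (laurent_ring sigmaK sigmaVK).
Local Notation E := (zend (int -> F)).

Variable w : int -> F.
Hypothesis w_notin : forall i, w i \notin K i.
Hypothesis w_sqr : forall i, w i ^+ 2 \in K i.
Hypothesis w_notin_prev : forall i, w (i + 1) \notin K i.
Local Notation A := (nc_sym K w).
Local Notation g := (sym_g K w).

Variables (L : zalg) (f : forall i j, A i j -> L i j).
Hypothesis f_loc : is_localisation g f.

Let repB := @repB F Q0 Q1 two_neq0 w w_notin w_sqr.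
Let repM := @repM F Q0 Q1 two_neq0 w w_notin w_sqr.
Let rep1 := @rep1 F Q0 Q1 two_neq0 w w_notin w_sqr.
Let monM := mon_mul sigmaK sigmaVK.
Let mon1E : mon 1 0 = 1. Proof. exact: mon1. Qed.
Let th := theta_mon sigmaK sigmaVK (qconjK Q0) (tau_sigma Q0 Q1).

Lemma rep_g_unit i :
  exists v, rep (g i) * v = 1 /\ v * rep (g i) = 1.
Proof.
exists (mon (g_val Q0 Q1 w i)^-1 0).
rewrite (rep_g two_neq0 w_notin w_sqr) !monM addr0.
have c0 := g_val_neq0 two_neq0 w_notin_prev i.
by rewrite -[X in mon (_ * X) _ = _ /\ _]/((g_val Q0 Q1 w i)^-1)
  -[X in _ /\ mon (_ * X) _ = _]/(g_val Q0 Q1 w i) mulfV // mulVf // mon1E.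
Qed.

Lemma rep_gprod i n : exists2 c, c != 0 & rep (gprod g i n) = mon c 0.
Proof.
elim: n i => [|n IHn] i /=; first by exists 1; rewrite ?oner_eq0 // rep1 mon1E.
have [c c0 cE] := IHn (i + 2); exists (g_val Q0 Q1 w i * c).
  by rewrite mulf_neq0 // (g_val_neq0 two_neq0 w_notin_prev).
by rewrite repM cE (rep_g two_neq0 w_notin w_sqr) monM addr0.
Qed.

Definition corner_rep (z : zcorner L 0) : E := loc_rep f (@rep F Q0 Q1 w) z.

Lemma corner_repB a b : corner_rep (a - b) = corner_rep a - corner_rep b.
Proof. exact: (loc_repB f_loc repB repM rep1 rep_g_unit). Qed.

Lemma corner_repM a b : corner_rep (a * b) = corner_rep a * corner_rep b.
Proof. exact: (loc_repM f_loc repB repM rep1 rep_g_unit). Qed.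

Lemma corner_rep1 : corner_rep 1 = 1.
Proof. exact: (loc_rep1 f_loc repB repM rep1 rep_g_unit). Qed.

Lemma corner_rep0 : corner_rep 0 = 0.
Proof. by rewrite -(subrr 0) corner_repB subrr. Qed.

Lemma corner_repD a b : corner_rep (a + b) = corner_rep a + corner_rep b.
Proof.
rewrite -{1}[b]opprK corner_repB -[- b]sub0r corner_repB corner_rep0.
by rewrite sub0r opprK.
Qed.

Lemma corner_rep_frac r (a : A 0 (shift2 0 r)) y :
  zinverse (f (gprod g 0 r)) y ->
  corner_rep (zmul (f a) y) * rep (gprod g 0 r) = rep a.
Proof. exact: (loc_rep_frac f_loc repB repM rep1 rep_g_unit). Qed.

Lemma corner_rep_eq0 z : corner_rep z = 0 -> z = 0.
Proof.
have [r [a [y [gy ->]]]] := loc_frac f_loc z => e.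
have := corner_rep_frac a gy; rewrite e mul0r => /esym.
move=> /(rep_inj0 two_neq0 w_notin w_sqr w_notin_prev (shift2_0 r)) ->.
have -> : f (0 : A 0 (shift2 0 r)) = 0.
  have [[fD _ _] _ _ _] := f_loc.
  by apply: (addrI (f 0)); rewrite -fD !addr0.
by rewrite zmul0l.
Qed.

Lemma corner_rep_inj : injective corner_rep.
Proof.
move=> a b e; apply/eqP; rewrite -subr_eq0; apply/eqP/corner_rep_eq0.
by rewrite corner_repB e subrr.
Qed.

Lemma filtration_rep n z : loc_filtration g f n z ->
  laurent (- n%:Z) (n%:Z + 1) (corner_rep z) /\ theta (corner_rep z) = corner_rep z.
Proof.
move=> [a [y [gy ->]]]; have e := corner_rep_frac a gy.
have [c c0 cE] := rep_gprod 0 n; rewrite cE in e.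
have La := rep_laurent two_neq0 w_notin w_sqr w_notin_prev a (shift2_0 n).
have tha := theta_rep two_neq0 w_notin w_sqr a (shift2_0 n).
have thg := theta_rep two_neq0 w_notin w_sqr (gprod g 0 n) (shift2_0 n).
move: (corner_rep _) e => x e; have xE : x = rep a * mon c^-1 0.
  by rewrite -e mulmonK.
split.
  have L0 : laurent 0 1 (mon c^-1 0) by exact: laurent_mon.
  by rewrite xE; apply: laurent_widen (laurent_mul La L0); lia.
have := congr1 theta e; rewrite (thetaM (qconjK Q0)) tha -e.
rewrite cE in thg; rewrite thg mulrA (commrX n (commrN1 _)) -!mulrA.
move=> /(congr1 (fun u => (-1) ^+ n * u)); rewrite !mulrA -expr2 sqrr_sign !mul1r.
by move=> /(congr1 (fun u => u * mon c^-1 0)); rewrite !mulmonK.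
Qed.

Lemma filtration_surj n x : laurent (- n%:Z) (n%:Z + 1) x -> theta x = x ->
  exists2 z, loc_filtration g f n z & corner_rep z = x.
Proof.
move=> Lx thx; have [c c0 cE] := rep_gprod 0 n.
have thg := theta_rep two_neq0 w_notin w_sqr (gprod g 0 n) (shift2_0 n).
rewrite cE in thg.
have [||a aE] := rep_surj0 two_neq0 w_notin w_sqr w_notin_prev (u := x * mon c 0)
  (shift2_0 n).
- have L0 : laurent 0 1 (mon c 0) by exact: laurent_mon.
  by apply: laurent_widen (laurent_mul Lx L0); lia.
- by rewrite (thetaM (qconjK Q0)) thx thg !mulrA (commrX n (commrN1 _)).
have [[y gy] _] := invertible_rep_gprod f_loc repM rep1 rep_g_unit 0 n.
exists (zmul (f a) y); first by exists a, y.
have := corner_rep_frac a gy; rewrite cE aE.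
by move=> /(congr1 (fun u => u * mon c^-1 0)); rewrite !mulmonK.
Qed.

(** For the converse, some element of the [n]-th step has the same image as [z], and injectivity
    identifies the two. *)
Lemma filtrationP n z :
  loc_filtration g f n z <-> laurent (- n%:Z) (n%:Z + 1) (corner_rep z).
Proof.
split=> [/filtration_rep[]//|Lz].
have thz : theta (corner_rep z) = corner_rep z.
  have [r [a [y ay]]] := loc_frac f_loc z.
  by have [] := @filtration_rep r z; first by exists a, y.
by have [z' Vz' /corner_rep_inj<-] := filtration_surj Lz thz.
Qed.

Lemma corner_repP x : (S x /\ theta x = x) <-> exists a, x = corner_rep a.
Proof.
split=> [[[m [n Lx]] thx]|[z ->]].
  have [|z _ <-] := @filtration_surj (`|m| + `|n|)%N x _ thx; last by exists z.
  by apply: laurent_widen Lx; lia.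
have [r [a [y ay]]] := loc_frac f_loc z.
have [|Lz thz] := @filtration_rep r z; first by exists a, y.
by split=> //; exists (- r%:Z), (r%:Z + 1).
Qed.

Lemma corner_dedekind : dedekind_domain (zcorner L 0).
Proof.
apply: (fixed_ring_dedekind (laurent_fixed_ring two_neq0 corner_repB corner_repM
  corner_rep1 corner_rep_inj corner_repP)).
Qed.

(** * The Hilbert function of the filtration *)

Local Notation act := (fun k => loc_scale f (sym_scalar K w 0 k)).

Lemma corner_rep_act k z : k \in qbase Q0 -> corner_rep (act k z) = mon k 0 * corner_rep z.
Proof.
move=> Kk; rewrite /corner_rep /loc_scale (loc_repM f_loc repB repM rep1 rep_g_unit).
rewrite (loc_rep_f f_loc repB repM rep1 rep_g_unit); congr (_ * _).
exact: (rep_scalar two_neq0 w_notin w_sqr Kk).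
Qed.

Lemma corner_theta z : theta (corner_rep z) = corner_rep z.
Proof. by have [] := (corner_repP (corner_rep z)).2 (ex_intro _ z erefl). Qed.

Lemma filtration_dim_base :
  has_dim (qbase Q0) act (loc_filtration g f 0) [set 0]%classic 1.
Proof.
exists (fun=> 1) => [_|z /filtrationP Lz].
  by apply/filtrationP; rewrite corner_rep1 -mon1E; exact: laurent_mon.
have zE : corner_rep z = mon (cf (corner_rep z) 0) 0.
  apply/eqP; rewrite -subr_eq0; apply/eqP.
  by apply: laurent_eq0 (laurent_top (n := 0) Lz).
set k := cf (corner_rep z) 0 in zE *.
have Kk : k \in qbase Q0.
  apply: (qconj_fixed two_neq0); have := corner_theta z; rewrite zE th.
  by move=> /(congr1 (fun u : E => cf u 0)); rewrite !cf_mon.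
exists [ffun=> k]; split.
  split=> [t|]; first by rewrite ffunE.
  rewrite big_ord1 ffunE; apply: corner_rep_inj.
  by rewrite corner_repB corner_rep_act // corner_rep1 mulr1 zE subrr corner_rep0.
move=> c [cK]; rewrite big_ord1 => e; apply/ffunP => t; rewrite ffunE (ord1 t).
have /(congr1 (fun u : E => cf u 0)) : corner_rep (z - act (c ord0) 1) = 0.
  by rewrite (e : _ = 0) corner_rep0.
rewrite corner_repB corner_rep_act // corner_rep1 mulr1 cfB cf_mon cf0 /= => /eqP.
by rewrite subr_eq0 => /eqP.
Qed.

(** The coefficient of [t^(n+1)] identifies the quotient with [F], which has the basis [1, w 0] over
    [K_0] when [Q0] is generated by [w 0]; in general the second element is [qgen Q0]. *)
Lemma filtration_dim_step n :
  has_dim (qbase Q0) act (loc_filtration g f n.+1) (loc_filtration g f n) 2.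
Proof.
pose v (t : 'I_2) := if t == ord0 then 1 else qgen Q0.
have /choice[b bP] : forall t, exists z, loc_filtration g f n.+1 z /\
    cf (corner_rep z) n.+1%:Z = v t.
  move=> t; have [||z Vz zE] := @filtration_surj n.+1
    (* The second monomial is the image of the first under [theta], which makes the sum
       invariant. *)
    (mon (v t) n.+1%:Z + mon (tau0 (v t)) (- n.+1%:Z)).
  - by apply: laurent_add; apply: laurent_mon; lia.
  - by rewrite thetaD !th opprK /= qconjK addrC.
  by exists z; split=> //; rewrite zE cfD !cf_mon eqxx /= addr0.
have cfE (c : {ffun 'I_2 -> F}) z : (forall t, c t \in qbase Q0) ->
    cf (corner_rep (z - \sum_t act (c t) (b t))) n.+1%:Z =
    cf (corner_rep z) n.+1%:Z - (c ord0 + c (fintype.lift ord0 ord0) * qgen Q0).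
  move=> cK; rewrite big_ord_recl big_ord1 corner_repB corner_repD !corner_rep_act //.
  have cfmon k x : loc_filtration g f n.+1 x ->
      cf (mon k 0 * corner_rep x) n.+1%:Z = k * cf (corner_rep x) n.+1%:Z.
    move=> /filtrationP Lx; have L0 : laurent 0 (0 + 1) (mon k 0) by exact: laurent_mon.
    by have := cf_top_mul L0 Lx; rewrite add0r cf_mon.
  by rewrite cfB cfD !(cfmon _ _ (bP _).1) !(bP _).2 /v /= mulr1.
have actV k x : k \in qbase Q0 -> loc_filtration g f n.+1 x ->
    laurent (- n.+1%:Z) (n.+1%:Z + 1) (corner_rep (act k x)).
  move=> Kk /filtrationP Lx; rewrite corner_rep_act //.
  have L0 : laurent 0 1 (mon k 0) by exact: laurent_mon.
  by apply: laurent_widen (laurent_mul L0 Lx); lia.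
exists b => [t|z Vz]; first exact: (bP t).1.
have Lz := (filtrationP _ _).1 Vz.
have [[p q] /= /andP[Kp Kq] zE] := qspan Q0 (cf (corner_rep z) n.+1%:Z).
exists [ffun t => if t == ord0 then p else q]; split.
  have cK t : [ffun t : 'I_2 => if t == ord0 then p else q] t \in qbase Q0.
    by rewrite ffunE; case: ifP.
  split=> //; apply/filtrationP.
  apply: (laurent_shrink two_neq0 (k := 0)); last first.
  - by rewrite cfE // zE !ffunE /= subrr.
  - by rewrite expr0 mul1r corner_theta.
  rewrite big_ord_recl big_ord1 corner_repB corner_repD.
  by apply: laurent_sub => //; apply: laurent_add; apply: actV => //; exact: (bP _).1.
move=> c [cK /filtrationP Lc].
have : cf (corner_rep (z - \sum_t act (c t) (b t))) n.+1%:Z = 0.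
  by apply: cf_laurent Lc _; lia.
rewrite cfE // zE => /eqP; rewrite subr_eq0 => /eqP e.
have [-> ->] := qcoord_uniq Kp Kq (cK _) (cK _) e.
apply/ffunP => t; rewrite ffunE; case: eqP => [->//|/eqP t0].
by congr (c _); apply/val_inj; case: t t0 => -[|[|]].
Qed.

Lemma corner_filtration_dim :
  filtration_dim (qbase Q0) act (loc_filtration g f) 1.
Proof.
exists (fun n => if n is 0 then 1 else 2)%N; split=> [[|n]|].
- exact: filtration_dim_base.
- exact: filtration_dim_step.
(* The values are [1, 2, 2, ...]: the polynomial is the constant 2, valid from [n = 1] on, and its
   degree 0 gives dimension 1. *)
exists 2%:P; split.
- by rewrite polyC_eq0.
- by exists 1%N => -[|n] // _; rewrite hornerC.
by rewrite size_polyC.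
Qed.
End Corner.

Theorem theorem1p2 (F : fieldType) (K0 K1 : divringClosed F) (w : int -> F)
    (hchar : 2%N \notin [pchar F])
    (hK0 : has_index K0 2) (hK1 : has_index K1 2)
    (hsimple : simple_bimodule K0 K1)
    (hw : forall i : int, [/\ w (i + 1) \notin alternate K0 K1 (i + 1),
                              w (i + 1) ^+ 2 \in alternate K0 K1 (i + 1) &
                              w (i + 1) \notin alternate K0 K1 i])
    (L : zalg)
    (f : forall i j, nc_sym (alternate K0 K1) w i j -> L i j)
    (hL : is_localisation (sym_g (alternate K0 K1) w) f) :
  dedekind_domain (zcorner L 0) /\
  filtration_dim K0
    (fun k => loc_scale f (sym_scalar (alternate K0 K1) w 0 k))
    (loc_filtration (sym_g (alternate K0 K1) w) f) 1.
Proof.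
have two_neq0 : (2%:R : F) != 0 by move: hchar; rewrite inE.
have w_notin i : w i \notin alternate K0 K1 i by have [] := hw (i - 1); rewrite subrK.
have w_sqr i : w i ^+ 2 \in alternate K0 K1 i by have [] := hw (i - 1); rewrite subrK.
have w_prev i : w (i + 1) \notin alternate K0 K1 i by have [] := hw i.
(* Among the [w i], those of index 0 and 1 serve as generators of [F] over [K0] and [K1]. *)
pose Q0 := Quadratic (w_notin 0) (w_sqr 0)
  (fun x => has_index2_span x hK0 (w_notin 0)).
pose Q1 := Quadratic (w_notin 1) (w_sqr 1)
  (fun x => has_index2_span x hK1 (w_notin 1)).
split.
  exact: (@corner_dedekind F Q0 Q1 two_neq0 w w_notin w_sqr w_prev L f hL).
exact: (@corner_filtration_dim F Q0 Q1 two_neq0 w w_notin w_sqr w_prev L f hL).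
Qed.
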